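(* Let $K$ be a knot in $S^3$ and let $X$ be a simply connected closed 4-manifold. Then $g_{ds}^X(K)\le g_{ds}^{S^4}(K)$.
   Context: Conventions: all manifolds are oriented, compact, connected and topological, and all embeddings are locally flat. A surface $S$ (properly) embedded in a 4-manifold $Y$ is a $\mathbb{Z}$-surface if $\pi_1(Y\smallsetminus S)\cong\mathbb{Z}$. For simply connected 4-manifolds $X_1,X_2$ with boundary $S^3$, $g_{X_1,X_2}(K)$ is the minimum of $\operatorname{genus}(F_1\cup_K F_2)$ over all properly embedded surfaces $F_i\subset X_i$ with $\partial F_i=K$, $i=1,2$, such that $F_1\cup_K F_2$ is a $\mathbb{Z}$-surface in $X_1\cup_{S^3}X_2$. For a simply connected closed 4-manifold $X$, the $X$-double slice genus $g_{ds}^X(K)$ is the minimum of $g_{X_1,X_2}(K)$ over all 4-manifolds $X_1,X_2$ with boundary $S^3$ such that $X=X_1\cup_{S^3}X_2$ (such $X_i$ are automatically simply connected). *)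

(* Defs.v *)
From HB Require Import structures.
From mathcomp Require Import all_boot all_order all_algebra generic_quotient.
From mathcomp Require Import all_classical all_reals all_analysis.
From Stdlib Require Import Relation_Operators Operators_Properties.

Import Order.TTheory GRing.Theory Num.Theory numFieldNormedType.Exports.
Local Open Scope classical_set_scope.
Local Open Scope ring_scope.

(* Homeomorphisms between subspaces [A] of [T] and [B] of [U]; the values of
   [f] outside [A] are irrelevant. *)
Definition homeomorphism {T U : topologicalType} (A : set T) (B : set U)
    (f : T -> U) : Prop :=
  [/\ set_bij A B f, {within A, continuous f} &
      exists2 g : U -> T, {within B, continuous g} & {in A, cancel f g}].

Definition homeomorphic {T U : topologicalType} (A : set T) (B : set U) : Prop :=
  exists f : T -> U, homeomorphism A B f.

Section quotient_by_relation.
Context {T : topologicalType} (r : T -> T -> Prop).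

Definition gen_equiv (x y : T) : bool := `[< clos_refl_sym_trans T r x y >].

Lemma gen_equiv_refl : reflexive gen_equiv.
Proof. by move=> x; apply/asboolP; exact: rst_refl. Qed.

Lemma gen_equiv_sym : symmetric gen_equiv.
Proof. by move=> x y; apply/asboolP/asboolP; exact: rst_sym. Qed.

Lemma gen_equiv_trans : transitive gen_equiv.
Proof.
by move=> y x z /asboolP xy /asboolP yz; apply/asboolP; exact: rst_trans xy yz.
Qed.

Definition gen_equiv_rel :=
  EquivRel gen_equiv gen_equiv_refl gen_equiv_sym gen_equiv_trans.

(* [T] modulo the equivalence relation generated by [r]. *)
Definition quotient_by : topologicalType :=
  quotient_topology {eq_quot gen_equiv_rel}%qT.

Definition quotient_map (x : T) : quotient_by :=
  (\pi_{eq_quot gen_equiv_rel} x)%qT.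

End quotient_by_relation.

(* The pushout of [f true : S -> Y true] and [f false : S -> Y false]. *)
Section gluing.
Context {S : Type} {Y : bool -> topologicalType} (f : forall b, S -> Y b).

Definition glue_step (p q : {b & Y b}) : Prop :=
  exists s : S, p = existT Y true (f true s) /\ q = existT Y false (f false s).

Definition glue : topologicalType := quotient_by glue_step.

Definition glue_in (b : bool) (y : Y b) : glue :=
  quotient_map glue_step (existT Y b y).

Definition glue_sets (F : forall b, set (Y b)) : set glue :=
  \bigcup_b (glue_in b @` F b).

End gluing.

Section topology_of_manifolds.
Variable R : realType.

(* The n-dimensional sphere, a subspace of R^{n+1}. *)
Definition sphere (n : nat) : topologicalType :=
  set_type [set v : 'rV[R]_n.+1 | \sum_i v ord0 i ^+ 2 = 1].

Definition unit_interval : set R := `[0, 1]%classic.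

(* The paths and homotopies below are only considered on [0, 1] and [0, 1]^2;
   their values elsewhere are irrelevant. *)
Section fundamental_group.
Context {T : topologicalType} (A : set T).

Definition paths (x y : T) : set (R -> T) :=
  [set g | [/\ {within unit_interval, continuous g}, g @` unit_interval `<=` A,
               g 0 = x & g 1 = y]].

Definition path_homotopic (x y : T) (g h : R -> T) : Prop :=
  exists H : R * R -> T,
    [/\ {within unit_interval `*` unit_interval, continuous H},
        H @` (unit_interval `*` unit_interval) `<=` A,
        forall s, unit_interval s -> H (s, 0) = g s /\ H (s, 1) = h s &
        forall t, unit_interval t -> H (0, t) = x /\ H (1, t) = y].

Definition path_concat (g h : R -> T) : R -> T :=
  fun t => if t <= 2^-1 then g (2 * t) else h (2 * t - 1).

Definition path_connected : Prop :=
  forall x y, A x -> A y -> paths x y !=set0.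

Definition loop_class (x : T) (g : R -> T) : set (R -> T) :=
  [set h | paths x x h /\ path_homotopic x x g h].

Definition pi1 (x : T) : set (set (R -> T)) := loop_class x @` paths x x.

Definition pi1_mul (x : T) (c d : set (R -> T)) : set (R -> T) :=
  [set h | exists g1 g2, [/\ c g1, d g2 & loop_class x (path_concat g1 g2) h]].

Definition pi1_trivial (x : T) : Prop := pi1 x = [set loop_class x (cst x)].

(* An isomorphism from pi_1(A, x) to the additive group of integers. *)
Definition pi1_isoZ (x : T) : Prop :=
  exists phi : set (R -> T) -> int,
    set_bij (pi1 x) [set: int] phi /\
    {in pi1 x &, forall c d, phi (pi1_mul x c d) = phi c + phi d}.

End fundamental_group.

Definition simply_connected (T : topologicalType) : Prop :=
  path_connected [set: T] /\ exists x : T, pi1_trivial [set: T] x.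

(* Charts of n-manifolds take values in the half-space [v_0 >= 0], n > 0. *)
Definition half_space (n : nat) : set 'rV[R]_n :=
  [set v | forall i : 'I_n, i = 0%N :> nat -> 0 <= v ord0 i].

Definition chart {M : topologicalType} {n : nat} (U : set M)
    (V : set 'rV[R]_n) (phi : M -> 'rV[R]_n) : Prop :=
  [/\ open U, exists2 W, open W & V = W `&` half_space n &
      homeomorphism U V phi].

(* Compact connected topological n-manifolds, possibly with boundary. *)
Definition compact_manifold (n : nat) (M : topologicalType) : Prop :=
  [/\ hausdorff_space M, @second_countable M, compact [set: M],
      connected [set: M] &
      forall x : M, exists U (V : set 'rV[R]_n) phi, U x /\ chart U V phi].

Definition manifold_boundary (n : nat) (M : topologicalType) : set M :=
  [set x | exists U (V : set 'rV[R]_n) phi, [/\ U x, chart U V phi &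
    forall i : 'I_n, i = 0%N :> nat -> phi x ord0 i = 0]].

Definition closed_manifold (n : nat) (M : topologicalType) : Prop :=
  compact_manifold n M /\ manifold_boundary n M = set0.

Definition flat_slice (n k : nat) : set 'rV[R]_n :=
  [set v | forall i : 'I_n, (k <= i)%N -> v ord0 i = 0].

(* [S] is a compact connected properly embedded locally flat k-dimensional
   submanifold of the compact n-manifold [M] (0 < k <= n).  Since the slices
   meet the boundary of the half-space transversally, the boundary of [S] is
   its intersection with the boundary of [M]. *)
Definition locally_flat_submanifold (n k : nat) {M : topologicalType}
    (S : set M) : Prop :=
  [/\ closed S, connected S &
      forall x, S x -> exists U (V : set 'rV[R]_n) phi,
        [/\ U x, chart U V phi & phi @` (S `&` U) = V `&` flat_slice n k]].

Definition knot (K : set (sphere 3)) : Prop :=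
  locally_flat_submanifold 3 1 K /\ homeomorphic K [set: sphere 1].

Definition disc : set 'rV[R]_2 := [set v | \sum_i v ord0 i ^+ 2 <= 1].

Definition circle_pt (t : R) : 'rV[R]_2 :=
  \row_i (if i == ord0 then cos (2 * pi * t) else sin (2 * pi * t)).

(* The circle is divided into 4g arcs, identified following the word
   a_1 b_1 a_1^-1 b_1^-1 ... a_g b_g a_g^-1 b_g^-1. *)
Definition polygon_step (g : nat) (p q : disc) : Prop :=
  exists (i : nat) (t : R), [/\ (i < g)%N, 0 <= t <= 1 &
    let e (a : R) := circle_pt (((4 * i)%:R + a) / (4 * g)%:R) in
    (set_val p = e t /\ set_val q = e (3 - t)) \/
    (set_val p = e (1 + t) /\ set_val q = e (4 - t))].

(* The closed oriented surface of genus g. *)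
Definition genus_surface (g : nat) : topologicalType :=
  if g is 0 then sphere 2 else quotient_by (polygon_step g).

(* Being homeomorphic to a model also says that [S] is orientable. *)
Definition has_genus {T : topologicalType} (S : set T) (g : nat) : Prop :=
  homeomorphic S [set: genus_surface g].

Definition Z_surface {Y : topologicalType} (S : set Y) : Prop :=
  locally_flat_submanifold 4 2 S /\
  path_connected (~` S) /\ exists2 x, (~` S) x & pi1_isoZ (~` S) x.

(* The minimum of a set of natural numbers, +oo if the set is empty. *)
Definition min_nat (P : set nat) : \bar R := ereal_inf [set (n%:R)%:E | n in P].

(* A compact connected 4-manifold together with an identification of its
   boundary with the 3-sphere. *)
Definition sphere_bounded {Y : topologicalType} (f : sphere 3 -> Y) : Prop :=
  compact_manifold 4 Y /\
  homeomorphism [set: sphere 3] (manifold_boundary 4 Y) f.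

(* g_{X_1, X_2}(K), where X_1 = Y true and X_2 = Y false.  The orientability of
   F_1 and F_2 follows from that of their union. *)
Definition glued_genus {Y : bool -> topologicalType}
    (f : forall b, sphere 3 -> Y b) (K : set (sphere 3)) : \bar R :=
  min_nat [set g | exists F : forall b, set (Y b),
    [/\ forall b, locally_flat_submanifold 4 2 (F b),
        forall b, F b `&` manifold_boundary 4 (Y b) = f b @` K,
        Z_surface (glue_sets f F) &
        has_genus (glue_sets f F) g]].

(* The infimum is a minimum, as all values are natural numbers or +oo.
   Orientations play no role for simply connected [X]: the pieces inherit an
   orientation from [X], for which exactly one of [f true] and [f false] is
   orientation preserving onto the oriented boundary, and exchanging the two
   pieces exchanges the two cases without changing the glued genus. *)
Definition double_slice_genus (X : topologicalType) (K : set (sphere 3)) :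
    \bar R :=
  ereal_inf [set e | exists (Y : bool -> topologicalType)
                            (f : forall b, sphere 3 -> Y b),
    [/\ forall b, sphere_bounded (f b),
        homeomorphic [set: X] [set: glue f] &
        e = glued_genus f K]].

End topology_of_manifolds.

(* Main.v *)
(** Write the 4-sphere as [Y_1] glued to [Y_2] along a 3-sphere, with a surface
[F] as in the definition of the double slice genus.  Choose a point [p] in the
interior of [Y_1], off [F].  Stereographic projection from [p] followed by a
chart of [X] embeds the 4-sphere minus [p] as an open subset of [X].  Keep the
copy of [Y_2] and replace [Y_1] by the complement in [X] of the interior of that
copy: this decomposes [X] along the same 3-sphere and contains a copy of [F].

The fundamental group of the complement of [F] is unchanged.  In the 4-sphere
one glues to the complement of [F] and [p] a ball around [p], and in [X] the
complement [V] of a large ball; both are simply connected and meet the rest in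
a collar homeomorphic to a punctured ball.  That [V] is simply connected follows
from the same van Kampen argument applied to [X], the union of [V] and the open
ball. *)

Require Import Defs.
From mathcomp Require Import all_boot all_order all_algebra.
From mathcomp Require Import all_classical all_reals all_analysis.
From mathcomp Require Import generic_quotient ring lra.
From Stdlib Require Import Relation_Operators Eqdep_dec.
Import Order.TTheory GRing.Theory Num.Theory numFieldNormedType.Exports.
Local Open Scope classical_set_scope.
Local Open Scope ring_scope.

(** * Continuity on subsets *)

(** Simple connectedness is used in the form [fillable]: four compatible paths in a set bound a
    square in it. On a fine grid this turns the van Kampen argument into replacing edges and
    refilling cells, without presentations of groups. The overlap is always a 4-ball without its
    centre, simply connected because the dimension is at least 3.

    The isomorphism with the integers is given at a base point, which must survive the removal of
    [p]; so [p] has to avoid that point too. The existence of [p] is not formal, as boundary points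
    are defined by the existence of a chart: it must be excluded that surface and boundary exhaust
    the piece. This would put a square of the surface inside the knot, a circle.

    The local structure of the new first piece is transported along homeomorphisms between open
    sets. Two of them cover the piece: one comes from [Y_1] without [p], the other from [X] without
    the copy of [Y_2]. The identification with the quotient that defines a gluing is made last, by a
    continuous bijection from a compact space to a Hausdorff one. *)

Lemma wcont_comp {T U W : topologicalType} (A : set T) (B : set U)
    (f : T -> U) (g : U -> W) :
  {within A, continuous f} -> (forall x, A x -> B (f x)) ->
  {within B, continuous g} -> {within A, continuous (fun x => g (f x))}.
Proof.
move=> /subspace_continuousP cf AB /subspace_continuousP cg.
apply/subspace_continuousP => x Ax P /= nP.
have [V nV VP] : exists2 V, nbhs (f x) V & (forall y, V y -> B y -> P (g y)).
  by exists [set y | B y -> P (g y)]; [exact: (cg _ (AB _ Ax) _ nP)|].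
have h := cf x Ax V nV.
by apply: filterS (h : nbhs x _) => y /= yV Ay; apply: VP (AB _ Ay); exact: yV.
Qed.

Lemma wcont_ext {T U : topologicalType} (A : set T) (f g : T -> U) :
  (forall x, A x -> f x = g x) ->
  {within A, continuous f} -> {within A, continuous g}.
Proof.
by move=> fg; apply: subspace_eq_continuous => x; rewrite inE => /fg.
Qed.

Section real_valued.
Context {R : realType} {T : topologicalType}.
Implicit Types f g : T -> R.

Lemma cont_add f g : continuous f -> continuous g -> continuous (fun x => f x + g x).
Proof. by move=> cf cg x; apply: cvgD; [exact: cf|exact: cg]. Qed.

Lemma cont_opp f : continuous f -> continuous (fun x => - f x).
Proof. by move=> cf x; apply: cvgN; exact: cf. Qed.

Lemma cont_mul f g : continuous f -> continuous g -> continuous (fun x => f x * g x).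
Proof. by move=> cf cg x; apply: cvgM; [exact: cf|exact: cg]. Qed.

Lemma cont_inv f : (forall x, f x != 0) -> continuous f -> continuous (fun x => (f x)^-1).
Proof. by move=> f0 cf x; apply: cvgV => //; exact: cf. Qed.

Lemma cont_norm f : continuous f -> continuous (fun x => `|f x|).
Proof. by move=> cf x; apply: cvg_norm; exact: cf. Qed.

Lemma cont_sqrt f : continuous f -> continuous (fun x => Num.sqrt (f x)).
Proof.
move=> cf x; apply: (@continuous_comp _ _ _ f Num.sqrt); first exact: cf.
exact: sqrt_continuous.
Qed.

Lemma cont_max f g : continuous f -> continuous g -> continuous (fun x => Num.max (f x) (g x)).
Proof. by move=> cf cg x; apply: continuous_max; [exact: cf|exact: cg]. Qed.

Lemma cont_min f g : continuous f -> continuous g -> continuous (fun x => Num.min (f x) (g x)).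
Proof. by move=> cf cg x; apply: continuous_min; [exact: cf|exact: cg]. Qed.

Lemma cont_sum {I : finType} (f : I -> T -> R) :
  (forall i, continuous (f i)) -> continuous (fun x => \sum_i f i x).
Proof.
move=> cf; have : forall r : seq I, continuous (fun x => \sum_(i <- r) f i x).
  elim=> [|i r IHr].
    by under eq_fun do rewrite big_nil; exact: cst_continuous.
  by under eq_fun do rewrite big_cons; apply: cont_add.
by apply.
Qed.

Lemma cont_row {n} (f : 'I_n -> T -> R) :
  (forall i, continuous (f i)) -> continuous (fun x => \row_i f i x : 'rV[R]_n).
Proof.
move=> cf x P /= [Q nQ QP].
have h j : \forall y \near x, Q ord0 j (f j y).
  by apply: cf; move: (nQ ord0 j); rewrite mxE.
have := filter_forall (nbhs_filter x) h; rewrite !near_simpl.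
by apply: filterS => y yQ; apply: QP => i j; rewrite mxE (ord1 i).
Qed.

Lemma cont_coord {n} (f : T -> 'rV[R]_n) i j :
  continuous f -> continuous (fun x => f x i j).
Proof.
move=> cf x; apply: (@continuous_comp _ _ _ f (fun M : 'rV[R]_n => M i j)).
  exact: cf.
exact: coord_continuous.
Qed.

End real_valued.

Lemma cont_fst {T U W : topologicalType} (f : T -> U * W) :
  continuous f -> continuous (fun x => (f x).1).
Proof.
move=> cf x; apply: (@continuous_comp _ _ _ f fst); first exact: cf.
exact: cvg_fst.
Qed.

Lemma cont_snd {T U W : topologicalType} (f : T -> U * W) :
  continuous f -> continuous (fun x => (f x).2).
Proof.
move=> cf x; apply: (@continuous_comp _ _ _ f snd); first exact: cf.
exact: cvg_snd.
Qed.

Lemma cont_pair {T U W : topologicalType} (f : T -> U) (g : T -> W) :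
  continuous f -> continuous g -> continuous (fun x => (f x, g x)).
Proof. by move=> cf cg x; apply: cvg_pair; [exact: cf|exact: cg]. Qed.

Lemma cont_id {T : topologicalType} : continuous (fun x : T => x).
Proof. by move=> x; exact: cvg_id. Qed.

Ltac cont_auto := try apply: continuous_subspaceT; repeat
  lazymatch goal with
  | |- continuous (fun _ => ?c) => exact: cst_continuous
  | |- continuous (fun x => (@?f x + @?g x)%R) => apply: (cont_add f g)
  | |- continuous (fun x => (@?f x * @?g x)%R) => apply: (cont_mul f g)
  | |- continuous (fun x => (- @?f x)%R) => apply: (cont_opp f)
  | |- continuous (fun x => `|@?f x|%R) => apply: (cont_norm f)
  | |- continuous (fun x => Num.max (@?f x) (@?g x)) => apply: (cont_max f g)
  | |- continuous (fun x => Num.min (@?f x) (@?g x)) => apply: (cont_min f g)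
  | |- continuous (fun x => (@?f x, @?g x)) => apply: (cont_pair f g)
  | |- continuous (fun x => (@?f x).1) => apply: (cont_fst f)
  | |- continuous (fun x => (@?f x).2) => apply: (cont_snd f)
  | |- continuous (fun x => x) => exact: cont_id
  | |- _ => first [ assumption | exact: (cont_fst _ cont_id) | exact: (cont_snd _ cont_id)
      | apply: cont_sqrt | apply: cont_coord | apply: cont_mul | apply: cont_add ]
  end.

Lemma closedX {T U : topologicalType} (A : set T) (B : set U) :
  closed A -> closed B -> closed (A `*` B).
Proof.
move=> cA cB; have -> : A `*` B = fst @^-1` A `&` snd @^-1` B by [].
by apply: closedI; apply: closed_comp => // x _; [exact: cvg_fst|exact: cvg_snd].
Qed.

Section pasting.
Context {R : realType} {T U : topologicalType}.

(** The pasting lemma: the two branches live on relatively closed halves of [A] that meet where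
    [p = q]. Piecewise paths and squares below are glued by it. *)
Lemma wcont_if (A : set T) (p q : T -> R) (f g : T -> U) :
  closed A -> continuous p -> continuous q ->
  {within A `&` [set x | p x <= q x], continuous f} ->
  {within A `&` [set x | q x <= p x], continuous g} ->
  (forall x, A x -> p x = q x -> f x = g x) ->
  {within A, continuous (fun x => if p x <= q x then f x else g x)}.
Proof.
move=> cA cp cq cf cg fg.
have cl (u v : T -> R) : continuous u -> continuous v ->
    closed [set x | u x <= v x].
  move=> cu cv.
  have -> : [set x | u x <= v x] = (fun x => v x - u x) @^-1` [set r | 0 <= r].
    by apply/seteqP; split=> x /=; rewrite subr_ge0.
  apply: closed_comp; last exact: closed_ge.
  by move=> x _; move: x; cont_auto.
have -> : A = (A `&` [set x | p x <= q x]) `|` (A `&` [set x | q x <= p x]).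
  rewrite -setIUr; apply/esym/setIidPl => x _ /=.
  by case: (leP (p x) (q x)) => [|/ltW]; [left|right].
apply: withinU_continuous.
- by apply: closedI => //; exact: cl.
- by apply: closedI => //; exact: cl.
- by apply: wcont_ext cf => x [_ /= ->].
- apply: wcont_ext cg => x [Ax /= qp]; case: leP => // pq.
  by rewrite fg//; apply/eqP; rewrite eq_le pq.
Qed.

End pasting.

(** * The unit interval, and squares placed side by side *)

Section squares.
Context {R : realType}.
Notation I := (unit_interval R).

Lemma unit0 : I 0. Proof. by rewrite /unit_interval/= in_itv/= lexx ler01. Qed.
Lemma unit1 : I 1. Proof. by rewrite /unit_interval/= in_itv/= lexx ler01. Qed.
Lemma unitE (t : R) : I t = (0 <= t <= 1).
Proof. by rewrite /unit_interval/= in_itv. Qed.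
Lemma closed_unit : closed I. Proof. exact: itv_closed. Qed.
Lemma compact_unit : compact I. Proof. exact: segment_compact. Qed.
Lemma compact_square : compact (I `*` I).
Proof. by apply: compact_setX; exact: compact_unit. Qed.
Lemma closed_square : closed (I `*` I).
Proof. by apply: closedX; exact: closed_unit. Qed.

Context {T : topologicalType}.

(** The induction appends one square at the right end of the strip and glues along the common
    vertical edge. Keeping unit width postpones the rescaling to [strip]. *)
Lemma strip_aux (G : nat -> R * R -> T) n :
  (forall i, (i <= n)%N -> {within I `*` I, continuous (G i)}) ->
  (forall i t, (i < n)%N -> I t -> G i (1, t) = G i.+1 (0, t)) ->
  exists H : R * R -> T,
    {within (`[0, n.+1%:R]%classic `*` I), continuous H} /\
    forall i s t, (i <= n)%N -> I s -> I t -> H (i%:R + s, t) = G i (s, t).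
Proof.
elim: n => [|n IHn] cG eG.
  exists (G 0%N); split; first exact: cG.
  by move=> i s t; rewrite leqn0 => /eqP -> _ _; rewrite add0r.
have [||H [cH HE]] := IHn.
- by move=> i ile; apply: cG; exact: leqW.
- by move=> i t ilt; apply: eG; exact: ltnW.
exists (fun z => if z.1 <= n.+1%:R then H z else G n.+1 (z.1 - n.+1%:R, z.2)).
split.
  apply: wcont_if.
  - by apply: closedX; [exact: itv_closed|exact: closed_unit].
  - by cont_auto.
  - by cont_auto.
  - apply: continuous_subspaceW cH => -[s t] [[/= + It] le1].
    by rewrite !in_itv/= => /andP[-> _].
  - apply: (@wcont_comp _ _ _ _ (I `*` I) (fun z : R * R => (z.1 - n.+1%:R, z.2))).
    + by cont_auto.
    + move=> [s t] [[/= + It] le1]; rewrite in_itv/= => /andP[_ s2]; split => //=.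
      rewrite unitE subr_ge0 le1/= lerBlDl; move: s2.
      by rewrite -natr1.
    + exact: cG.
  - move=> [s t] [/= _ It] ->; rewrite subrr -eG// -HE//; last exact: unit1.
    by rewrite natr1.
move=> i s t; rewrite leq_eqVlt => /predU1P[->|ilt] Is It /=.
  case: leP => [|_]; last by rewrite addrC addKr.
  rewrite gerDl => s0; have -> : s = 0.
    by apply/eqP; rewrite eq_le s0; move: Is; rewrite unitE => /andP[].
  rewrite -eG// -HE//; last exact: unit1.
  by rewrite natr1 addr0.
rewrite ifT; first exact: HE.
move: Is; rewrite unitE => /andP[_ s1].
by rewrite (le_trans (lerD (lexx _) s1))// natr1 ler_nat.
Qed.

Lemma strip (G : nat -> R * R -> T) n :
  (forall i, (i <= n)%N -> {within I `*` I, continuous (G i)}) ->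
  (forall i t, (i < n)%N -> I t -> G i (1, t) = G i.+1 (0, t)) ->
  exists H : R * R -> T,
    {within I `*` I, continuous H} /\
    forall i s t, (i <= n)%N -> I s -> I t ->
      H ((i%:R + s) / n.+1%:R, t) = G i (s, t).
Proof.
move=> cG eG; have [H [cH HE]] := strip_aux G n cG eG.
exists (fun z => H (n.+1%:R * z.1, z.2)); split.
  apply: (@wcont_comp _ _ _ _ ([set` `[(0 : R), n.+1%:R]] `*` I)
    (fun z : R * R => (n.+1%:R * z.1, z.2)) _ _ _ cH); first by cont_auto.
  move=> [s t] [/= Is It]; split => //=; move: Is; rewrite unitE in_itv/=.
  by move=> /andP[s0 s1]; rewrite mulr_ge0//= ler_piMr.
by move=> i s t ile Is It /=; rewrite mulrC divfK ?pnatr_eq0// HE.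
Qed.

End squares.

(** * Filling squares *)

Section filling.
Context {R : realType}.
Notation I := (unit_interval R).
Context {T : topologicalType}.

Definition path_in (A : set T) (g : R -> T) : Prop :=
  {within I, continuous g} /\ forall t, I t -> A (g t).

Definition square_in (A : set T) (H : R * R -> T) : Prop :=
  {within I `*` I, continuous H} /\ forall s t, I s -> I t -> A (H (s, t)).

Definition has_sides (b r u l : R -> T) (H : R * R -> T) : Prop :=
  forall t, I t -> [/\ H (t, 0) = b t, H (1, t) = r t, H (t, 1) = u t & H (0, t) = l t].

(* For path-connected [A] this says that [A] is simply connected. *)
Definition fillable (A : set T) : Prop :=
  forall b r u l, path_in A b -> path_in A r -> path_in A u -> path_in A l ->
    b 0 = l 0 -> b 1 = r 0 -> u 0 = l 1 -> u 1 = r 1 ->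
    exists2 H, square_in A H & has_sides b r u l H.

Lemma grid_unit n i (s : R) : (i <= n)%N -> I s -> I ((i%:R + s) / n.+1%:R).
Proof.
rewrite !unitE => ile /andP[s0 s1]; rewrite divr_ge0 ?addr_ge0//= ler_pdivrMr ?ltr0n//.
by rewrite mul1r -natr1 lerD// ler_nat.
Qed.

Lemma grid_shift n i : ((i%:R + 1) / n.+1%:R : R) = (i.+1%:R + 0) / n.+1%:R.
Proof. by rewrite addr0 natr1. Qed.

(** This is the Lebesgue number lemma. Near each point, and for large [n], the square of radius
    [1/(n+1)] is sent into [U] or into [V]; compactness makes a single [n] serve all points. *)
Lemma lebesgue_grid (U V : set T) (H : R * R -> T) :
  open U -> open V -> square_in (U `|` V) H ->
  exists n, forall i j, (i <= n)%N -> (j <= n)%N ->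
    (forall s t, I s -> I t ->
      U (H ((i%:R + s) / n.+1%:R, (j%:R + t) / n.+1%:R))) \/
    (forall s t, I s -> I t ->
      V (H ((i%:R + s) / n.+1%:R, (j%:R + t) / n.+1%:R))).
Proof.
move=> oU oV [cH HUV].
pose Q (W : set T) (n : nat) (x : R * R) := forall y, (I `*` I) y ->
  `|x.1 - y.1| <= n.+1%:R^-1 -> `|x.2 - y.2| <= n.+1%:R^-1 -> W (H y).
have nearQ (W : set T) x : open W -> (I `*` I) x -> W (H x) ->
    \forall x' \near x & n \near \oo, Q W n x'.
  move=> oW Ix Wx; move/subspace_continuousP: cH => /(_ x Ix W) cHx.
  have /cHx : nbhs (H x) W by exact: open_nbhs_nbhs.
  rewrite /fmap/= nbhs_simpl/= => /nbhs_ballP[e /= e0 eW].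
  (* Half of the radius is spent on moving the centre, the other half on the mesh width. *)
  have e20 : 0 < e / 2 by rewrite divr_gt0.
  exists (ball x (e / 2), [set n | n.+1%:R^-1 < e / 2]) => /=.
    split; first exact: nbhsx_ballx.
    exact: (near_infty_natSinv_lt (PosNum e20)).
  move=> [x' n] /= [[b1 b2] ne] y Iy y1 y2; apply: eW => //.
  have eE : e = e / 2 + e / 2 by lra.
  rewrite eE; split; apply: (ball_triangle (y := _)); [exact: b1| |exact: b2|];
    by apply: (le_lt_trans _ ne).
have [|n _ /= nP] := (compact_near_coveringP (I `*` I)).1 compact_square
    nat \oo (fun n x => Q U n x \/ Q V n x) _.
  move=> x Ix; case: (HUV x.1 x.2 Ix.1 Ix.2); rewrite -surjective_pairing => h.
    by apply: filterS (nearQ U x oU Ix h) => z; left.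
  by apply: filterS (nearQ V x oV Ix h) => z; right.
have {}nP := nP n (leqnn n).
exists n => i j ile jle.
(* Every point of a cell is within one mesh width of the lower left corner, so the property at the
   corner settles the cell. *)
have key (k : nat) (s : R) : I s ->
    `|(k%:R + 0) / n.+1%:R - (k%:R + s) / n.+1%:R| <= n.+1%:R^-1.
  rewrite unitE => /andP[s0 s1]; rewrite -mulrBl opprD addrACA subrr add0r add0r.
  rewrite normrM normrN (ger0_norm s0) normfV ger0_norm ?ler0n//.
  by rewrite ler_piMl// invr_ge0.
have [] := nP ((i%:R + 0) / n.+1%:R, (j%:R + 0) / n.+1%:R).
- by split; apply: grid_unit => //; exact: unit0.
- by move=> h; left=> s t Is It; apply: h; [split; exact: grid_unit|exact: key|exact: key].
- by move=> h; right=> s t Is It; apply: h; [split; exact: grid_unit|exact: key|exact: key].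
Qed.

Lemma cell_square_in (W : set T) (H : R * R -> T) n i j :
  {within I `*` I, continuous H} -> (i <= n)%N -> (j <= n)%N ->
  (forall s t, I s -> I t ->
      W (H ((i%:R + s) / n.+1%:R, (j%:R + t) / n.+1%:R))) ->
  square_in W (fun z => H ((i%:R + z.1) / n.+1%:R, (j%:R + z.2) / n.+1%:R)).
Proof.
move=> cH ile jle HW; split; last by [].
apply: (@wcont_comp _ _ _ _ (I `*` I)
  (fun z : R * R => ((i%:R + z.1) / n.+1%:R, (j%:R + z.2) / n.+1%:R)) _ _ _ cH).
  by cont_auto.
by move=> [s t] [/= Is It]; split; exact: grid_unit.
Qed.

Lemma grid_cover n (x : R) : I x ->
  exists i s, [/\ (i <= n)%N, I s & x = (i%:R + s) / n.+1%:R].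
Proof.
suff aux m (y : R) : 0 <= y <= m.+1%:R ->
    exists i s, [/\ (i <= m)%N, I s & y = i%:R + s].
  rewrite unitE => /andP[x0 x1]; have [|i [s [ile Is xE]]] := aux n (x * n.+1%:R).
    by rewrite mulr_ge0//= ler_piMl.
  by exists i, s; split => //; rewrite -xE mulfK// pnatr_eq0.
elim: m y => [|m IHm] y /andP[y0 y1].
  by exists 0%N, y; rewrite unitE y0 y1 add0r.
have [ym|/ltW my] := leP y m.+1%:R.
  have [|i [s [ile Is ->]]] := IHm y; first by rewrite y0.
  by exists i, s; split => //; exact: leqW.
exists m.+1, (y - m.+1%:R); rewrite unitE subr_ge0 my lerBlDl natr1; split => //.
by rewrite addrC subrK.
Qed.

(** Two passes of [strip]: the cells of each row are joined along the first coordinate, then the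
    rows are stacked with the coordinates exchanged. *)
Lemma grid_glue (A : set T) (n : nat) (C : nat -> nat -> R * R -> T) :
  (forall i j, (i <= n)%N -> (j <= n)%N -> square_in A (C i j)) ->
  (forall i j t, (i < n)%N -> (j <= n)%N -> I t -> C i j (1, t) = C i.+1 j (0, t)) ->
  (forall i j s, (i <= n)%N -> (j < n)%N -> I s -> C i j (s, 1) = C i j.+1 (s, 0)) ->
  exists2 H, square_in A H & forall i j s t, (i <= n)%N -> (j <= n)%N -> I s -> I t ->
    H ((i%:R + s) / n.+1%:R, (j%:R + t) / n.+1%:R) = C i j (s, t).
Proof.
move=> CA Ch Cv.
(* Stated for every [j], with a dummy beyond [n], so that [choice] gives a total family of rows. *)
have rowP j : exists G : R * R -> T, (j <= n)%N ->
    {within I `*` I, continuous G} /\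
    forall i s t, (i <= n)%N -> I s -> I t ->
      G ((i%:R + s) / n.+1%:R, t) = C i j (s, t).
  have [jle|_] := boolP (j <= n)%N; last by exists (C 0%N 0%N).
  have [||G GP] := strip (fun i => C i j) n; last by exists G.
  - by move=> i ile; case: (CA i j ile jle).
  - by move=> i t ilt It; apply: Ch.
have [G GP] := choice rowP.
have [||H [cH HE]] := strip (fun j z => G j (z.2, z.1)) n.
- move=> j jle; have [cG _] := GP j jle.
  apply: (@wcont_comp _ _ _ _ (I `*` I) (fun z : R * R => (z.2, z.1)) _ _ _ cG).
    by cont_auto.
  by move=> [s t] [].
- move=> j s jlt Is /=; have [i [s' [ile Is' ->]]] := grid_cover n s Is.
  have [_ ->//] := GP j (ltnW jlt); last exact: unit1.
  have [_ ->//] := GP j.+1 jlt; last exact: unit0.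
  exact: Cv.
have HCE i j s t : (i <= n)%N -> (j <= n)%N -> I s -> I t ->
    H ((j%:R + t) / n.+1%:R, (i%:R + s) / n.+1%:R) = C i j (s, t).
  move=> ile jle Is It; rewrite HE//=; last exact: grid_unit.
  by have [_ ->] := GP j jle.
exists (fun z => H (z.2, z.1)) => //; split.
  apply: (@wcont_comp _ _ _ _ (I `*` I) (fun z : R * R => (z.2, z.1)) _ _ _ cH).
    by cont_auto.
  by move=> [s t] [].
move=> s t Is It /=.
have [i [s' [ile Is' ->]]] := grid_cover n s Is.
have [j [t' [jle It' ->]]] := grid_cover n t It.
by rewrite HCE//; have [_] := CA i j ile jle; apply.
Qed.

End filling.

(** * Van Kampen's argument *)

Section van_kampen.
Context {R : realType}.
Notation I := (unit_interval R).
Context {T : topologicalType}.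

Lemma pathsE (A : set T) x y g :
  paths R A x y g <-> [/\ path_in (R := R) A g, g 0 = x & g 1 = y].
Proof.
split=> [[cg gA g0 g1]|[[cg gA] g0 g1]]; split => //.
  by split => // t It; apply: gA; exists t.
by move=> _ [t It <-]; exact: gA.
Qed.

(** One path is fixed for each pair of endpoints, so that two cells with a common edge replace it by
    the same path. *)
Lemma path_connected_choice (A : set T) : path_connected R A ->
  exists q : T -> T -> R -> T, forall x y, A x -> A y ->
    [/\ path_in A (q x y), q x y 0 = x & q x y 1 = y].
Proof.
move=> cA; have h (p : T * T) : exists g : R -> T, A p.1 -> A p.2 ->
    [/\ path_in A g, g 0 = p.1 & g 1 = p.2].
  have [A1|nA] := pselect (A p.1); last by exists (cst p.1).
  have [A2|nA] := pselect (A p.2); last by exists (cst p.1).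
  by have [g /pathsE gP] := cA _ _ A1 A2; exists g.
have [q qP] := choice h; exists (fun x y => q (x, y)) => x y; exact: (qP (x, y)).
Qed.

Lemma path_inS (A B : set T) (g : R -> T) : A `<=` B -> path_in A g -> path_in B g.
Proof. by move=> AB [cg gA]; split => // t /gA /AB. Qed.

Lemma square_inS (A B : set T) (H : R * R -> T) :
  A `<=` B -> square_in A H -> square_in B H.
Proof. by move=> AB [cH HA]; split => // s t Is It; exact/AB/HA. Qed.

Lemma path_in_cst (A : set T) x : A x -> path_in (R := R) A (cst x).
Proof. by move=> Ax; split => //; apply: continuous_subspaceT; exact: cst_continuous. Qed.

Lemma square_side1 (A : set T) (H : R * R -> T) t :
  square_in A H -> I t -> path_in A (fun s => H (s, t)).
Proof.
move=> [cH HA] It; split; last by move=> s Is; exact: HA.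
apply: (@wcont_comp _ _ _ _ (I `*` I) (fun s : R => (s, t)) _ _ _ cH); first by cont_auto.
by [].
Qed.

Context (U V : set T).
Hypotheses (oU : open U) (oV : open V) (cP : path_connected R (U `&` V))
  (P0 : U `&` V !=set0).

(* On a fine grid, a cell that [H] does not send into [U] is sent into [V]; it is
   refilled inside [U `&` V]. *)
Lemma van_kampen_square (H : R * R -> T) : fillable (R := R) (U `&` V) ->
  square_in (U `|` V) H ->
  (forall t, I t -> [/\ U (H (t, 0)), U (H (1, t)), U (H (t, 1)) & U (H (0, t))]) ->
  exists2 H', square_in U H' &
    has_sides (fun t => H (t, 0)) (fun t => H (1, t))
              (fun t => H (t, 1)) (fun t => H (0, t)) H'.
Proof.
move=> fP sH bH; have [zz Pzz] := P0; have [q qP] := path_connected_choice _ cP.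
have [n nP] := lebesgue_grid _ _ _ oU oV sH.
have [cH HUV] := sH.
pose gx (i : nat) (s : R) := (i%:R + s) / n.+1%:R.
have gxS i : gx i 1 = gx i.+1 0 by exact: grid_shift.
have gx0 : gx 0%N 0 = 0 by rewrite /gx addr0 mul0r.
have gx1 : gx n.+1 0 = 1 by rewrite /gx addr0 divff// pnatr_eq0.
have Igx i s : (i <= n)%N -> I s -> I (gx i s) by exact: grid_unit.
have Igx' i : (i <= n.+1)%N -> I (gx i 0).
  rewrite leq_eqVlt => /predU1P[->|]; last by move=> h; apply: Igx => //; exact: unit0.
  by rewrite gx1; exact: unit1.
have I0 := @unit0 R. have I1 := @unit1 R.
(* The modified grid: a vertex outside [U] moves to the point [zz] of the overlap, and an edge not
   contained in [U] becomes the chosen path in the overlap. The test depends on the edge alone, so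
   neighbouring cells agree. *)
pose v i j := H (gx i 0, gx j 0).
pose z i j := if `[< U (v i j) >] then v i j else zz.
pose hU i j := forall s, I s -> U (H (gx i s, gx j 0)).
pose hV i j := forall s, I s -> V (H (gx i s, gx j 0)).
pose eh i j : R -> T := if `[< hU i j >] then fun s => H (gx i s, gx j 0)
                         else q (z i j) (z i.+1 j).
pose vU i j := forall t, I t -> U (H (gx i 0, gx j t)).
pose vV i j := forall t, I t -> V (H (gx i 0, gx j t)).
pose ev i j : R -> T := if `[< vU i j >] then fun t => H (gx i 0, gx j t)
                         else q (z i j) (z i j.+1).
have zU i j : U (v i j) -> z i j = v i j by move=> h; rewrite /z asboolT.
have zP i j : V (v i j) -> (U `&` V) (z i j).
  by rewrite /z; case: asboolP.
(* Index [n.+1] belongs to no cell; its edges lie on a side of the square, which [bH] places in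
   [U]. *)
have hcell i j : (i <= n)%N -> (j <= n.+1)%N -> hU i j \/ hV i j.
  move=> ile; rewrite leq_eqVlt => /predU1P[->|jlt].
    left=> s Is; rewrite gx1; have [_ _ //] := bH (gx i s) (Igx _ _ ile Is).
  by have [h|h] := nP i j ile jlt; [left|right] => s Is; exact: h.
have vcell i j : (i <= n.+1)%N -> (j <= n)%N -> vU i j \/ vV i j.
  move=> + jle; rewrite leq_eqVlt => /predU1P[->|ilt].
    left=> s Is; rewrite gx1; have [_ //] := bH (gx j s) (Igx _ _ jle Is).
  by have [h|h] := nP i j ilt jle; [left|right] => s Is; exact: h.
have ehE i j : (i <= n)%N -> (j <= n.+1)%N ->
    [/\ path_in U (eh i j), (hV i j -> path_in (U `&` V) (eh i j)),
        eh i j 0 = z i j & eh i j 1 = z i.+1 j].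
  move=> ile jle; rewrite /eh; case: asboolP => [hUij|nhU].
    have [cp _] : path_in U (fun s => H (gx i s, gx j 0)).
      split => //.
      apply: (@wcont_comp _ _ _ _ (I `*` I) (fun s : R => (gx i s, gx j 0)) _ _ _ cH).
        by rewrite /gx; cont_auto.
      by move=> s Is; split; [exact: Igx|exact: Igx'].
    split.
    - by split.
    - by move=> h; split => // s Is; split; [exact: hUij|exact: h].
    - by rewrite zU// /v; exact: hUij.
    - by rewrite zU// /v -gxS//; exact: hUij.
  have [//|hVij] := hcell i j ile jle.
  have z1 : (U `&` V) (z i j) by apply: zP; exact: hVij.
  have z2 : (U `&` V) (z i.+1 j) by apply: zP; rewrite /v -gxS; exact: hVij.
  have [qP1 qP2 qP3] := qP _ _ z1 z2; split => //.
  by apply: path_inS qP1 => x [].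
have evE i j : (i <= n.+1)%N -> (j <= n)%N ->
    [/\ path_in U (ev i j), (vV i j -> path_in (U `&` V) (ev i j)),
        ev i j 0 = z i j & ev i j 1 = z i j.+1].
  move=> ile jle; rewrite /ev; case: asboolP => [vUij|nvU].
    have [cp _] : path_in U (fun s => H (gx i 0, gx j s)).
      split => //.
      apply: (@wcont_comp _ _ _ _ (I `*` I) (fun s : R => (gx i 0, gx j s)) _ _ _ cH).
        by rewrite /gx; cont_auto.
      by move=> s Is; split; [exact: Igx'|exact: Igx].
    split.
    - by split.
    - by move=> h; split => // s Is; split; [exact: vUij|exact: h].
    - by rewrite zU// /v; exact: vUij.
    - by rewrite zU// /v -gxS//; exact: vUij.
  have [//|vVij] := vcell i j ile jle.
  have z1 : (U `&` V) (z i j) by apply: zP; exact: vVij.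
  have z2 : (U `&` V) (z i j.+1) by apply: zP; rewrite /v -gxS; exact: vVij.
  have [qP1 qP2 qP3] := qP _ _ z1 z2; split => //.
  by apply: path_inS qP1 => x [].
have CP (ij : nat * nat) : exists C : R * R -> T, (ij.1 <= n)%N -> (ij.2 <= n)%N ->
    square_in U C /\ has_sides (eh ij.1 ij.2) (ev ij.1.+1 ij.2)
      (eh ij.1 ij.2.+1) (ev ij.1 ij.2) C.
  case: ij => i j /=.
  have [ile|_] := boolP (i <= n)%N; last by exists H.
  have [jle|_] := boolP (j <= n)%N; last by exists H.
  (* In a cell inside [U] no edge was modified and [H] is kept. In a cell inside [V] the kept edges
     lie in [U] as well as in [V], and the new ones lie in the overlap; all four are therefore in
     the overlap, where [fP] fills them. *)
  have [cU|cV] := nP i j ile jle.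
    exists (fun z => H (gx i z.1, gx j z.2)) => _ _; split; first exact: cell_square_in.
    rewrite /has_sides => t It /=; rewrite /eh /ev !asboolT ?gxS// => s Is; rewrite -?gxS; exact: cU.
  have [C sC bC] : exists2 C, square_in (U `&` V) C &
      has_sides (eh i j) (ev i.+1 j) (eh i j.+1) (ev i j) C.
    have [_ h1 h2 h3] := ehE i j ile (leqW jle).
    have [_ h4 h5 h6] := ehE i j.+1 ile jle.
    have [_ h7 h8 h9] := evE i j (leqW ile) jle.
    have [_ h10 h11 h12] := evE i.+1 j ile jle.
    apply: fP.
    - by apply: h1 => s Is; exact: cV.
    - by apply: h10 => s Is; rewrite -gxS; exact: cV.
    - by apply: h4 => s Is; rewrite -gxS; exact: cV.
    - by apply: h7 => s Is; exact: cV.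
    - by rewrite h2 h8.
    - by rewrite h3 h11.
    - by rewrite h5 h9.
    - by rewrite h6 h12.
  by exists C => _ _; split => //; apply: square_inS sC => x [].
have [C {}CP] := choice CP.
have [|||H' sH' HE] := grid_glue U n (fun i j => C (i, j)).
- by move=> i j ile jle; have [] := CP (i, j) ile jle.
- move=> i j t ilt jle It.
  have [_ /(_ t It) [_ -> _ _]] := CP (i, j) (ltnW ilt) jle.
  by have [_ /(_ t It) [_ _ _ ->]] := CP (i.+1, j) ilt jle.
- move=> i j t ile jlt It.
  have [_ /(_ t It) [_ _ -> _]] := CP (i, j) ile (ltnW jlt).
  by have [_ /(_ t It) [-> _ _ _]] := CP (i, j.+1) ile jlt.
exists H' => // t It; have [i [s [ile Is ->]]] := grid_cover n t It.
(* Edges on the four sides lie in [U], hence were not modified: [H'] has the sides of [H]. *)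
have [b1 b2 b3 b4] : [/\ hU i 0%N, vU n.+1 i, hU i n.+1 & vU 0%N i].
  split=> r Ir; rewrite ?gx0 ?gx1; have [//] := bH (gx i r) (Igx _ _ ile Ir).
split.
- have := HE i 0%N s 0 ile (leq0n _) Is I0; rewrite -/(gx 0%N 0) gx0 => ->.
  have [_ /(_ s Is) [-> _ _ _]] := CP (i, 0%N) ile (leq0n _).
  by rewrite /= /eh asboolT// gx0.
- have := HE n i 1 s (leqnn _) ile I1 Is; rewrite -/(gx n 1) gxS gx1 => ->.
  have [_ /(_ s Is) [_ -> _ _]] := CP (n, i) (leqnn _) ile.
  by rewrite /= /ev asboolT// gx1.
- have := HE i n s 1 ile (leqnn _) Is I1; rewrite -/(gx n 1) gxS gx1 => ->.
  have [_ /(_ s Is) [_ _ -> _]] := CP (i, n) ile (leqnn _).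
  by rewrite /= /eh asboolT// gx1.
- have := HE 0%N i 0 s (leq0n _) ile I0 Is; rewrite -/(gx 0%N 0) gx0 => ->.
  have [_ /(_ s Is) [_ _ _ ->]] := CP (0%N, i) (leq0n _) ile.
  by rewrite /= /ev asboolT// gx0.
Qed.

(* The pieces of [g] that leave [U] are pushed, through [V], into [U `&` V]. *)
Lemma van_kampen_path (g : R -> T) : path_connected R V -> fillable (R := R) V ->
  path_in (U `|` V) g -> U (g 0) -> U (g 1) ->
  exists2 g', paths R U (g 0) (g 1) g' &
    path_homotopic R (U `|` V) (g 0) (g 1) g g'.
Proof.
move=> cV fV [cg gUV] g0U g1U.
have [zz Pzz] := P0; have [q qP] := path_connected_choice _ cP.
have [r rP] := path_connected_choice _ cV.
have [n nP] : exists n, forall i, (i <= n)%N ->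
    (forall s, I s -> U (g ((i%:R + s) / n.+1%:R))) \/
    (forall s, I s -> V (g ((i%:R + s) / n.+1%:R))).
  (* The subdivision of the path comes from the square that is constant in the second coordinate. *)
  have [|n nP] := lebesgue_grid U V (fun z => g z.1) oU oV.
    split; last by move=> s t Is It; exact: gUV.
    apply: (@wcont_comp _ _ _ _ I (fun z : R * R => z.1) _ _ _ cg); first by cont_auto.
    by move=> [s t] [].
  exists n => i ile; have [h|h] := nP i 0%N ile (leq0n _); [left|right] => s Is;
    by apply: (h s 0) => //; exact: unit0.
pose gx (i : nat) (s : R) := (i%:R + s) / n.+1%:R.
have gxS i : gx i 1 = gx i.+1 0 by exact: grid_shift.
have gx0 : gx 0%N 0 = 0 by rewrite /gx addr0 mul0r.
have gx1 : gx n.+1 0 = 1 by rewrite /gx addr0 divff// pnatr_eq0.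
have Igx i s : (i <= n)%N -> I s -> I (gx i s) by exact: grid_unit.
have I0 := @unit0 R. have I1 := @unit1 R.
(* [z i] is the new position of a subdivision point, [v i] a path from the old position to the new
   one (constant inside [U], otherwise through [V]), and [w i] the new piece of the path. *)
pose z i := if `[< U (g (gx i 0)) >] then g (gx i 0) else zz.
pose v i := if `[< U (g (gx i 0)) >] then cst (g (gx i 0)) else r (g (gx i 0)) zz.
pose w i := if `[< forall s, I s -> U (g (gx i s)) >] then (fun s => g (gx i s))
            else q (z i) (z i.+1).
have zP i : V (g (gx i 0)) -> (U `&` V) (z i) by rewrite /z; case: asboolP.
have vP i : V (g (gx i 0)) -> [/\ path_in V (v i), v i 0 = g (gx i 0) & v i 1 = z i].
  move=> Vi; rewrite /v /z; case: asboolP => [Ui|nUi].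
    by split => //; exact: path_in_cst.
  by apply: rP => //; case: Pzz.
have cgi i : (i <= n)%N -> {within I, continuous (fun s => g (gx i s))}.
  move=> ile; apply: (@wcont_comp _ _ _ _ I (gx i) _ _ _ cg).
    by rewrite /gx; cont_auto.
  by move=> s Is; exact: Igx.
have wP i : (i <= n)%N ->
    [/\ path_in U (w i),
        (forall s, I s -> V (g (gx i s))) -> path_in V (w i),
        w i 0 = z i & w i 1 = z i.+1].
  move=> ile; rewrite /w; case: asboolP => [Ui|nUi].
    split => //; first by split => //; exact: cgi.
    - by move=> Vi; split => //; exact: cgi.
    - by rewrite /z asboolT//; exact: Ui.
    - by rewrite gxS /z asboolT//; rewrite -gxS; exact: Ui.
  have [//|Vi] := nP i ile.
  have z1 : (U `&` V) (z i) by apply: zP; exact: Vi.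
  have z2 : (U `&` V) (z i.+1) by apply: zP; rewrite -gxS; exact: Vi.
  have [q1 q2 q3] := qP _ _ z1 z2; split => //.
    by apply: path_inS q1 => x [].
  by move=> _; apply: path_inS q1 => x [].
have CP i : exists C : R * R -> T, (i <= n)%N ->
    square_in (U `|` V) C /\
    has_sides (fun s => g (gx i s)) (v i.+1) (w i) (v i) C.
  have [ile|_] := boolP (i <= n)%N; last by exists (fun => zz).
  have [Ui|Vi] := nP i ile.
    exists (fun z => g (gx i z.1)) => _; split.
      split; last by move=> s t Is It; left; exact: Ui.
      apply: (@wcont_comp _ _ _ _ I (fun z : R * R => z.1) _ _ _ (cgi i ile)).
        by cont_auto.
      by move=> [s t] [].
    move=> t It; rewrite /w /v !asboolT//=; first by split => //; rewrite gxS.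
      exact: Ui.
    by rewrite -gxS; exact: Ui.
  (* The old piece, the two connecting paths and the new piece all lie in [V], so [fV] supplies the
     homotopy between the pieces. *)
  have [C sC bC] : exists2 C, square_in V C &
      has_sides (fun s => g (gx i s)) (v i.+1) (w i) (v i) C.
    have Vi' : V (g (gx i.+1 0)) by rewrite -gxS; exact: Vi.
    have [w1 w2 w3 w4] := wP i ile.
    have [v1 v2 v3] := vP i (Vi _ I0).
    have [v1' v2' v3'] := vP i.+1 Vi'.
    apply: fV => //.
    - by split => //; exact: cgi.
    - exact: w2.
    - by rewrite gxS v2'.
    - by rewrite w3.
    - by rewrite w4.
  by exists C => _; split => //; apply: square_inS sC => x; right.
have [C {}CP] := choice CP.
have [||H [cH HE]] := strip C n.
- by move=> i ile; have [[]] := CP i ile.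
- move=> i t ilt It.
  have [_ /(_ t It) [_ -> _ _]] := CP i (ltnW ilt).
  by have [_ /(_ t It) [_ _ _ ->]] := CP i.+1 ilt.
have sH : square_in (U `|` V) H.
  split => // s t Is It; have [i [s' [ile Is' ->]]] := grid_cover n s Is.
  by rewrite HE//; have [[_ h] _] := CP i ile; exact: h.
(* The endpoints of [g] lie in [U], so the connecting paths there are constant and the homotopy
   fixes the endpoints. *)
have H0 t : I t -> H (0, t) = g 0.
  move=> It; have := HE 0%N 0 t (leq0n _) I0 It; rewrite -/(gx 0%N 0) gx0 => ->.
  have [_ /(_ t It) [_ _ _ ->]] := CP 0%N (leq0n _).
  by rewrite /v gx0 asboolT.
have H1 t : I t -> H (1, t) = g 1.
  move=> It; have := HE n 1 t (leqnn _) I1 It; rewrite -/(gx n 1) gxS gx1 => ->.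
  have [_ /(_ t It) [_ -> _ _]] := CP n (leqnn _).
  by rewrite /v gx1 asboolT.
exists (fun s => H (s, 1)).
  rewrite pathsE H0// H1//; split => //; split.
    by have [] := square_side1 _ _ _ sH I1.
  move=> s Is; have [i [s' [ile Is' ->]]] := grid_cover n s Is.
  rewrite HE//; have [_ /(_ s' Is') [_ _ -> _]] := CP i ile.
  by have [[_ wU] _ _ _] := wP i ile; exact: wU.
exists H; split => //.
- by move=> _ [[s t] [/= Is It] <-]; case: sH => _ h; exact: h.
- move=> s Is; split => //; have [i [s' [ile Is' ->]]] := grid_cover n s Is.
  by rewrite HE//; have [_ /(_ s' Is') [-> _ _ _]] := CP i ile.
- by move=> t It; rewrite H0// H1.
Qed.

End van_kampen.

(** * Simply connected sets *)

Ltac unit_lra := rewrite ?unitE; try (apply/andP; split); lra.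

Section free_homotopies.
Context {R : realType}.
Notation I := (unit_interval R).
Context {T : topologicalType}.

Lemma path_comp (A : set T) (J : set R) (g : R -> T) (a : R -> R) :
  path_in A g -> continuous a -> (forall t, J t -> I (a t)) ->
  {within J, continuous (fun t => g (a t))}.
Proof.
move=> [cg _] ca aI; apply: (@wcont_comp _ _ _ _ I a _ _ _ cg) => //.
exact: continuous_subspaceT.
Qed.

Lemma square_comp {S : topologicalType} (A : set T) (J : set S) (H : R * R -> T) (a : S -> R * R) :
  square_in A H -> continuous a -> (forall t, J t -> I (a t).1 /\ I (a t).2) ->
  {within J, continuous (fun t => H (a t))}.
Proof.
move=> [cH _] ca aI; apply: (@wcont_comp _ _ _ _ (I `*` I) a _ _ _ cH) => //.
exact: continuous_subspaceT.
Qed.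

Section based.
Context (A : set T) (x0 : T).
Hypotheses (cA : path_connected R A) (Ax0 : A x0)
  (null : forall g, paths R A x0 x0 g -> path_homotopic R A x0 x0 g (cst x0)).

(** The closed path is joined to the base point by [c], and the null-homotopy of the conjugated loop
    is reparametrised. [K] is a disc in polar form: the first coordinate runs along the boundary and
    the second is the depth, so the lateral sides coincide and the top is collapsed to [x0]. *)
Lemma free_null (d : R -> T) : path_in A d -> d 0 = d 1 ->
  exists2 K, square_in A K & forall t, I t ->
    [/\ K (t, 0) = d t, K (t, 1) = x0 & K (0, t) = K (1, t)].
Proof.
move=> pd d01; have I0 := @unit0 R; have I1 := @unit1 R.
have Ad0 : A (d 0) by case: pd => _; apply.
have [c /pathsE[pc c0 c1]] := cA _ _ Ax0 Ad0.
pose g t := if 3 * t <= 1 then c (3 * t) else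
            if 3 * t <= 2 then d (3 * t - 1) else c (3 - 3 * t).
have pg : paths R A x0 x0 g.
  apply/pathsE; split.
  - split.
      apply: wcont_if.
      + exact: closed_unit.
      + by cont_auto.
      + by cont_auto.
      + apply: (path_comp _ _ _ _ pc); first by cont_auto.
        by move=> t [/=]; rewrite unitE => /andP[t0 t1] ?; unit_lra.
      + apply: wcont_if.
        * apply: closedI; first exact: closed_unit.
          have -> : [set x : R | 1 <= 3 * x] = (fun x => 3 * x) @^-1` [set y | 1 <= y] by [].
          by apply: closed_comp; [move=> x _; move: x; cont_auto|exact: closed_ge].
        * by cont_auto.
        * by cont_auto.
        * apply: (path_comp _ _ _ _ pd); first by cont_auto.
          by move=> t [[/=]]; rewrite unitE => /andP[t0 t1] ? ?; unit_lra.
        * apply: (path_comp _ _ _ _ pc); first by cont_auto.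
          by move=> t [[/=]]; rewrite unitE => /andP[t0 t1] ? ?; unit_lra.
        * move=> t [] _ _ e; rewrite e (_ : 2 - 1 = 1); last by lra.
          by rewrite (_ : 3 - 2 = 1) ?c1 ?d01//; lra.
      + move=> t _ e; rewrite e ifT; last by lra.
        by rewrite subrr c1.
    move=> t; rewrite unitE => /andP[t0 t1]; rewrite /g; case: leP => h.
      by case: pc => _; apply; unit_lra.
    by case: leP => h'; [case: pd => _; apply; unit_lra|case: pc => _; apply; unit_lra].
  - by rewrite /g mulr0 ler01.
  - by rewrite /g mulr1 !ifF ?subrr//; lra.
have [G [cG AG G1 G2]] := null _ pg.
have sG : square_in A G.
  by split => // s t Is It; apply: AG; exists (s, t).
(* [q] maps the bottom side onto the middle third of the null-homotopic loop, the
   lateral sides onto its outer thirds, and the top side onto the other three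
   sides of the homotopy, where it is constant. *)
pose q (z : R * R) : R * R :=
  ((1 - z.2) * ((1 + z.1) / 3) + z.2 * Num.min 1 (Num.max 0 (3 * z.1 - 1)),
   z.2 * Num.min 1 (Num.min (3 * z.1) (3 - 3 * z.1))).
have qI s t : I s -> I t -> I (q (s, t)).1 /\ I (q (s, t)).2.
  rewrite !unitE => /andP[s0 s1] /andP[t0 t1] /=.
  set m := Num.min 1 (Num.max _ _); set m' := Num.min 1 (Num.min _ _).
  have /andP[m0 m1] : 0 <= m <= 1.
    by rewrite /m le_min ler01 le_max lexx ge_min lexx.
  have /andP[m'0 m'1] : 0 <= m' <= 1.
    rewrite /m' !le_min ler01 ge_min lexx/= andbT; apply/andP; split; lra.
  split; last by rewrite mulr_ge0//= mulr_ile1.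
  apply/andP; split; nra.
have Ksq : square_in A (fun z => G (q z)).
  split.
    apply: (square_comp _ _ _ q sG); last by move=> [s t] [/= Is It]; exact: qI.
    by rewrite /q; cont_auto.
  by move=> s t Is It; case: sG => _ h; rewrite (surjective_pairing (q _)); apply: h; case: (qI s t Is It).
exists (fun z => G (q z)) => // t It; have := It; rewrite unitE => /andP[t0 t1].
split.
- have -> : q (t, 0) = ((1 + t) / 3, 0).
    by rewrite /q /=; congr (_, _); ring.
  have It' : I ((1 + t) / 3) by unit_lra.
  have [-> _] := G1 _ It'; rewrite /g mulrC divfK ?pnatr_eq0//.
  case: leP => h.
    have -> : t = 0 by lra.
    by rewrite addr0 c1.
  case: leP => h'; last by (have : (1 : R) < 0 by lra); rewrite ltr10.
  by congr d; ring.
- have -> : q (t, 1) = (Num.min 1 (Num.max 0 (3 * t - 1)), Num.min 1 (Num.min (3 * t) (3 - 3 * t))).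
    by rewrite /q /=; congr (_, _); ring.
  have [h|h] := leP (3 * t) 1.
    have -> : Num.max 0 (3 * t - 1) = 0 by apply/max_idPl; lra.
    have -> : Num.min 1 0 = 0 :> R by apply/min_idPr; lra.
    set m := Num.min 1 _.
    have Im : I m.
      by rewrite unitE /m !le_min ler01 ge_min lexx/= andbT; apply/andP; split; lra.
    by case: (G2 m Im).
  have [h'|h'] := leP 2 (3 * t).
    have -> : Num.max 0 (3 * t - 1) = 3 * t - 1 by apply/max_idPr; lra.
    have -> : Num.min 1 (3 * t - 1) = 1 :> R by apply/min_idPl; lra.
    set m := Num.min 1 _.
    have Im : I m.
      by rewrite unitE /m !le_min ler01 ge_min lexx/= andbT; apply/andP; split; lra.
    by case: (G2 m Im).
  have -> : Num.min 1 (Num.min (3 * t) (3 - 3 * t)) = 1.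
    by apply/min_idPl; rewrite le_min; apply/andP; split; lra.
  set m := Num.min 1 _.
  have Im : I m.
    by rewrite unitE /m !le_min ler01 le_max lexx/= ge_min lexx.
  by case: (G1 m Im).
(* Each lateral side runs through an outer third of [g], in both cases along [c] backwards, so the
   two sides coincide. *)
- have e0 : q (0, t) = ((1 - t) / 3, 0).
    rewrite /q /=; congr (_, _).
      have -> : Num.max 0 (3 * 0 - 1) = 0 :> R by apply/max_idPl; lra.
      have -> : Num.min 1 0 = 0 :> R by apply/min_idPr; lra.
      by ring.
    have -> : Num.min (3 * 0) (3 - 3 * 0) = 0 :> R.
      by rewrite mulr0; apply/min_idPl; lra.
    have -> : Num.min 1 0 = 0 :> R by apply/min_idPr; lra.
    by ring.
  have e1 : q (1, t) = (1 - (1 - t) / 3, 0).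
    rewrite /q /=; congr (_, _).
      have -> : Num.max 0 (3 * 1 - 1) = 2 :> R.
        by rewrite (_ : 3 * 1 - 1 = 2); [apply/max_idPr; lra|ring].
      have -> : Num.min 1 2 = 1 :> R by apply/min_idPl; lra.
      by field.
    have -> : Num.min (3 * 1) (3 - 3 * 1) = 0 :> R.
      by rewrite mulr1 subrr; apply/min_idPr; lra.
    have -> : Num.min 1 0 = 0 :> R by apply/min_idPr; lra.
    by ring.
  rewrite e0 e1.
  have Ia : I ((1 - t) / 3) by unit_lra.
  have Ib : I (1 - (1 - t) / 3) by unit_lra.
  have [-> _] := G1 _ Ia; have [-> _] := G1 _ Ib; rewrite /g.
  have -> : 3 * ((1 - t) / 3) = 1 - t by field.
  have -> : 3 * (1 - (1 - t) / 3) = 2 + t by field.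
  rewrite ifT; last by lra.
  rewrite ifF; last by apply/negbTE; rewrite -ltNge; lra.
  case: leP => h; last by congr c; ring.
  have -> : t = 0 by lra.
  by rewrite subr0 addr0 c1 (_ : 2 - 1 = 1) ?d01//; ring.
Qed.

End based.
End free_homotopies.

Section filling_simply_connected.
Context {R : realType}.
Notation I := (unit_interval R).
Context {T : topologicalType}.
Implicit Types (A : set T) (b r u l : R -> T).

Definition perimeter b r u l (t : R) : T :=
  if 4 * t <= 2 then (if 4 * t <= 1 then b (4 * t) else r (4 * t - 1))
  else (if 4 * t <= 3 then u (3 - 4 * t) else l (4 - 4 * t)).

(** The perimeter is run counterclockwise from the corner (0, 0), a quarter of the time per side. As
    [u] goes to the right and [l] upwards, these two are run backwards. *)
Lemma path_in_perimeter A b r u l :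
  path_in A b -> path_in A r -> path_in A u -> path_in A l ->
  b 1 = r 0 -> u 0 = l 1 -> u 1 = r 1 -> path_in A (perimeter b r u l).
Proof.
move=> pb pr pu pl br ul ur; split; last first.
  move=> t; rewrite unitE /perimeter => /andP[t0 t1].
  case: leP => h; case: leP => h'.
  - by case: pb => _; apply; unit_lra.
  - by case: pr => _; apply; unit_lra.
  - by case: pu => _; apply; unit_lra.
  - by case: pl => _; apply; unit_lra.
have cle (c : R) : closed [set t : R | 4 * t <= c].
  have -> : [set t : R | 4 * t <= c] = (fun x => 4 * x) @^-1` [set y | y <= c] by [].
  by apply: closed_comp; [move=> x _; move: x; cont_auto|exact: closed_le].
have cge (c : R) : closed [set t : R | c <= 4 * t].
  have -> : [set t : R | c <= 4 * t] = (fun x => 4 * x) @^-1` [set y | c <= y] by [].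
  by apply: closed_comp; [move=> x _; move: x; cont_auto|exact: closed_ge].
apply: wcont_if; [exact: closed_unit|by cont_auto|by cont_auto| | |].
- apply: wcont_if; [by apply: closedI; [exact: closed_unit|]|by cont_auto|by cont_auto| | |].
  + apply: (path_comp _ _ _ _ pb); first by cont_auto.
    by move=> t [[/=]]; rewrite unitE => /andP[t0 t1] ? ?; unit_lra.
  + apply: (path_comp _ _ _ _ pr); first by cont_auto.
    by move=> t [[/=]]; rewrite unitE => /andP[t0 t1] ? ?; unit_lra.
  + by move=> t _ ->; rewrite subrr.
- apply: wcont_if; [by apply: closedI; [exact: closed_unit|]|by cont_auto|by cont_auto| | |].
  + apply: (path_comp _ _ _ _ pu); first by cont_auto.
    by move=> t [[/=]]; rewrite unitE => /andP[t0 t1] ? ?; unit_lra.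
  + apply: (path_comp _ _ _ _ pl); first by cont_auto.
    by move=> t [[/=]]; rewrite unitE => /andP[t0 t1] ? ?; unit_lra.
  + by move=> t _ ->; rewrite subrr ul; congr l; ring.
- move=> t _ ->; rewrite ifF; last by lra.
  rewrite ifT; last by lra.
  have -> : (2 - 1 : R) = 1 by ring.
  by have -> : (3 - 2 : R) = 1 by ring.
Qed.

Lemma perimeterE b r u l t : I t ->
  b 1 = r 0 -> u 0 = l 1 -> u 1 = r 1 ->
  [/\ perimeter b r u l (t / 4) = b t,
      perimeter b r u l ((1 + t) / 4) = r t,
      perimeter b r u l ((3 - t) / 4) = u t &
      perimeter b r u l ((4 - t) / 4) = l t].
Proof.
rewrite unitE /perimeter => /andP[t0 t1] br ul ur.
have mE (x : R) : 4 * (x / 4) = x by field.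
rewrite !mE; split.
- by rewrite !ifT//; lra.
- rewrite ifT; last by lra.
  case: leP => h; last by congr r; ring.
  have -> : t = 0 by lra.
  by rewrite addr0.
- case: leP => h.
    have -> : t = 1 by lra.
    rewrite ifF; last by lra.
    by rewrite ur; congr r; ring.
  rewrite ifT; last by lra.
  by congr u; ring.
- rewrite ifF; last by lra.
  case: leP => h; last by congr l; ring.
  have -> : t = 1 by lra.
  by rewrite -ul; congr u; ring.
Qed.

(* The square is folded into four triangles with common vertex its centre,
   each of them mapped to [K] by (position along the boundary, depth). *)
Lemma free_null_fill A x0 b r u l K :
  square_in A K ->
  (forall t, I t -> [/\ K (t, 0) = perimeter b r u l t, K (t, 1) = x0 &
                        K (0, t) = K (1, t)]) ->
  b 1 = r 0 -> u 0 = l 1 -> u 1 = r 1 ->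
  exists2 H, square_in A H & has_sides b r u l H.
Proof.
move=> sK KE br ul ur.
(* [d] is the distance to the boundary in the maximum norm, and [1 - 2 d] the side of the concentric
   square through the point. The depth [e] already reaches 1 at [d = 1/4]: the central square of
   half size goes to [x0], and bounding [D] below by 1/2 avoids the division by zero at the
   centre. *)
pose d (z : R * R) := Num.min (Num.min z.1 (1 - z.1)) (Num.min z.2 (1 - z.2)).
pose D z := Num.max 2^-1 (1 - 2 * d z).
pose e z := Num.min 1 (4 * d z).
have cd : continuous d by rewrite /d; cont_auto.
have cD : continuous (fun z => (D z)^-1).
  apply: cont_inv; last by rewrite /D; cont_auto.
  by move=> z; rewrite gt_eqF// lt_max invr_gt0 ltr0n.
(* Relative positions along the sides of the concentric square. *)
pose px z := (z.1 - d z) * (D z)^-1.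
pose py z := (z.2 - d z) * (D z)^-1.
have dP s t : I s -> I t -> let z := (s, t) in
    [/\ 0 <= d z, d z <= s, d z <= 1 - s, d z <= t & d z <= 1 - t].
  rewrite !unitE => /andP[s0 s1] /andP[t0 t1] z; split.
  - by rewrite /d !le_min /= s0 t0 !subr_ge0 s1 t1.
  - by rewrite /d !ge_min lexx.
  - by rewrite /d !ge_min lexx orbT.
  - by rewrite /d !ge_min lexx !orbT.
  - by rewrite /d !ge_min lexx !orbT.
have dge s t c : c <= s -> c <= 1 - s -> c <= t -> c <= 1 - t -> c <= d (s, t).
  by move=> h1 h2 h3 h4; rewrite /d !le_min h1 h2 h3 h4.
have eI s t : I s -> I t -> I (e (s, t)).
  move=> Is It; have [d0 _ _ _ _] := dP s t Is It.
  by rewrite unitE /e le_min ler01 mulr_ge0//= ge_min lexx.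
have DP z : 0 < D z /\ 1 - 2 * d z <= D z.
  by rewrite /D lt_max invr_gt0 ltr0n le_max lexx orbT.
have pxI s t : I s -> I t -> 0 <= px (s, t) <= 1.
  move=> Is It; have [d0 d1 d2 d3 d4] := dP s t Is It; have [D0 D1] := DP (s, t).
  rewrite /px; apply/andP; split; [apply: divr_ge0 => /=; lra|rewrite ler_pdivrMr //=; lra].
have pyI s t : I s -> I t -> 0 <= py (s, t) <= 1.
  move=> Is It; have [d0 d1 d2 d3 d4] := dP s t Is It; have [D0 D1] := DP (s, t).
  rewrite /py; apply/andP; split; [apply: divr_ge0 => /=; lra|rewrite ler_pdivrMr //=; lra].
(* The four triangles in the order bottom, right, left, top. *)
pose F z := if z.2 <= z.1
  then (if z.2 <= 1 - z.1 then K (px z / 4, e z) else K ((1 + py z) / 4, e z))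
  else (if z.2 <= 1 - z.1 then K ((4 - py z) / 4, e z) else K ((3 - px z) / 4, e z)).
have args s t : I s -> I t -> [/\ I (px (s, t) / 4), I ((1 + py (s, t)) / 4),
    I ((4 - py (s, t)) / 4) & I ((3 - px (s, t)) / 4)].
  move=> Is It; have /andP[? ?] := pxI s t Is It; have /andP[? ?] := pyI s t Is It.
  by rewrite !unitE; split; apply/andP; split; lra.
have branch (a : R * R -> R) : continuous a ->
    (forall s t, I s -> I t -> I (a (s, t))) -> forall J, J `<=` I `*` I ->
    {within J, continuous (fun z => K (a z, e z))}.
  move=> ca aI J JI; apply: (square_comp _ _ _ (fun z => (a z, e z)) sK).
    by rewrite /e; cont_auto.
  by move=> [s t] /JI[Is It]; split; [exact: aI|exact: eI].
have sF : square_in A F.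
  split; last first.
    move=> s t Is It; rewrite /F /=; have [a1 a2 a3 a4] := args s t Is It.
    by case: sK => _ KA; case: ifP => _; case: ifP => _; apply: KA => //; exact: eI.
  have cl1 : closed ((I `*` I) `&` [set x : R * R | x.2 <= x.1]).
    apply: closedI; first exact: closed_square.
    have -> : [set x : R * R | x.2 <= x.1] = (fun x => x.1 - x.2) @^-1` [set y | 0 <= y].
      by apply/seteqP; split=> x /=; rewrite subr_ge0.
    by apply: closed_comp; [move=> x _; move: x; cont_auto|exact: closed_ge].
  have cl2 : closed ((I `*` I) `&` [set x : R * R | x.1 <= x.2]).
    apply: closedI; first exact: closed_square.
    have -> : [set x : R * R | x.1 <= x.2] = (fun x => x.2 - x.1) @^-1` [set y | 0 <= y].
      by apply/seteqP; split=> x /=; rewrite subr_ge0.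
    by apply: closed_comp; [move=> x _; move: x; cont_auto|exact: closed_ge].
  have central z : (I `*` I) z -> 4^-1 <= d z -> forall a, I a -> K (a, e z) = x0.
    move=> _ dz a Ia; have -> : e z = 1 by apply/min_idPl; lra.
    by case: (KE a Ia).
  have outer z : (I `*` I) z -> d z <= 4^-1 -> D z = 1 - 2 * d z.
    by move=> _ dz; apply/max_idPr; lra.
  apply: wcont_if; [exact: closed_square|by cont_auto|by cont_auto| | |].
  - apply: wcont_if; [by []|by cont_auto|by cont_auto| | |].
    + apply: branch; [by rewrite /px; cont_auto| |by move=> z [[]]].
      by move=> s t Is It; case: (args s t Is It).
    + apply: branch; [by rewrite /py; cont_auto| |by move=> z [[]]].
      by move=> s t Is It; case: (args s t Is It).
    + move=> [s t] [[/= Is It] ts] tE.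
      have [a1 a2 a3 a4] := args s t Is It.
      have [dz|dz] := leP (d (s, t)) 4^-1; last by rewrite !central// ltW.
      have D1 := outer (s, t) (conj Is It) dz.
      have dE : d (s, t) = t.
        have [_ _ _ h _] := dP s t Is It; apply: le_anti; rewrite h/=.
        by apply: dge; move: (ts : t <= s) (tE : t = 1 - s); lra.
      congr (K (_, _)); congr (_ / _).
      rewrite /px /py D1 dE /= subrr mul0r addr0 -[RHS](@divff _ (1 - 2 * t)); last first.
        by apply/eqP; lra.
      by congr (_ / _); lra.
  - apply: wcont_if; [by []|by cont_auto|by cont_auto| | |].
    + apply: branch; [by rewrite /py; cont_auto| |by move=> z [[]]].
      by move=> s t Is It; case: (args s t Is It).
    + apply: branch; [by rewrite /px; cont_auto| |by move=> z [[]]].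
      by move=> s t Is It; case: (args s t Is It).
    + move=> [s t] [[/= Is It] ts] tE.
      have [a1 a2 a3 a4] := args s t Is It.
      have [dz|dz] := leP (d (s, t)) 4^-1; last by rewrite !central// ltW.
      have D1 := outer (s, t) (conj Is It) dz.
      have dE : d (s, t) = s.
        have [_ h _ _ _] := dP s t Is It; apply: le_anti; rewrite h/=.
        by apply: dge; move: (ts : s <= t) (tE : t = 1 - s); lra.
      congr (K (_, _)); congr (_ / _).
      rewrite /px /py D1 dE /= subrr mul0r subr0.
      suff -> : (t - s) / (1 - 2 * s) = 1 by ring.
      rewrite -[RHS](@divff _ (1 - 2 * s)); last by apply/eqP; lra.
      by congr (_ / _); lra.
  (* On the lower half of this diagonal the perimeter parameter is 0 on one side and 1 on the other,
     where the lateral sides of [K] agree; on the upper half it is 1/2 on both. *)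
  - move=> [s t] [/= Is It] tE; rewrite -{}tE in Is *; have [a1 a2 a3 a4] := args t t It It.
    have [dz|dz] := leP (d (t, t)) 4^-1; last by case: ifP => _; rewrite !central// ltW.
    have D1 := outer (t, t) (conj It It) dz.
    case: leP => h.
      have dE : d (t, t) = t.
        have [_ q _ _ _] := dP t t It It; apply: le_anti; rewrite q/=.
        by apply: dge; move: h; lra.
      rewrite /px /py dE /= subrr !mul0r subr0 divff//.
      by have [_ _ ->] := KE _ (eI t t It It).
    have dE : d (t, t) = 1 - t.
      have [_ _ q _ _] := dP t t It It; apply: le_anti; rewrite q/=.
      by apply: dge; move: h; lra.
    congr (K (_, _)); congr (_ / _).
    have -> : py (t, t) = 1.
      rewrite /py D1 dE /= -[RHS](@divff _ (1 - 2 * (1 - t))); last by apply/eqP; lra.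
      by congr (_ / _); lra.
    have -> : px (t, t) = 1.
      rewrite /px D1 dE /= -[RHS](@divff _ (1 - 2 * (1 - t))); last by apply/eqP; lra.
      by congr (_ / _); lra.
    by ring.
exists F => // t It; have It' := It; rewrite unitE in It'.
have /andP[t0 t1] := It'.
have [p1 p2 p3 p4] := perimeterE b r u l t It br ul ur.
have I0 := @unit0 R; have I1 := @unit1 R.
have bd z : d z = 0 -> e z = 0 /\ D z = 1.
  move=> dz; rewrite /e /D dz !mulr0 subr0; split; first by apply/min_idPr; lra.
  by apply/max_idPr; lra.
have dz0 s s' : I s -> I s' -> (s = 0 \/ s = 1) \/ (s' = 0 \/ s' = 1) -> d (s, s') = 0.
  move=> Is Is' hs; have [d0 d1 d2 d3 d4] := dP s s' Is Is'.
  apply/eqP; rewrite eq_le d0 andbT; case: hs => -[] h; lra.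
have vals z : (I `*` I) z -> d z = 0 -> forall a, I a -> K (a, e z) = perimeter b r u l a.
  by move=> Iz dz a Ia; have [-> _] := bd z dz; case: (KE a Ia).
have per0 : perimeter b r u l 0 = b 0.
  by have [h _ _ _] := perimeterE b r u l 0 I0 br ul ur; rewrite mul0r in h.
have bl : b 0 = l 0.
  have [h _ _ h'] := perimeterE b r u l 0 I0 br ul ur.
  rewrite mul0r in h; rewrite subr0 divff ?pnatr_eq0// in h'.
  by rewrite -h -h'; have [<- _ _] := KE 0 I0; have [<- _ _] := KE 1 I1; case: (KE 0 I0).
split; rewrite /F /=.
- have dz := dz0 t 0 It I0 (or_intror (or_introl erefl)).
  have [_ D1] := bd _ dz.
  rewrite t0 subr_ge0 t1 vals//; last by case: (args t 0 It I0).
  by rewrite /px dz D1 /= subr0 divr1.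
- have dz := dz0 1 t I1 It (or_introl (or_intror erefl)).
  have [_ D1] := bd _ dz; have [a1 a2 a3 a4] := args 1 t I1 It.
  rewrite t1 subrr; case: leP => h; last first.
    by rewrite vals// /py dz D1 /= subr0 divr1.
  have t00 : t = 0 by lra.
  rewrite vals// /px dz D1 /= subr0 divr1 t00 -br.
  by have [-> _] := perimeterE b r u l 1 I1 br ul ur.
- have dz := dz0 t 1 It I1 (or_intror (or_intror erefl)).
  have [_ D1] := bd _ dz; have [a1 a2 a3 a4] := args t 1 It I1.
  rewrite /px /py in a1 a2 a3 a4 *; rewrite dz D1 !subr0 !divr1 in a1 a2 a3 a4 *.
  have [_ q2 _ _] := perimeterE b r u l 1 I1 br ul ur.
  have [_ _ _ q4] := perimeterE b r u l 1 I1 br ul ur.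
  rewrite [1 <= 1 - t]lerBrDr gerDl; case: (leP 1 t) => h; case: (leP t 0) => h'.
  + by exfalso; have /negP := ltr10 R; apply; lra.
  + rewrite vals//=; have -> : t = 1 by lra.
    by rewrite q2 ur.
  + rewrite vals//=; have -> : t = 0 by lra.
    by rewrite q4 ul.
  + by rewrite vals.
- have dz := dz0 0 t I0 It (or_introl (or_introl erefl)).
  have [_ D1] := bd _ dz; have [a1 a2 a3 a4] := args 0 t I0 It.
  rewrite /px /py in a1 a2 a3 a4 *; rewrite dz D1 !subr0 !divr1 in a1 a2 a3 a4 *.
  case: leP => h.
    rewrite t1 vals//= mul0r per0.
    by have -> : t = 0 by lra.
  by rewrite t1 vals.
Qed.

(** Contracting loops at one base point is enough: the perimeter of the four paths is closed,
    [free_null] contracts it, and [free_null_fill] folds the contraction into a square. *)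
Lemma simply_connected_fillable A x0 :
  path_connected R A -> A x0 ->
  (forall g, paths R A x0 x0 g -> path_homotopic R A x0 x0 g (cst x0)) ->
  fillable (R := R) A.
Proof.
move=> cA Ax0 null b r u l pb pr pu pl bl br ul ur.
have pp := path_in_perimeter A b r u l pb pr pu pl br ul ur.
have I0 := @unit0 R; have I1 := @unit1 R.
have p01 : perimeter b r u l 0 = perimeter b r u l 1.
  have [h _ _ h'] := perimeterE b r u l 0 I0 br ul ur.
  rewrite mul0r in h; rewrite subr0 divff ?pnatr_eq0// in h'.
  by rewrite h h'.
have [K sK KE] := free_null A x0 cA Ax0 null _ pp p01.
exact: free_null_fill sK KE br ul ur.
Qed.

End filling_simply_connected.

(** * Fundamental groups *)

Section path_algebra.
Context {R : realType}.
Notation I := (unit_interval R).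
Context {T : topologicalType}.
Implicit Types (A : set T) (g h k : R -> T).

Lemma path_in_comp A g (a : R -> R) : path_in A g -> continuous a ->
  (forall t, I t -> I (a t)) -> path_in A (fun t => g (a t)).
Proof.
move=> pg ca aI; split; first exact: (path_comp _ _ _ _ pg).
by case: pg => _ gA t /aI /gA.
Qed.

Lemma square_in_comp A (H : R * R -> T) (a : R * R -> R * R) : square_in A H -> continuous a ->
  (forall s t, I s -> I t -> I (a (s, t)).1 /\ I (a (s, t)).2) ->
  square_in A (fun z => H (a z)).
Proof.
move=> sH ca aI; split.
  by apply: (square_comp _ _ _ _ sH) => // -[s t] [/= Is It]; exact: aI.
move=> s t Is It; have [a1 a2] := aI s t Is It.
by rewrite (surjective_pairing (a _)); case: sH => _ h; exact: h.
Qed.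

Lemma path_homotopicP A x y g h : path_homotopic R A x y g h <->
  exists2 H, square_in A H & has_sides g (cst y) h (cst x) H.
Proof.
split=> [[H [cH HA H1 H2]]|[H [cH HA] bH]]; exists H => //.
- by split => // s t Is It; apply: HA; exists (s, t).
- by move=> t It; have [h1 h2] := H1 t It; have [h3 h4] := H2 t It.
- split => //.
  + by move=> _ [[s t] [/= Is It] <-]; exact: HA.
  + by move=> s Is; have [] := bH s Is.
  + by move=> t It; have [] := bH t It.
Qed.

Lemma path_homotopic_refl A x y g : paths R A x y g -> path_homotopic R A x y g g.
Proof.
move=> /pathsE[pg g0 g1]; apply/path_homotopicP; exists (fun z => g z.1).
  split; last by move=> s t Is It; case: pg => _; apply.
  apply: (@wcont_comp _ _ _ _ I (fun z : R * R => z.1) _ _ _ (proj1 pg)); first by cont_auto.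
  by move=> [s t] [].
by move=> t It /=; rewrite g0 g1.
Qed.

Lemma path_homotopic_sym A x y g h :
  path_homotopic R A x y g h -> path_homotopic R A x y h g.
Proof.
move=> /path_homotopicP[H sH bH]; apply/path_homotopicP.
exists (fun z => H (z.1, 1 - z.2)).
  apply: (square_in_comp _ _ (fun z => (z.1, 1 - z.2)) sH); first by cont_auto.
  by move=> s t Is It; split => //=; move: It; rewrite unitE => /andP[? ?]; unit_lra.
move=> t It /=; have It' : I (1 - t) by move: It; rewrite unitE => /andP[? ?]; unit_lra.
have [h1 _ h3 _] := bH t It; have [_ h2 _ h4] := bH _ It'.
by rewrite subr0 subrr; split.
Qed.

Lemma path_homotopic_trans A x y g h k : path_homotopic R A x y g h ->
  path_homotopic R A x y h k -> path_homotopic R A x y g k.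
Proof.
move=> /path_homotopicP[H sH bH] /path_homotopicP[G sG bG]; apply/path_homotopicP.
have I0 := @unit0 R; have I1 := @unit1 R.
have HG s : I s -> H (s, 1) = G (s, 0).
  by move=> Is; have [_ _ -> _] := bH s Is; have [-> _ _ _] := bG s Is.
exists (fun z => if 2 * z.2 <= 1 then H (z.1, 2 * z.2) else G (z.1, 2 * z.2 - 1)).
  split; last first.
    move=> s t Is; rewrite unitE => /andP[t0 t1] /=; case: leP => ht.
      by case: sH => _; apply => //; unit_lra.
    by case: sG => _; apply => //; unit_lra.
  apply: wcont_if; [exact: closed_square|by cont_auto|by cont_auto| | |].
  - apply: (square_comp _ _ _ _ sH); first by cont_auto.
    move=> [s t] [[/= Is]]; rewrite unitE => /andP[t0 t1] ht; split => //.
    by unit_lra.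
  - apply: (square_comp _ _ _ _ sG); first by cont_auto.
    move=> [s t] [[/= Is]]; rewrite unitE => /andP[t0 t1] ht; split => //.
    by unit_lra.
  - by move=> [s t] [/= Is It] ->; rewrite subrr HG.
move=> t It /=; have := It; rewrite unitE => /andP[t0 t1].
have [h1 _ _ _] := bH t It; have [_ _ g3 _] := bG t It.
have sd : (if 2 * t <= 1 then H (1, 2 * t) else G (1, 2 * t - 1)) = y /\
  (if 2 * t <= 1 then H (0, 2 * t) else G (0, 2 * t - 1)) = x.
  case: leP => ht.
    have It' : I (2 * t) by unit_lra.
    by have [_ -> _ ->] := bH _ It'.
  have It' : I (2 * t - 1) by unit_lra.
  by have [_ -> _ ->] := bG _ It'.
case: sd => -> ->; rewrite mulr0 ler01 h1; split => //.
rewrite mulr1 ifF; last by lra.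
by rewrite (_ : 2 - 1 = 1) ?g3//; ring.
Qed.

Lemma path_concatE g h : g 1 = h 0 ->
  path_concat R g h = fun t => if 2 * t <= 1 then g (2 * t) else h (2 * t - 1).
Proof.
move=> gh; apply/funext => t; rewrite /path_concat.
have -> : (t <= 2^-1) = (2 * t <= 1); last by [].
by rewrite -[2^-1]mul1r ler_pdivlMr// mulrC.
Qed.

Lemma paths_concat A x y z g h : paths R A x y g -> paths R A y z h ->
  paths R A x z (path_concat R g h).
Proof.
move=> /pathsE[pg g0 g1] /pathsE[ph h0 h1]; rewrite path_concatE ?g1//.
apply/pathsE; split.
- split; last first.
    move=> t; rewrite unitE => /andP[t0 t1]; case: leP => ht.
      by case: pg => _; apply; unit_lra.
    by case: ph => _; apply; unit_lra.
  apply: wcont_if; [exact: closed_unit|by cont_auto|by cont_auto| | |].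
  + apply: (path_comp _ _ _ _ pg); first by cont_auto.
    by move=> t [/=]; rewrite unitE => /andP[t0 t1] ?; unit_lra.
  + apply: (path_comp _ _ _ _ ph); first by cont_auto.
    by move=> t [/=]; rewrite unitE => /andP[t0 t1] ?; unit_lra.
  + by move=> t _ ->; rewrite g1 subrr h0.
- by rewrite mulr0 ler01 g0.
- rewrite mulr1 ifF; last by lra.
  by rewrite (_ : 2 - 1 = 1) ?h1//; ring.
Qed.

Lemma paths_rev A x y g : paths R A x y g -> paths R A y x (fun t => g (1 - t)).
Proof.
move=> /pathsE[pg g0 g1]; apply/pathsE; rewrite subr0 subrr; split => //.
apply: path_in_comp => //; first by cont_auto.
by move=> t; rewrite !unitE => /andP[? ?]; unit_lra.
Qed.

Lemma path_homotopic_concat A x y z g g' h h' :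
  path_homotopic R A x y g g' -> path_homotopic R A y z h h' ->
  path_homotopic R A x z (path_concat R g h) (path_concat R g' h').
Proof.
move=> /path_homotopicP[H sH bH] /path_homotopicP[G sG bG]; apply/path_homotopicP.
have I0 := @unit0 R; have I1 := @unit1 R.
have HG t : I t -> H (1, t) = G (0, t).
  by move=> It; have [_ -> _ _] := bH t It; have [_ _ _ ->] := bG t It.
have gh : g 1 = h 0.
  have [<- _ _ _] := bH 1 I1; have [<- _ _ _] := bG 0 I0; exact: HG.
have gh' : g' 1 = h' 0.
  have [_ _ <- _] := bH 1 I1; have [_ _ <- _] := bG 0 I0; exact: HG.
rewrite !path_concatE//.
exists (fun z => if 2 * z.1 <= 1 then H (2 * z.1, z.2) else G (2 * z.1 - 1, z.2)).
  split; last first.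
    move=> s t + It; rewrite unitE => /andP[t0 t1] /=; case: leP => ht.
      by case: sH => _; apply => //; unit_lra.
    by case: sG => _; apply => //; unit_lra.
  apply: wcont_if; [exact: closed_square|by cont_auto|by cont_auto| | |].
  - apply: (square_comp _ _ _ _ sH); first by cont_auto.
    move=> [s t] [[/= + It]]; rewrite unitE => /andP[t0 t1] ht; split => //.
    by unit_lra.
  - apply: (square_comp _ _ _ _ sG); first by cont_auto.
    move=> [s t] [[/= + It]]; rewrite unitE => /andP[t0 t1] ht; split => //.
    by unit_lra.
  - by move=> [s t] [/= Is It] ->; rewrite subrr HG.
move=> t It /=; have := It; rewrite unitE => /andP[t0 t1].
have [_ _ _ h4] := bH t It; have [_ g2 _ _] := bG t It.
rewrite mulr0 mulr1 ler01 h4.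
have -> : (2 <= 1 :> R) = false by apply/negbTE; rewrite -ltNge ltr1n.
rewrite (_ : 2 - 1 = 1); last by ring.
rewrite g2; split => //.
  case: leP => ht.
    have It' : I (2 * t) by unit_lra.
    by have [-> _ _ _] := bH _ It'.
  have It' : I (2 * t - 1) by unit_lra.
  by have [-> _ _ _] := bG _ It'.
case: leP => ht.
  have It' : I (2 * t) by unit_lra.
  by have [_ _ -> _] := bH _ It'.
have It' : I (2 * t - 1) by unit_lra.
by have [_ _ -> _] := bG _ It'.
Qed.

Lemma fillable_homotopic A x y g h : fillable (R := R) A ->
  paths R A x y g -> paths R A x y h -> path_homotopic R A x y g h.
Proof.
move=> fA /pathsE[pg g0 g1] /pathsE[ph h0 h1]; apply/path_homotopicP.
have I0 := @unit0 R; have I1 := @unit1 R.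
apply: fA => //; apply: path_in_cst.
  by rewrite -g1; case: pg => _; apply.
by rewrite -g0; case: pg => _; apply.
Qed.

Lemma pi1_trivial_null A x g : pi1_trivial R A x -> A x ->
  paths R A x x g -> path_homotopic R A x x g (cst x).
Proof.
move=> tA Ax pg.
have pc : paths R A x x (cst x) by apply/pathsE; split => //; exact: path_in_cst.
have : pi1 R A x (loop_class R A x g) by exists g.
rewrite tA /= => E; have : loop_class R A x (cst x) (cst x).
  by split => //; exact: path_homotopic_refl.
by rewrite -E => -[].
Qed.

(** The contraction fixes [c] at all times, so applying it to a loop at [c] is a homotopy relative
    to the endpoints. *)
Lemma star_null A c g :
  forall (H : R -> T -> T), A c ->
  {within I `*` A, continuous (fun z => H z.1 z.2)} ->
  (forall t x, I t -> A x -> A (H t x)) -> (forall t, I t -> H t c = c) ->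
  (forall x, A x -> H 0 x = x /\ H 1 x = c) ->
  paths R A c c g -> path_homotopic R A c c g (cst c).
Proof.
move=> H Ac cH AH Hc H01 /pathsE[pg g0 g1]; apply/path_homotopicP.
exists (fun z => H z.2 (g z.1)).
  split; last by move=> s t Is It; apply: AH => //; case: pg => _; apply.
  apply: (@wcont_comp _ _ _ _ (I `*` A) (fun z : R * R => (z.2, g z.1)) _ _ _ cH).
    rewrite /from_subspace; apply: cont_pair; first by cont_auto.
    apply: (@wcont_comp _ _ _ _ I (fun z : R * R => z.1) _ _ _ (proj1 pg)); first by cont_auto.
    by move=> [s t] [].
  by move=> [s t] [/= Is It]; split => //=; case: pg => _; apply.
move=> t It /=; have Ag : A (g t) by case: pg => _; apply.
by have [-> ->] := H01 _ Ag; rewrite g0 g1 !Hc.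
Qed.

Lemma path_connected_from A c : (forall x, A x -> paths R A x c !=set0) ->
  path_connected R A.
Proof.
move=> h x y Ax Ay; have [g pg] := h x Ax; have [k pk] := h y Ay.
exists (path_concat R g (fun t => k (1 - t))).
by apply: paths_concat pg _; exact: paths_rev.
Qed.

End path_algebra.

(** * Paths, fillings and fundamental groups under maps *)

Section transfer.
Context {R : realType}.
Notation I := (unit_interval R).
Context {T U : topologicalType} (A : set T) (B : set U) (i : T -> U).
Hypotheses (ci : {within A, continuous i}) (iAB : forall x, A x -> B (i x)).

Lemma path_in_image (g : R -> T) : path_in A g -> path_in B (fun t => i (g t)).
Proof.
move=> [cg gA]; split; last by move=> t /gA /iAB.
by apply: (@wcont_comp _ _ _ _ A g _ cg _ ci).
Qed.

Lemma paths_image x y (g : R -> T) : paths R A x y g ->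
  paths R B (i x) (i y) (fun t => i (g t)).
Proof.
by move=> /pathsE[pg <- <-]; apply/pathsE; split => //; exact: path_in_image.
Qed.

Lemma square_in_image (H : R * R -> T) : square_in A H -> square_in B (fun z => i (H z)).
Proof.
move=> [cH HA]; split; last by move=> s t Is It; exact/iAB/HA.
apply: (@wcont_comp _ _ _ _ A H _ cH _ ci).
by move=> [s t] [/= Is It]; exact: HA.
Qed.

Lemma path_homotopic_image x y (g h : R -> T) : path_homotopic R A x y g h ->
  path_homotopic R B (i x) (i y) (fun t => i (g t)) (fun t => i (h t)).
Proof.
move=> /path_homotopicP[H sH bH]; apply/path_homotopicP.
exists (fun z => i (H z)); first exact: square_in_image.
by move=> t It; have [-> -> -> ->] := bH t It.
Qed.

(** The sides are carried by [j] into [A] and filled there; [i] brings the square back, and [i]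
    after [j] restores the sides. *)
Lemma fillable_retract (j : U -> T) : {within B, continuous j} ->
  (forall y, B y -> A (j y)) -> (forall y, B y -> i (j y) = y) ->
  fillable (R := R) A -> fillable (R := R) B.
Proof.
move=> cj jBA ij fA b r u l pb pr pu pl bl br ul ur.
have pj (g : R -> U) : path_in B g -> path_in A (fun t => j (g t)).
  move=> [cg gB]; split; last by move=> t /gB /jBA.
  by apply: (@wcont_comp _ _ _ _ B g _ cg _ cj).
have [H sH bH] := fA _ _ _ _ (pj _ pb) (pj _ pr) (pj _ pu) (pj _ pl)
  (congr1 j bl) (congr1 j br) (congr1 j ul) (congr1 j ur).
exists (fun z => i (H z)); first exact: square_in_image.
move=> t It; have [-> -> -> ->] := bH t It; rewrite !ij//.
- by case: pl => _; apply.
- by case: pu => _; apply.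
- by case: pr => _; apply.
- by case: pb => _; apply.
Qed.

Lemma path_connected_image : path_connected R A -> i @` A = B -> path_connected R B.
Proof.
move=> cA <- _ _ [x Ax <-] [y Ay <-]; have [g /pathsE[[cg gA] g0 g1]] := cA x y Ax Ay.
exists (fun t => i (g t)); apply/pathsE; rewrite g0 g1; split => //; split.
  by apply: (@wcont_comp _ _ _ _ A g _ cg _ ci).
by move=> t It; exists (g t) => //; exact: gA.
Qed.

End transfer.

Section classes.
Context {R : realType} {T : topologicalType} (A : set T) (x : T).
Notation loop := (paths R A x x).
Notation cls := (loop_class R A x).

Lemma loop_class_id g : loop g -> cls g g.
Proof. by move=> pg; split => //; exact: path_homotopic_refl. Qed.

Lemma loop_class_eq g h : loop g -> loop h ->
  cls g = cls h <-> path_homotopic R A x x g h.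
Proof.
move=> pg ph; split=> [E|gh].
  by have := loop_class_id h ph; rewrite -E => -[].
apply/seteqP; split => k [pk hk]; split => //.
  by apply: path_homotopic_trans hk; exact: path_homotopic_sym.
exact: path_homotopic_trans hk.
Qed.

Lemma pi1_mul_class g h : loop g -> loop h ->
  pi1_mul R A x (cls g) (cls h) = cls (path_concat R g h).
Proof.
move=> pg ph; apply/seteqP; split=> k.
  move=> [g1 [h1 [[pg1 gg1] [ph1 hh1] [pk hk]]]]; split => //.
  by apply: path_homotopic_trans hk; exact: path_homotopic_concat hh1.
by move=> hk; exists g, h; split => //; exact: loop_class_id.
Qed.

End classes.

(** The last two hypotheses say that [i] is onto and one-to-one on loops up to homotopy. Classes are
    sets of functions and are moved as such: [D] takes preimages, [E] takes images closed up under
    homotopy, and each of them transports an isomorphism in one direction. *)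
Lemma pi1_isoZ_transfer {R : realType} {T U : topologicalType}
    (A : set T) (B : set U) (i : T -> U) (x : T) :
  {within A, continuous i} -> (forall y, A y -> B (i y)) ->
  (forall k, paths R B (i x) (i x) k -> exists2 g, paths R A x x g &
     path_homotopic R B (i x) (i x) (fun t => i (g t)) k) ->
  (forall g h, paths R A x x g -> paths R A x x h ->
     path_homotopic R B (i x) (i x) (fun t => i (g t)) (fun t => i (h t)) ->
     path_homotopic R A x x g h) ->
  pi1_isoZ R A x <-> pi1_isoZ R B (i x).
Proof.
move=> ci iAB surj inj.
have pim g : paths R A x x g -> paths R B (i x) (i x) (fun t => i (g t)).
  exact: paths_image.
pose D (c : set (R -> U)) := [set g | paths R A x x g /\ c (fun t => i (g t))].
have DE g : paths R A x x g ->
    D (loop_class R B (i x) (fun t => i (g t))) = loop_class R A x g.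
  move=> pg; apply/seteqP; split=> h [ph].
    by move=> [_ gh]; split => //; exact: inj.
  move=> gh; split => //; split; first exact: pim.
  exact: path_homotopic_image gh.
pose E (c : set (R -> T)) := [set k | paths R B (i x) (i x) k /\
  exists2 g, c g & path_homotopic R B (i x) (i x) (fun t => i (g t)) k].
have EE g : paths R A x x g ->
    E (loop_class R A x g) = loop_class R B (i x) (fun t => i (g t)).
  move=> pg; apply/seteqP; split=> k [pk].
    move=> [h [ph gh] hk]; split => //; apply: path_homotopic_trans hk.
    exact: path_homotopic_image gh.
  by move=> gk; split => //; exists g => //; exact: loop_class_id.
have pi1B c : pi1 R B (i x) c -> exists2 g, paths R A x x g &
    c = loop_class R B (i x) (fun t => i (g t)).
  move=> [k pk <-]; have [g pg gk] := surj k pk; exists g => //.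
  by apply/esym/loop_class_eq => //; exact: pim.
have icat g h : (fun t => i (path_concat R g h t)) =
    path_concat R (fun t => i (g t)) (fun t => i (h t)).
  by apply/funext => t; rewrite /path_concat; case: ifP.
have mulB g h : paths R A x x g -> paths R A x x h ->
    pi1_mul R B (i x) (loop_class R B (i x) (fun t => i (g t)))
      (loop_class R B (i x) (fun t => i (h t))) =
    loop_class R B (i x) (fun t => i (path_concat R g h t)).
  by move=> pg ph; rewrite pi1_mul_class ?icat//; exact: pim.
split=> [[phi [[_ phi_inj phi_surj] phiM]]|[phi [[_ phi_inj phi_surj] phiM]]].
- exists (phi \o D); split; first split => //.
  + move=> c d; rewrite !inE => /pi1B[g pg ->] /pi1B[h ph ->] /=; rewrite !DE//.
    move=> /phi_inj; rewrite !inE => gh; have /loop_class_eq : loop_class R A x g = loop_class R A x h.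
      by apply: gh; [exists g|exists h].
    move=> /(_ pg ph) /(path_homotopic_image _ _ _ ci iAB) gh'.
    by apply/loop_class_eq => //; exact: pim.
  + move=> n _; have [_ [g pg <-] gn] := phi_surj n Logic.I.
    exists (loop_class R B (i x) (fun t => i (g t))).
      by exists (fun t => i (g t)) => //; exact: pim.
    by rewrite /= DE.
  + move=> c d; rewrite !inE => /pi1B[g pg ->] /pi1B[h ph ->] /=.
    rewrite mulB// !DE//; last exact: (paths_concat _ _ _ _ _ _ pg ph).
    by rewrite -phiM ?inE ?pi1_mul_class//; [exists g|exists h].
- exists (phi \o E); split; first split => //.
  + move=> c d; rewrite !inE => -[g pg <-] [h ph <-] /=; rewrite !EE// => /phi_inj.
    rewrite !inE => gh.
    have /loop_class_eq : loop_class R B (i x) (fun t => i (g t)) =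
        loop_class R B (i x) (fun t => i (h t)).
      by apply: gh; [exists (fun t => i (g t))|exists (fun t => i (h t))] => //; exact: pim.
    move=> /(_ (pim _ pg) (pim _ ph)) gh'.
    by apply/loop_class_eq => //; exact: inj.
  + move=> n _; have [_ /pi1B[g pg ->] gn] := phi_surj n Logic.I.
    by exists (loop_class R A x g); [exists g|rewrite /= EE].
  + move=> c d; rewrite !inE => -[g pg <-] [h ph <-] /=.
    rewrite pi1_mul_class// !EE//; last exact: (paths_concat _ _ _ _ _ _ pg ph).
    have inB k : paths R A x x k ->
        loop_class R B (i x) (fun t => i (k t)) \in pi1 R B (i x).
      by move=> pk; rewrite inE; exists (fun t => i (k t)) => //; exact: pim.
    by rewrite -mulB// phiM//; exact: inB.
Qed.

(** * Punctured Euclidean space *)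

Section subtypes.
Context {X : topologicalType} {A : set X}.

Lemma cont_val {T : topologicalType} (f : T -> set_type A) :
  continuous f -> continuous (fun x => set_val (f x)).
Proof.
move=> cf x; apply: (@continuous_comp _ _ _ f set_val); first exact: cf.
exact: (@initial_continuous (set_type A) X set_val).
Qed.

Lemma cont_sub {T : topologicalType} (f : T -> set_type A) :
  continuous (fun x => set_val (f x)) -> continuous f.
Proof.
move=> cf x P /= [_ [[W oW <-] /= Wx WP]].
have : nbhs x (fun y => W (set_val (f y))).
  by apply: (cf x W); exact: open_nbhs_nbhs.
by apply: filterS => y; exact: WP.
Qed.

Lemma valP_set (a : set_type A) : A (set_val a).
Proof. exact: set_valP. Qed.

(** A total inverse of [set_val], with [d] as its value off [A]. *)
Definition to_sub (d : set_type A) (x : X) : set_type A :=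
  if pselect (A x) is left h then exist _ x (mem_set h) else d.

Lemma to_subK d x : A x -> set_val (to_sub d x) = x.
Proof. by rewrite /to_sub; case: pselect. Qed.

Lemma val_subK d (a : set_type A) : to_sub d (set_val a) = a.
Proof. by apply: val_inj; apply: to_subK; exact: valP_set. Qed.

Lemma wcont_to_sub d : {within A, continuous (to_sub d)}.
Proof.
apply: cont_sub.
have : {within A, continuous (fun x : X => x)}.
  by apply: continuous_subspaceT; exact: cont_id.
by apply: wcont_ext => x Ax; rewrite to_subK.
Qed.

End subtypes.

Section row_vectors.
Context {R : realType}.
Notation I := (unit_interval R).

Section cont_rows.
Context {T : topologicalType} {n : nat}.
Implicit Types f g : T -> 'rV[R]_n.

Lemma cont_vadd f g : continuous f -> continuous g -> continuous (fun x => f x + g x).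
Proof. by move=> cf cg x; apply: cvgD; [exact: cf|exact: cg]. Qed.

Lemma cont_vopp f : continuous f -> continuous (fun x => - f x).
Proof. by move=> cf x; apply: cvgN; exact: cf. Qed.

Lemma cont_scale (a : T -> R) f : continuous a -> continuous f ->
  continuous (fun x => a x *: f x).
Proof. by move=> ca cf x; apply: cvgZ; [exact: ca|exact: cf]. Qed.

End cont_rows.

(** The Euclidean norm has to be introduced by hand, because the built-in norm of row vectors is the
    maximum norm. *)
Definition normsq {n} (v : 'rV[R]_n) : R := \sum_i v ord0 i ^+ 2.

Lemma cont_normsq {T : topologicalType} {n} (f : T -> 'rV[R]_n) :
  continuous f -> continuous (fun x => normsq (f x)).
Proof.
move=> cf; apply: cont_sum => i.
by under eq_fun do rewrite expr2; apply: cont_mul; apply: cont_coord.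
Qed.

Lemma normsq_ge0 {n} (v : 'rV[R]_n) : 0 <= normsq v.
Proof. by apply: sumr_ge0 => i _; exact: sqr_ge0. Qed.

Lemma normsq_eq0 {n} (v : 'rV[R]_n) : (normsq v == 0) = (v == 0).
Proof.
apply/idP/eqP => [|->]; last first.
  by rewrite /normsq big1// => i _; rewrite mxE expr0n.
rewrite psumr_eq0; last by move=> i _; exact: sqr_ge0.
move=> /allP h; apply/rowP => i; rewrite mxE; apply/eqP.
by rewrite -sqrf_eq0; apply: h; rewrite mem_index_enum.
Qed.

Lemma normsq_gt0 {n} (v : 'rV[R]_n) : (0 < normsq v) = (v != 0).
Proof. by rewrite lt_neqAle normsq_ge0 andbT eq_sym normsq_eq0. Qed.

Lemma normsqZ {n} a (v : 'rV[R]_n) : normsq (a *: v) = a ^+ 2 * normsq v.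
Proof. by rewrite /normsq mulr_sumr; apply: eq_bigr => i _; rewrite mxE exprMn. Qed.

Lemma normsq_recl {n} (v : 'rV[R]_n.+1) :
  normsq v = v ord0 ord0 ^+ 2 + \sum_i v ord0 (lift ord0 i) ^+ 2.
Proof. by rewrite /normsq big_ord_recl. Qed.

Lemma sqr_coord_le {n} (v : 'rV[R]_n) i : v ord0 i ^+ 2 <= normsq v.
Proof.
rewrite /normsq (bigD1 i)//= lerDl; apply: sumr_ge0 => j _; exact: sqr_ge0.
Qed.

Lemma segment_path {n} (A : set 'rV[R]_n) v w :
  (forall t, I t -> A ((1 - t) *: v + t *: w)) -> paths R A v w !=set0.
Proof.
move=> h; exists (fun t => (1 - t) *: v + t *: w); apply/pathsE; split.
- split; last exact: h.
  by apply: continuous_subspaceT; apply: cont_vadd; apply: cont_scale; cont_auto.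
- by rewrite subr0 scale1r scale0r addr0.
- by rewrite subrr scale1r scale0r add0r.
Qed.

Lemma star_fillable {n} (A : set 'rV[R]_n) c : A c ->
  (forall t x, I t -> A x -> A ((1 - t) *: x + t *: c)) -> fillable (R := R) A.
Proof.
move=> Ac Astar; apply: (simply_connected_fillable A c) => //.
  by apply: (path_connected_from _ c) => x Ax; apply: segment_path => t It; exact: Astar.
move=> g; apply: (@star_null R _ A c g (fun t x => (1 - t) *: x + t *: c)) => //.
- rewrite /from_subspace; apply: continuous_subspaceT; apply: cont_vadd;
    apply: cont_scale; cont_auto.
- by move=> t _; rewrite -scalerDl subrK scale1r.
- by move=> x _; rewrite subr0 subrr !scale1r !scale0r addr0 add0r.
Qed.

(** * Punctured space as a union of two star-shaped sets *)

Section punctured.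
Variable n : nat.
Notation V := 'rV[R]_n.+3.
Let r (v : V) := \sum_i v ord0 (lift ord0 i) ^+ 2.

Let off_axis : set V := [set v | exists2 i, i != ord0 & v ord0 i != 0].

Let rP v : off_axis v <-> 0 < r v.
Proof.
have r0 : 0 <= r v by apply: sumr_ge0 => i _; exact: sqr_ge0.
split.
  move=> [i i0 vi]; rewrite lt_neqAle r0 andbT; apply/eqP => /esym/eqP.
  rewrite psumr_eq0; last by move=> j _; exact: sqr_ge0.
  move=> /allP h; move/negP: vi; apply; move: i0; case: (unliftP ord0 i) => [j ->|->//] _.
  by rewrite -sqrf_eq0; apply: h; rewrite mem_index_enum.
move=> rv; apply: contrapT => nP; move: rv; rewrite /r big1 ?ltxx// => i _.
apply/eqP; rewrite sqrf_eq0; apply: contrapT => /negP vi; apply: nP.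
by exists (lift ord0 i) => //; rewrite eq_sym neq_lift.
Qed.

Let open_off : open off_axis.
Proof.
have -> : off_axis = r @^-1` [set t | 0 < t] by apply/seteqP; split=> v /rP.
apply: open_comp; last exact: open_gt.
move=> v _; move: v; apply: cont_sum => i.
by under eq_fun do rewrite expr2; apply: cont_mul; apply: cont_coord; exact: cont_id.
Qed.

Let pos : set V := [set v | 0 < v ord0 ord0].
Let neg : set V := [set v | v ord0 ord0 < 0].

Let open_pos : open pos.
Proof.
apply: (@open_comp _ _ (fun v : V => v ord0 ord0) [set t | 0 < t]); last exact: open_gt.
by move=> v _; move: v; apply: cont_coord; exact: cont_id.
Qed.

Let open_neg : open neg.
Proof.
apply: (@open_comp _ _ (fun v : V => v ord0 ord0) [set t | t < 0]); last exact: open_lt.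
by move=> v _; move: v; apply: cont_coord; exact: cont_id.
Qed.

Let e (k : 'I_n.+3) : V := delta_mx ord0 k.
Let eE k i : e k ord0 i = (i == k)%:R.
Proof. by rewrite mxE eqxx. Qed.

(** The segment could meet the axis only if [v] were, up to its axial part, a negative multiple of
    [e k]; the disjunction excludes this. *)
Let seg_off (v : V) k : k != ord0 -> off_axis v ->
  0 < v ord0 k \/ (exists2 i, (i != ord0) && (i != k) & v ord0 i != 0) ->
  forall t, I t -> off_axis ((1 - t) *: v + t *: e k).
Proof.
move=> k0 vo vk t; rewrite unitE => /andP[t0 t1].
have E i : ((1 - t) *: v + t *: e k) ord0 i = (1 - t) * v ord0 i + t * (i == k)%:R.
  by rewrite !mxE eqxx.
have [tlt|tge] := ltP t 1; last first.
  have -> : t = 1 by lra.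
  by exists k => //; rewrite subrr scale0r scale1r add0r eE eqxx oner_eq0.
case: vk => [vk|[i /andP[i0 ik] vi]].
  by exists k => //; rewrite E eqxx mulr1 gt_eqF//; nra.
exists i => //; rewrite E (negbTE ik) mulr0 addr0 mulf_neq0// gt_eqF//; lra.
Qed.

Let i1 : 'I_n.+3 := lift ord0 ord0.
Let i2 : 'I_n.+3 := lift ord0 (lift ord0 ord0).
Let i10 : i1 != ord0. Proof. by []. Qed.
Let i20 : i2 != ord0. Proof. by []. Qed.
Let i12 : i1 != i2. Proof. by []. Qed.

Let pc_off : path_connected R off_axis.
Proof.
apply: (path_connected_from _ (e i1)) => v vo.
have eo k : k != ord0 -> off_axis (e k).
  by move=> k0; exists k => //; rewrite eE eqxx oner_eq0.
have [h|h] := pselect (0 < v ord0 i1 \/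
    (exists2 i, (i != ord0) && (i != i1) & v ord0 i != 0)).
  by apply: segment_path => t It; exact: seg_off.
have [i i0 vi] := vo.
have ii1 : i = i1.
  by apply: contrapT => /eqP ii; apply: h; right; exists i; rewrite ?i0.
(* Here [v] is, up to its axial part, a negative multiple of [e i1]. The detour through [e i2] uses
   a second direction transverse to the axis, hence dimension at least 3. *)
have [g pg] : paths R off_axis v (e i2) !=set0.
  apply: segment_path => t It; apply: seg_off => //; right.
  by exists i1; [apply/andP; split|rewrite -ii1].
have [k pk] : paths R off_axis (e i2) (e i1) !=set0.
  apply: segment_path => t It; apply: seg_off => //; first exact: eo.
  right; exists i2; first by apply/andP; split.
  by rewrite eE eqxx oner_eq0.
by exists (path_concat R g k); exact: paths_concat pg pk.
Qed.

(** The complement of the closed ray opposite to [e ord0], star-shaped about [e ord0]; [down] is its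
    mirror image. *)
Let up : set V := pos `|` off_axis.
Let down : set V := neg `|` off_axis.

Let fill_up : fillable (R := R) up.
Proof.
apply: (star_fillable _ (e ord0)).
  by left; rewrite /pos /= eE eqxx ltr01.
move=> t v; rewrite unitE => /andP[t0 t1] vu.
have [tlt|tge] := ltP t 1; last first.
  have -> : t = 1 by lra.
  by rewrite subrr scale0r scale1r add0r; left; rewrite /pos /= eE eqxx ltr01.
case: vu => [v0|[i i0 vi]].
  left; rewrite /pos /= !mxE eqxx mulr1; rewrite /pos /= in v0; nra.
right; exists i => //; rewrite !mxE eqxx (negbTE i0) mulr0 addr0 mulf_neq0// gt_eqF//; lra.
Qed.

Let opp_down (v : V) : down v <-> up (- v).
Proof.
split=> -[h|[i i0 vi]].
- by left; move: h; rewrite /pos /neg /= !mxE oppr_gt0.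
- by right; exists i => //; rewrite !mxE oppr_eq0.
- by left; move: h; rewrite /pos /neg /= !mxE oppr_gt0.
- by right; exists i => //; move: vi; rewrite !mxE oppr_eq0.
Qed.

Let fill_down : fillable (R := R) down.
Proof.
apply: (fillable_retract up down -%R _ _ -%R) fill_up => //.
- by apply: continuous_subspaceT; apply: cont_vopp; exact: cont_id.
- by move=> v vu; apply/opp_down; rewrite opprK.
- by apply: continuous_subspaceT; apply: cont_vopp; exact: cont_id.
- by move=> v /opp_down.
- by move=> v _; rewrite opprK.
Qed.

Let up_down_I : up `&` down = off_axis.
Proof.
apply/seteqP; split=> v; last by move=> h; split; right.
move=> [[h|//] [h'|//]]; move: h h'; rewrite /pos /neg /= => h h'.
by have := lt_trans h h'; rewrite ltxx.
Qed.

Let off_ne : off_axis !=set0.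
Proof. by exists (e i1), i1 => //; rewrite eE eqxx oner_eq0. Qed.

Let pc_down : path_connected R down.
Proof.
apply: (path_connected_from _ (- e ord0)) => v vd; apply: segment_path => t.
rewrite unitE => /andP[t0 t1].
have [tlt|tge] := ltP t 1; last first.
  have -> : t = 1 by lra.
  rewrite subrr scale0r scale1r add0r; left.
  by rewrite /neg /= !mxE !eqxx mulr1n ltrN10.
case: vd => [v0|[i i0 vi]].
  left; rewrite /neg /= !mxE !eqxx mulr1n; rewrite /neg /= in v0; nra.
right; exists i => //; rewrite !mxE eqxx (negbTE i0) oppr0 mulr0 addr0 mulf_neq0// gt_eqF//; lra.
Qed.

Let pc_up : path_connected R up.
Proof.
apply: (path_connected_image down up -%R) pc_down _.
  by apply: continuous_subspaceT; apply: cont_vopp; exact: cont_id.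
apply/seteqP; split=> [_ [v vd <-]|v vu]; first exact/opp_down.
by exists (- v); [apply/opp_down; rewrite opprK|rewrite opprK].
Qed.

Let up_down_U : up `|` down = [set v | v != 0].
Proof.
apply/seteqP; split=> v /=.
  move=> h; apply/eqP => v0; rewrite {}v0 in h.
  by case: h => -[]; rewrite /pos /neg /off_axis /= ?mxE ?ltxx// => -[i]; rewrite mxE eqxx.
move=> v0; have [|no] := pselect (off_axis v); first by left; right.
have [h|h|h] := ltgtP (v ord0 ord0) 0; [by right; left|by left; left|].
exfalso; move/eqP: v0; apply; apply/rowP => i; rewrite mxE.
have [->//|i0] := eqVneq i ord0.
by apply: contrapT => /eqP vi; apply: no; exists i.
Qed.

Let open_up : open up. Proof. exact: openU. Qed.
Let open_down : open down. Proof. exact: openU. Qed.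

Lemma path_connected_punctured : path_connected R [set v : V | v != 0].
Proof.
rewrite -up_down_U; apply: (path_connected_from _ (e i1)) => v vv.
have eo : off_axis (e i1) by exists i1 => //; rewrite eE eqxx oner_eq0.
have [g pg] : (paths R up v (e i1) `|` paths R down v (e i1)) !=set0.
  case: vv => vv.
    by have [g pg] := pc_up v (e i1) vv (or_intror eo); exists g; left.
  by have [g pg] := pc_down v (e i1) vv (or_intror eo); exists g; right.
exists g; case: pg => /pathsE[pg g0 g1]; apply/pathsE; split => //.
  by apply: path_inS pg => x; left.
by apply: path_inS pg => x; right.
Qed.

(** The sets [up] and [down] overlap in the complement of an axis, which is path-connected. So
    [van_kampen_path] moves every loop into [up], where it contracts. *)
Lemma fillable_punctured : fillable (R := R) [set v : V | v != 0].
Proof.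
have e0 : [set v : V | v != 0] (e ord0).
  by rewrite -up_down_U; left; left; rewrite /pos /= eE eqxx ltr01.
apply: (simply_connected_fillable _ (e ord0)) => //.
  exact: path_connected_punctured.
rewrite -up_down_U => g /pathsE[pg g0 g1].
have u0 : up (e ord0) by left; rewrite /pos /= eE eqxx ltr01.
have [||||g' pg' gg'] := van_kampen_path up down open_up open_down _ _ g pc_down fill_down pg.
- by rewrite up_down_I; exact: pc_off.
- by rewrite up_down_I; exact: off_ne.
- by rewrite g0.
- by rewrite g1.
rewrite g0 g1 in pg' gg'; apply: path_homotopic_trans gg' _.
have /(fillable_homotopic _ _ _ _ _ fill_up pg') :
    paths R up (e ord0) (e ord0) (cst (e ord0)).
  by apply/pathsE; split => //; exact: path_in_cst.
move=> /path_homotopicP[H sH bH]; apply/path_homotopicP; exists H => //.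
by apply: square_inS sH => x; left.
Qed.

End punctured.

End row_vectors.

(** * Spheres *)

Lemma wcont_inv {R : realType} {T : topologicalType} (A : set T) (f : T -> R) :
  {within A, continuous f} -> (forall x, A x -> f x != 0) ->
  {within A, continuous (fun x => (f x)^-1)}.
Proof.
move=> cf f0; apply: (@wcont_comp _ _ _ _ [set r : R | r != 0] f GRing.inv cf f0).
by apply: continuous_in_subspaceT => r; rewrite inE => r0; exact: inv_continuous.
Qed.

Section spheres.
Context {R : realType}.
Notation I := (unit_interval R).

Section stereographic.
Variable n : nat.
Notation S := (sphere R n).

Definition pole_vec : 'rV[R]_n.+1 := delta_mx ord0 ord0.

Lemma pole_vecE i : pole_vec ord0 i = (i == ord0)%:R.
Proof. by rewrite mxE eqxx. Qed.

Lemma normsq_pole : normsq pole_vec = 1.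
Proof.
rewrite normsq_recl pole_vecE eqxx expr1n big1 ?addr0// => i _.
by rewrite pole_vecE eq_sym (negbTE (neq_lift _ _)) expr0n.
Qed.

Definition pole : S := exist _ pole_vec (mem_set normsq_pole).

Definition to_sphere (v : 'rV[R]_n.+1) : S := to_sub pole v.

Lemma normsq_sphere (x : S) : normsq (set_val x) = 1.
Proof. exact: (valP_set x). Qed.

Lemma to_sphereK v : normsq v = 1 -> set_val (to_sphere v) = v.
Proof. exact: to_subK. Qed.

Definition height (x : S) : R := set_val x ord0 ord0.

Lemma cont_height : continuous height.
Proof. by apply: cont_coord; apply: cont_val; exact: cont_id. Qed.

Lemma height_le1 x : height x <= 1.
Proof.
have := sqr_coord_le (set_val x) ord0; rewrite normsq_sphere -/(height x) => h; nra.
Qed.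

Lemma height_pole : height pole = 1.
Proof. by rewrite /height /= pole_vecE eqxx. Qed.

Lemma height_eq1 x : height x = 1 -> x = pole.
Proof.
move=> h; apply: val_inj; change (set_val x = pole_vec).
have := normsq_sphere x; rewrite normsq_recl -/(height x) h expr1n.
move=> E; have /eqP : \sum_i set_val x ord0 (lift ord0 i) ^+ 2 = 0 by lra.
rewrite psumr_eq0 => [/allP s0|i _]; last exact: sqr_ge0.
apply/rowP => i; rewrite pole_vecE; case: (unliftP ord0 i) => [j ->|->]; last by rewrite eqxx; exact: h.
rewrite eq_sym (negbTE (neq_lift _ _)); apply/eqP; rewrite -sqrf_eq0.
by apply: s0; rewrite mem_index_enum.
Qed.

Lemma height_lt1 x : x <> pole <-> height x < 1.
Proof.
rewrite lt_neqAle height_le1 andbT; split=> [h|/eqP h xp].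
  by apply/eqP => /height_eq1.
by apply: h; rewrite xp height_pole.
Qed.

Definition stereo (x : S) : 'rV[R]_n :=
  \row_i (set_val x ord0 (lift ord0 i) / (1 - height x)).

Definition unstereo_vec (y : 'rV[R]_n) : 'rV[R]_n.+1 :=
  \row_i if unlift ord0 i is Some j then 2 * y ord0 j / (normsq y + 1)
         else (normsq y - 1) / (normsq y + 1).

Lemma normsq1_gt0 (y : 'rV[R]_n) : 0 < normsq y + 1.
Proof. by rewrite ltr_wpDl// normsq_ge0. Qed.

Lemma normsq_unstereo y : normsq (unstereo_vec y) = 1.
Proof.
have q0 := normsq1_gt0 y; have q1 : normsq y + 1 != 0 by rewrite gt_eqF.
rewrite normsq_recl mxE unlift_none.
under eq_bigr do rewrite mxE liftK !exprMn -mulrA mulrC -mulrA.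
rewrite -mulr_suml -/(normsq y); field.
by rewrite q1.
Qed.

Definition unstereo (y : 'rV[R]_n) : S := to_sphere (unstereo_vec y).

Lemma val_unstereo y : set_val (unstereo y) = unstereo_vec y.
Proof. by apply: to_sphereK; exact: normsq_unstereo. Qed.

Lemma height_unstereo y : height (unstereo y) = (normsq y - 1) / (normsq y + 1).
Proof. by rewrite /height val_unstereo mxE unlift_none. Qed.

Lemma height_unstereo_gt y a : a < 1 ->
  (a < height (unstereo y)) = (1 + a < normsq y * (1 - a)).
Proof.
move=> a1; have q0 := normsq1_gt0 y; rewrite height_unstereo ltr_pdivlMr//.
by apply/idP/idP => h; nra.
Qed.

Lemma unstereo_neq_pole y : unstereo y <> pole.
Proof.
apply/height_lt1; have q0 := normsq1_gt0 y; rewrite height_unstereo ltr_pdivrMr//; lra.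
Qed.

Lemma unstereoK : cancel unstereo stereo.
Proof.
move=> y; have q0 := normsq1_gt0 y; have q1 : normsq y + 1 != 0 by rewrite gt_eqF.
apply/rowP => i; rewrite mxE height_unstereo val_unstereo mxE liftK.
by field; rewrite ?q1 ?andbT; do ?[apply/andP; split]; rewrite ?q1//;
  apply/eqP => e; have /negP := ltr10 R; apply; lra.
Qed.

Lemma normsq_stereo x : x <> pole ->
  normsq (stereo x) = (1 + height x) / (1 - height x).
Proof.
move=> /height_lt1 h; have h0 : 1 - height x != 0 by rewrite subr_eq0 gt_eqF.
have := normsq_sphere x; rewrite normsq_recl -/(height x) => E.
rewrite /normsq; under eq_bigr do rewrite mxE exprMn.
rewrite -mulr_suml.
have -> : \sum_i set_val x ord0 (lift ord0 i) ^+ 2 = 1 - height x ^+ 2.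
  by move: E; lra.
by field.
Qed.

Lemma stereoK x : x <> pole -> unstereo (stereo x) = x.
Proof.
move=> xp; have h := xp; move/height_lt1 in h.
have h0 : 1 - height x != 0 by rewrite subr_eq0 gt_eqF.
apply: val_inj; change (set_val (unstereo (stereo x)) = set_val x).
rewrite val_unstereo; apply/rowP => i; rewrite mxE normsq_stereo//.
case: (unliftP ord0 i) => [j ->|->]; last first.
  rewrite -/(height x); field; do ?[apply/andP; split];
    rewrite ?h0//; apply/eqP => e; have /negP := ltr10 R; apply; lra.
rewrite mxE; field; do ?[apply/andP; split];
    rewrite ?h0//; apply/eqP => e; have /negP := ltr10 R; apply; lra.
Qed.

Lemma cont_unstereo : continuous unstereo.
Proof.
apply: cont_sub; under eq_fun do rewrite val_unstereo.
have ci : continuous (fun y : 'rV[R]_n => (normsq y + 1)^-1).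
  apply: cont_inv; first by move=> y; rewrite gt_eqF// normsq1_gt0.
  by apply: cont_add; [apply: cont_normsq; exact: cont_id|exact: cst_continuous].
apply: cont_row => i; case: (unlift ord0 i) => [j|]; apply: cont_mul => //.
  apply: cont_mul; first exact: cst_continuous.
  by apply: cont_coord; exact: cont_id.
by apply: cont_add; [apply: cont_normsq; exact: cont_id|exact: cst_continuous].
Qed.

Lemma wcont_stereo : {within [set x | x <> pole], continuous stereo}.
Proof.
apply: cont_row => i; apply: cont_mul.
  by apply: continuous_subspaceT; apply: cont_coord; apply: cont_val; exact: cont_id.
apply: wcont_inv; last by move=> x /height_lt1 h; rewrite subr_eq0 gt_eqF.
apply: continuous_subspaceT; apply: cont_add; first exact: cst_continuous.
by apply: cont_opp; exact: cont_height.
Qed.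

Definition cap (a : R) : set S := [set x | a < height x].

Lemma open_cap a : open (cap a).
Proof.
by apply: (@open_comp _ _ height [set t | a < t]);
  [move=> x _; exact: cont_height|exact: open_gt].
Qed.

Lemma cap_nbhs (B : set S) : open B -> B pole ->
  exists a, 0 <= a < 1 /\ cap a `<=` B.
Proof.
move=> [W oW <-] /= Wp; have /nbhs_ballP[e /= e0 eW] : nbhs pole_vec W by exact: open_nbhs_nbhs.
(* With [h] the height, the factor 1/2 answers [1 - h^2 <= 2 (1 - h)], which brings the square of
   every other coordinate below [e^2]; the bound by [e] serves the height itself. The maximum with 0
   keeps the cap in the upper hemisphere, where [slide] is defined. *)
pose a := Num.max 0 (1 - Num.min e (e ^+ 2 / 2)).
have e2 : 0 < e ^+ 2 / 2 by rewrite divr_gt0// exprn_gt0.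
have a1 : 1 - a <= e.
  by rewrite /a lerBlDr -lerBlDl le_max; apply/orP; right; rewrite lerB// ge_min lexx.
have a2 : 1 - a <= e ^+ 2 / 2.
  by rewrite /a lerBlDr -lerBlDl le_max; apply/orP; right; rewrite lerB// ge_min lexx orbT.
exists a; split.
  rewrite /a le_max lexx/= gt_max ltr01/=.
  by rewrite ltrBlDr ltrDl lt_min e0 e2.
move=> x xa; apply: eW; split => // i j; rewrite (ord1 i).
have ha := height_le1 x; rewrite /cap /= in xa.
have a0 : 0 <= a by rewrite /a le_max lexx.
change (`|pole_vec ord0 j - set_val x ord0 j| < e).
rewrite pole_vecE; case: (unliftP ord0 j) => [k ->|->].
  rewrite eq_sym (negbTE (neq_lift _ _)) sub0r normrN.
  have : set_val x ord0 (lift ord0 k) ^+ 2 <= 1 - height x ^+ 2.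
    have := normsq_sphere x; rewrite normsq_recl -/(height x) => E.
    suff : set_val x ord0 (lift ord0 k) ^+ 2 <= \sum_i set_val x ord0 (lift ord0 i) ^+ 2.
      by move: E; lra.
    by rewrite (bigD1 k)//= lerDl; apply: sumr_ge0 => ? _; exact: sqr_ge0.
  move=> hk; have {}hk : set_val x ord0 (lift ord0 k) ^+ 2 < e ^+ 2 by nra.
  by rewrite -(ger0_norm (ltW e0)) -ltr_sqr ?nnegrE ?normr_ge0// !real_normK ?num_real.
rewrite eqxx; change (`|1 - height x| < e); rewrite ger0_norm ?subr_ge0//; lra.
Qed.

Definition normalize (v : 'rV[R]_n.+1) : S := to_sphere ((Num.sqrt (normsq v))^-1 *: v).

Lemma val_normalize v : v != 0 -> set_val (normalize v) = (Num.sqrt (normsq v))^-1 *: v.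
Proof.
move=> v0; apply: to_sphereK.
have h : 0 < normsq v by rewrite normsq_gt0.
by rewrite normsqZ exprVn sqr_sqrtr ?ltW// mulVf// gt_eqF.
Qed.

Lemma normalize_sphere (x : S) : normalize (set_val x) = x.
Proof. by rewrite /normalize normsq_sphere sqrtr1 invr1 scale1r; exact: val_subK. Qed.

Lemma wcont_normalize : {within [set v | v != 0], continuous normalize}.
Proof.
apply: cont_sub.
apply: (@wcont_ext _ _ _ (fun v : 'rV[R]_n.+1 => (Num.sqrt (normsq v))^-1 *: v)).
  by move=> v v0; rewrite val_normalize.
apply: cont_scale; last by apply: continuous_subspaceT; exact: cont_id.
apply: wcont_inv; last by move=> v v0; rewrite gt_eqF// sqrtr_gt0 normsq_gt0.
by apply: continuous_subspaceT; apply: cont_sqrt; apply: cont_normsq; exact: cont_id.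
Qed.

Definition slide (t : R) (x : S) : S :=
  normalize ((1 - t) *: set_val x + t *: pole_vec).

Lemma normsq_slide t x : normsq ((1 - t) *: set_val x + t *: pole_vec) =
  (1 - t) ^+ 2 + t ^+ 2 + 2 * t * (1 - t) * height x.
Proof.
have := normsq_sphere x; rewrite !normsq_recl -/(height x) => E.
under eq_bigr => i _ do rewrite 3!mxE pole_vecE eq_sym (negbTE (neq_lift _ _)) mulr0 addr0 exprMn.
rewrite -mulr_sumr 3!mxE pole_vecE eqxx mulr1 -/(height x).
have -> : \sum_i set_val x ord0 (lift ord0 i) ^+ 2 = 1 - height x ^+ 2 by move: E; lra.
by ring.
Qed.

(** A chord contains the origin only if its ends are antipodal. In numbers, [(1 - t)^2 + t^2] equals
    [(1 + (2 t - 1)^2) / 2] and the cross term is nonnegative. *)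
Lemma slide_neq0 t x : I t -> 0 <= height x ->
  (1 - t) *: set_val x + t *: pole_vec != 0.
Proof.
rewrite unitE => /andP[t0 t1] h; rewrite -normsq_gt0 normsq_slide.
have p : 0 <= 2 * t * (1 - t) * height x by rewrite !mulr_ge0// subr_ge0.
have := sqr_ge0 (2 * t - 1); lra.
Qed.

(** On the chord the height lies between [height x] and 1. The chord stays in the unit ball, so
    dividing by the norm can only raise this positive height. *)
Lemma slide_cap a t x : 0 <= a < 1 -> I t -> cap a x -> cap a (slide t x).
Proof.
move=> /andP[a0 a1] It; rewrite /cap /= => xa.
have h0 : 0 <= height x by lra.
have v0 := slide_neq0 t x It h0.
have hx := height_le1 x.
have := It; rewrite unitE => /andP[t0 t1].
rewrite {1}/height val_normalize//.
set w := _ + _ in v0 *; rewrite mxE.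
have w0 : 0 < normsq w by rewrite normsq_gt0.
have p1 : 0 <= t * (1 - height x) by rewrite mulr_ge0// subr_ge0.
have p2 : 0 <= t * (1 - t) * (1 - height x) by rewrite !mulr_ge0// subr_ge0.
have w1 : normsq w <= 1 by rewrite normsq_slide; lra.
have wE : w ord0 ord0 = (1 - t) * height x + t by rewrite 3!mxE pole_vecE eqxx mulr1.
have wa : a < w ord0 ord0 by rewrite wE; lra.
apply: (lt_le_trans wa); apply: ler_peMl.
  by apply: ltW; exact: le_lt_trans a0 wa.
rewrite invf_ge1 ?sqrtr_gt0// -sqrtr1; exact: ler_wsqrtr.
Qed.

Lemma slide_pole t : I t -> slide t pole = pole.
Proof.
move=> It; rewrite /slide -[RHS]normalize_sphere; congr normalize.
by rewrite -scalerDl subrK scale1r.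
Qed.

Lemma slide0 x : slide 0 x = x.
Proof. by rewrite /slide subr0 scale1r scale0r addr0 normalize_sphere. Qed.

Lemma slide1 x : slide 1 x = pole.
Proof. by rewrite /slide subrr scale1r scale0r add0r -[RHS]normalize_sphere. Qed.

Lemma wcont_slide a : 0 <= a < 1 ->
  {within I `*` cap a, continuous (fun z => slide z.1 z.2)}.
Proof.
move=> /andP[a0 a1]; have h := @wcont_comp _ _ _ (I `*` cap a) [set v : 'rV[R]_n.+1 | v != 0]
  (fun z : R * S => (1 - z.1) *: set_val z.2 + z.1 *: pole_vec) normalize _ _ wcont_normalize.
apply: h.
  apply: continuous_subspaceT; apply: cont_vadd; apply: cont_scale; try by cont_auto.
  by apply: cont_val; cont_auto.
by move=> [t x] [/= It]; rewrite /cap /= => xa; apply: slide_neq0 => //; lra.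
Qed.

Lemma cap_pole a : a < 1 -> cap a pole.
Proof. by move=> a1; rewrite /cap /= height_pole. Qed.

Lemma path_connected_cap a : 0 <= a < 1 -> path_connected R (cap a).
Proof.
move=> a01; apply: (path_connected_from _ pole) => x xa.
exists (fun t => slide t x); apply/pathsE; rewrite slide0 slide1; split => //.
split; last by move=> t It; exact: slide_cap.
apply: (@wcont_comp _ _ _ _ (I `*` cap a) (fun t : R => (t, x)) _ _ _ (wcont_slide a a01)).
  by cont_auto.
by [].
Qed.

Lemma fillable_cap a : 0 <= a < 1 -> fillable (R := R) (cap a).
Proof.
move=> a01; have /andP[a0 a1] := a01.
apply: (simply_connected_fillable _ pole).
- exact: path_connected_cap.
- exact: cap_pole.
move=> g; apply: (@star_null R _ _ _ g slide).
- exact: cap_pole.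
- exact: wcont_slide.
- by move=> t x; exact: slide_cap.
- exact: slide_pole.
- by move=> x _; rewrite slide0 slide1.
Qed.

End stereographic.
End spheres.

(** * Punctured caps and punctured Euclidean space *)

Section punctured_cap.
Context {R : realType}.
Notation I := (unit_interval R).
Variable n : nat.
Notation S := (sphere R n.+3).
Notation V := 'rV[R]_n.+3.

Definition punct (a : R) : set S := [set x | cap n.+3 a x /\ x <> pole n.+3].

Section fixed_height.
Variable a : R.
Hypothesis a01 : 0 <= a < 1.

(** [stereo] sends the level of height [a] to the sphere of radius [s], and the punctured cap to the
    vectors longer than [s]. The map [out] reaches these from the nonzero vectors by adding [s] to
    the length; [inn] subtracts it again. *)
Let s := Num.sqrt ((1 + a) / (1 - a)).
Let out (y : V) : S := unstereo _ ((1 + s * (Num.sqrt (normsq y))^-1) *: y).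
Let inn (x : S) : V := (1 - s * (Num.sqrt (normsq (stereo _ x)))^-1) *: stereo _ x.

Let sE : s ^+ 2 = (1 + a) / (1 - a).
Proof. have /andP[a0 a1] := a01; rewrite sqr_sqrtr// divr_ge0; lra. Qed.

Let s0 : 0 < s.
Proof. have /andP[a0 a1] := a01; rewrite sqrtr_gt0 divr_gt0; lra. Qed.

Let punctE y : punct a (unstereo _ y) <-> s < Num.sqrt (normsq y).
Proof.
have /andP[a0 a1] := a01; have a1' : 0 < 1 - a by lra.
rewrite /punct /cap /= height_unstereo_gt// -ltr_pdivrMr// -sE.
have -> : (s ^+ 2 < normsq y) = (s < Num.sqrt (normsq y)).
  by rewrite -[in LHS](sqr_sqrtr (normsq_ge0 y)) ltr_sqr ?nnegrE ?sqrtr_ge0 ?ltW.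
by split=> [[]//|]; split => //; exact: unstereo_neq_pole.
Qed.

Let sqrt_gt0 (y : V) : y != 0 -> 0 < Num.sqrt (normsq y).
Proof. by move=> y0; rewrite sqrtr_gt0 normsq_gt0. Qed.

Let out_punct y : y != 0 -> punct a (out y).
Proof.
move=> y0; have h := sqrt_gt0 y y0; apply/punctE.
rewrite normsqZ sqrtrM ?sqr_ge0// sqrtr_sqr ger0_norm; last first.
  by rewrite addr_ge0// mulr_ge0// ?invr_ge0 ltW.
by rewrite mulrDl mul1r divfK ?gt_eqF// ltrDr.
Qed.

Let stereo_gt x : punct a x -> s < Num.sqrt (normsq (stereo _ x)).
Proof. by move=> [xa xp]; apply/punctE; rewrite stereoK. Qed.

Let inn_neq0 x : punct a x -> inn x != 0.
Proof.
move=> /stereo_gt h; have h0 := lt_trans s0 h.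
rewrite scaler_eq0 negb_or -normsq_gt0 -sqrtr_gt0 h0 andbT subr_eq0.
by rewrite gt_eqF// ltr_pdivrMr// mul1r.
Qed.

Let out_inn x : punct a x -> out (inn x) = x.
Proof.
move=> px; have h := stereo_gt x px; have h0 := lt_trans s0 h.
have [_ xp] := px; rewrite -[RHS]stereoK// /out /inn; congr unstereo.
set w := stereo _ x in h h0 *; set q := Num.sqrt (normsq w) in h h0 *.
have c0 : 0 <= 1 - s * q^-1 by rewrite subr_ge0 ler_pdivrMr// mul1r ltW.
rewrite normsqZ sqrtrM ?sqr_ge0// sqrtr_sqr ger0_norm// -/q scalerA.
rewrite -[RHS]scale1r; congr (_ *: _); field.
have e : (q - s != 0) by rewrite subr_eq0 gt_eqF.
by rewrite e gt_eqF.
Qed.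

Let wcont_out : {within [set y | y != 0], continuous out}.
Proof.
apply: (@wcont_comp _ _ _ _ [set: V]
  (fun y : V => (1 + s * (Num.sqrt (normsq y))^-1) *: y) (unstereo n.+3)) => //.
  apply: cont_scale; last by apply: continuous_subspaceT; exact: cont_id.
  apply: cont_add; first exact: cst_continuous.
  apply: cont_mul; first exact: cst_continuous.
  apply: wcont_inv; last by move=> y y0; rewrite gt_eqF// sqrt_gt0.
  by apply: continuous_subspaceT; apply: cont_sqrt; apply: cont_normsq; exact: cont_id.
by apply: continuous_subspaceT; exact: cont_unstereo.
Qed.

Let wcont_inn : {within punct a, continuous inn}.
Proof.
have cs : {within punct a, continuous (stereo n.+3)}.
  by apply: continuous_subspaceW (wcont_stereo _) => x [].
apply: cont_scale => //.
apply: cont_add; first exact: cst_continuous.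
apply: cont_opp; apply: cont_mul; first exact: cst_continuous.
apply: wcont_inv; last by move=> y /stereo_gt h; rewrite gt_eqF// (lt_trans s0).
by apply: cont_sqrt; exact: cont_normsq.
Qed.

Lemma fillable_punct : fillable (R := R) (punct a).
Proof.
exact: (@fillable_retract R V S [set y | y != 0] (punct a) out wcont_out
  out_punct inn wcont_inn inn_neq0 out_inn (fillable_punctured n)).
Qed.

Lemma path_connected_punct : path_connected R (punct a).
Proof.
apply: (@path_connected_image R V S [set y | y != 0] (punct a) out wcont_out).
  exact: path_connected_punctured.
apply/seteqP; split=> [_ [y y0 <-]|x px]; first exact: out_punct.
by exists (inn x); [exact: inn_neq0|exact: out_inn].
Qed.

Lemma punct_ne : punct a !=set0.
Proof.
exists (out (delta_mx ord0 ord0)); apply: out_punct.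
by apply/eqP => /matrixP/(_ ord0 ord0)/eqP; rewrite !mxE !eqxx oner_eq0.
Qed.

End fixed_height.

End punctured_cap.

Section connectedness.
Context {R : realType}.
Notation I := (unit_interval R).

Lemma path_connected_connected {T : topologicalType} (A : set T) :
  path_connected R A -> connected A.
Proof.
move=> cA; have [->|/set0P[x Ax]] := eqVneq A set0; first exact: connected0.
have h y : exists g : R -> T, A y -> paths R A x y g.
  have [Ay|nA] := pselect (A y); last by exists (cst x).
  by have [g pg] := cA x y Ax Ay; exists g.
have [q qP] := choice h.
have -> : A = \bigcup_(y in A) (q y @` I).
  apply/seteqP; split=> [y Ay|z [y Ay [t It <-]]].
    by exists y => //; exists 1; [exact: unit1|have /pathsE[] := qP y Ay].
  by have /pathsE[[_ h'] _ _] := qP y Ay; exact: h'.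
apply: bigcup_connected.
  exists x => y Ay; exists 0; first exact: unit0.
  by have /pathsE[] := qP y Ay.
move=> y Ay; apply: connected_continuous_connected; first exact: segment_connected.
by have /pathsE[[]] := qP y Ay.
Qed.

(** Radial projection from the path-connected punctured space. *)
Lemma connected_sphere n : connected [set: sphere R n.+2].
Proof.
apply: path_connected_connected.
apply: (@path_connected_image R 'rV[R]_n.+3 (sphere R n.+2) [set v | v != 0] _
  (normalize n.+2) (wcont_normalize n.+2) (path_connected_punctured n)).
apply/seteqP; split=> // x _; exists (set_val x); last exact: normalize_sphere.
by rewrite /= -normsq_gt0 normsq_sphere.
Qed.

End connectedness.

(** * Reflections of the sphere *)

Section reflection.
Context {R : realType}.
Variable n : nat.
Notation S := (sphere R n).
Notation V := 'rV[R]_n.+1.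

Definition dot (u v : V) : R := \sum_i u ord0 i * v ord0 i.

Lemma dotC u v : dot u v = dot v u.
Proof. by apply: eq_bigr => i _; rewrite mulrC. Qed.

Lemma dotBZ u v c w : dot (u - c *: v) w = dot u w - c * dot v w.
Proof.
rewrite /dot mulr_sumr -sumrB; apply: eq_bigr => i _; rewrite !mxE; ring.
Qed.

Lemma dotxx u : dot u u = normsq u.
Proof. by apply: eq_bigr => i _; rewrite expr2. Qed.

Section along.
Variable w : V.

(* When [w = 0] this is the identity, since [0^-1 = 0]. *)
Definition reflect_vec (v : V) : V := v - (2 * dot v w / normsq w) *: w.

Lemma normsq_reflect v : normsq (reflect_vec v) = normsq v.
Proof.
rewrite -!dotxx /reflect_vec dotBZ [dot v (v - _)]dotC [dot w (v - _)]dotC !dotBZ.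
rewrite !dotxx [dot w v]dotC; have [->|w0] := eqVneq (normsq w) 0.
  by rewrite invr0; ring.
by field.
Qed.

Definition reflect_sphere (x : S) : S := to_sphere n (reflect_vec (set_val x)).

Lemma val_reflect x : set_val (reflect_sphere x) = reflect_vec (set_val x).
Proof. by apply: to_sphereK; rewrite normsq_reflect normsq_sphere. Qed.

Lemma reflectK : involutive reflect_sphere.
Proof.
move=> x; apply: val_inj; change (set_val (reflect_sphere (reflect_sphere x)) = set_val x).
rewrite !val_reflect /reflect_vec dotBZ dotxx.
have [->|w0] := eqVneq (normsq w) 0; first by rewrite invr0 !mulr0 !scale0r !subr0.
rewrite -addrA -opprD -scalerDl.
set c := (X in X *: w); have -> : c = 0 by rewrite /c; field.
by rewrite scale0r subr0.
Qed.

Lemma cont_reflect : continuous reflect_sphere.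
Proof.
apply: cont_sub; under eq_fun do rewrite val_reflect.
have cv : continuous (fun x : S => set_val x : V) by apply: cont_val; exact: cont_id.
apply: cont_vadd => //; apply: cont_vopp; apply: cont_scale; last exact: cst_continuous.
apply: cont_mul; last exact: cst_continuous.
apply: cont_mul; first exact: cst_continuous.
by apply: cont_sum => i; apply: cont_mul; [exact: cont_coord|exact: cst_continuous].
Qed.

End along.

(** The mirror exchanging two unit vectors is orthogonal to their difference [w]: since [normsq w]
    is twice the product of [p] and [w], the coefficient of [w] is 1. If [p] is the pole, then
    [w = 0] and nothing moves. In this way any point can serve as centre of the stereographic
    projection. *)
Lemma reflect_to_pole (p : S) :
  reflect_sphere (set_val p - pole_vec n) p = pole n.
Proof.
apply: val_inj; change (set_val (reflect_sphere (set_val p - pole_vec n) p) = pole_vec n).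
rewrite val_reflect /reflect_vec; set v := set_val p.
have nv : normsq v = 1 by exact: normsq_sphere.
have E : normsq (v - pole_vec n) = 2 * dot v (v - pole_vec n).
  rewrite -dotxx -[pole_vec n]scale1r dotBZ [dot v _]dotC [dot (pole_vec n) _]dotC !dotBZ.
  by rewrite !dotxx nv normsq_pole [dot (pole_vec n) v]dotC; ring.
have [h|h] := eqVneq (normsq (v - pole_vec n)) 0.
  by rewrite h invr0 mulr0 scale0r subr0; move/eqP: h; rewrite normsq_eq0 subr_eq0 => /eqP.
by rewrite -E divff// scale1r opprB addrC subrK.
Qed.

End reflection.

(** * Homeomorphisms and charts *)

(** The working form of [homeomorphism]: with the inverse explicit, symmetry and composition are
    immediate. *)
Definition is_homeo {T U : topologicalType} (A : set T) (B : set U)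
    (f : T -> U) (g : U -> T) : Prop :=
  [/\ forall x, A x -> B (f x) /\ g (f x) = x,
      forall y, B y -> A (g y) /\ f (g y) = y,
      {within A, continuous f} & {within B, continuous g}].

Section homeo.
Context {T U W : topologicalType}.

Lemma homeomorphismE (A : set T) (B : set U) f :
  homeomorphism A B f <-> exists g, is_homeo A B f g.
Proof.
split=> [[[fAB finj fsurj] cf [g cg fg]]|[g [fP gP cf cg]]].
  exists g; split => // [x Ax|y By]; first by split; [exact: fAB|exact/fg/mem_set].
  by have [x Ax <-] := fsurj y By; rewrite fg ?inE.
split => //; last by exists g => // x; rewrite inE => /fP[].
split.
- by move=> x /fP[].
- move=> x y; rewrite !inE => Ax Ay fxy.
  by rewrite -(proj2 (fP x Ax)) fxy; exact: (proj2 (fP y Ay)).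
- by move=> y /gP[Ag fg]; exists (g y).
Qed.

Lemma is_homeo_sym (A : set T) (B : set U) f g : is_homeo A B f g -> is_homeo B A g f.
Proof. by case. Qed.

Lemma is_homeo_comp (A : set T) (B : set U) (C : set W) f g f' g' :
  is_homeo A B f g -> is_homeo B C f' g' -> is_homeo A C (f' \o f) (g \o g').
Proof.
move=> [fP gP cf cg] [fP' gP' cf' cg']; split.
- move=> x /fP[Bx gfx]; have [Cx gfx'] := fP' _ Bx; split => //=.
  by rewrite gfx'.
- move=> z /gP'[By fgz]; have [Ay fgy] := gP _ By; split => //=.
  by rewrite fgy.
- by apply: wcont_comp cf _ cf' => x /fP[].
- by apply: wcont_comp cg' _ cg => x /gP'[].
Qed.

Lemma is_homeo_sub (A A' : set T) (B : set U) f g : A' `<=` A ->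
  is_homeo A B f g -> is_homeo A' (f @` A') f g.
Proof.
move=> AA [fP gP cf cg]; split.
- by move=> x A'x; split; [exists x|case: (fP x (AA x A'x))].
- by move=> _ [x A'x <-]; case: (fP x (AA x A'x)) => _ ->.
- exact: continuous_subspaceW cf.
- by apply: continuous_subspaceW cg => _ [x /AA/fP[Bx _] <-].
Qed.

Lemma is_homeo_openI (A : set T) (B : set U) f g (O : set T) :
  is_homeo A B f g -> open B -> open O -> open (f @` (A `&` O)).
Proof.
move=> [fP gP cf cg] oB oO.
have -> : f @` (A `&` O) = B `&` g @^-1` O.
  apply/seteqP; split=> [_ [x [Ax Ox] <-]|y [By Oy]].
    by have [Bx gf] := fP x Ax; split => //=; rewrite gf.
  by have [Ay fg] := gP y By; exists (g y).
by apply: (continuous_inP g oB).1 => //; rewrite -continuous_open_subspace.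
Qed.

End homeo.

Lemma is_homeo_val {T : topologicalType} (A : set T) (d : set_type A) :
  is_homeo [set: set_type A] A set_val (to_sub d).
Proof.
split.
- by move=> x _; split; [exact: valP_set|exact: val_subK].
- by move=> y Ay; split => //; exact: to_subK.
- by apply: continuous_subspaceT; apply: cont_val; exact: cont_id.
- exact: wcont_to_sub.
Qed.

(** A continuous map from a compact space to a Hausdorff one is closed, so the inverse is continuous
    on the range. The given point of [T] is the value of the inverse elsewhere. *)
Lemma compact_is_homeo {T U : topologicalType} (f : T -> U) :
  compact [set: T] -> hausdorff_space U -> continuous f -> injective f ->
  T -> exists g, is_homeo [set: T] (range f) f g.
Proof.
move=> cT hU cf injf t0.
have [g gP] : exists g : U -> T, forall x, g (f x) = x.
  have h y : exists x, forall x', f x' = y -> x = x'.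
    have [[x xy]|nx] := pselect (exists x, f x = y).
      by exists x => x' x'y; apply: injf; rewrite xy.
    by exists t0 => x' x'y; exfalso; apply: nx; exists x'.
  by have [g gP] := choice h; exists g => x; exact: gP.
exists g; split.
- by move=> x _; split => //; exists x.
- by move=> _ [x _ <-]; rewrite gP.
- exact: continuous_subspaceT.
- apply/continuous_closedP => C cC; apply/closed_subspaceP.
  exists (f @` C).
    apply: compact_closed => //; apply: continuous_compact.
      exact: continuous_subspaceT.
    by apply: subclosed_compact cT _.
  apply/seteqP; split=> y [].
    by move=> [x Cx <-] yr; split => //; rewrite /from_subspace /= gP.
  by rewrite /from_subspace /= => Cg [x _ xy]; split; exists x => //; rewrite -xy gP in Cg.
Qed.

Section charts.
Context {R : realType}.

(** Cutting a chart down to [A] keeps its image open in the half-space, because the inverse of the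
    chart is continuous. Charts, boundary points and local flatness pass between open subsets by
    this. *)
Lemma chart_transport {T U : topologicalType} {n} (A : set T) (B : set U) f g
    (O : set T) V (phi : T -> 'rV[R]_n) :
  is_homeo A B f g -> open A -> open B -> chart R O V phi ->
  chart R (f @` (A `&` O)) (phi @` (A `&` O)) (phi \o g).
Proof.
move=> fg oA oB [oO [W oW VE] /homeomorphismE[psi hphi]].
have [fP gP cf cg] := fg; have [pP qP cp cq] := hphi.
split; first exact: is_homeo_openI fg oB oO.
- have /continuousP/(_ A oA)/open_subspaceP[W' oW' W'E] := cq.
  exists (W' `&` W); first exact: openI.
  rewrite -setIA -VE W'E; apply/seteqP; split=> [_ [x [Ax Ox] <-]|y [/= Ay Vy]].
    by have [Vx qpx] := pP x Ox; split => //; rewrite /from_subspace /= qpx.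
  by have [Oy pqy] := qP y Vy; exists (psi y).
- apply/homeomorphismE; exists (f \o psi).
  have h1 : is_homeo (A `&` O) (f @` (A `&` O)) f g by apply: is_homeo_sub fg => x [].
  have h2 : is_homeo (A `&` O) (phi @` (A `&` O)) phi psi.
    by apply: is_homeo_sub hphi => x [].
  exact: is_homeo_comp (is_homeo_sym _ _ _ _ h1) h2.
Qed.

Definition has_chart (n : nat) {M : topologicalType} (x : M) : Prop :=
  exists U (V : set 'rV[R]_n) phi, U x /\ chart R U V phi.

Definition locally_flat_at (n k : nat) {M : topologicalType} (S : set M) (x : M) : Prop :=
  exists U (V : set 'rV[R]_n) phi,
    [/\ U x, chart R U V phi & phi @` (S `&` U) = V `&` flat_slice R n k].

Section transport.
Context {T U : topologicalType} (A : set T) (B : set U) (f : T -> U) (g : U -> T).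
Hypotheses (fg : is_homeo A B f g) (oA : open A) (oB : open B).

Lemma has_chart_transport n x : A x -> has_chart n x -> has_chart n (f x).
Proof.
move=> Ax [D [V [phi [Dx cphi]]]].
exists (f @` (A `&` D)), (phi @` (A `&` D)), (phi \o g); split; first by exists x.
exact: chart_transport fg oA oB cphi.
Qed.

Lemma manifold_boundary_transport n x : A x ->
  manifold_boundary R n T x -> manifold_boundary R n U (f x).
Proof.
move=> Ax [D [V [phi [Dx cphi phi0]]]].
exists (f @` (A `&` D)), (phi @` (A `&` D)), (phi \o g); split.
- by exists x.
- exact: chart_transport fg oA oB cphi.
- by case: fg => fP _ _ _; move=> i i0 /=; rewrite (proj2 (fP x Ax)); exact: phi0.
Qed.

Lemma locally_flat_at_transport n k (S : set T) (S' : set U) x :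
  (forall y, A y -> (S y <-> S' (f y))) -> A x ->
  locally_flat_at n k S x -> locally_flat_at n k S' (f x).
Proof.
move=> SS Ax [D [V [phi [Dx cphi phiS]]]].
exists (f @` (A `&` D)), (phi @` (A `&` D)), (phi \o g); split.
- by exists x.
- exact: chart_transport fg oA oB cphi.
have [fP gP _ _] := fg.
have [_ _ /homeomorphismE[psi [pP qP _ _]]] := cphi.
apply/seteqP; split=> [_ [w [S'w [y [Ay Dy] yw]] <-]|_ [[y [Ay Dy] <-] fl]] /=.
  rewrite -{}yw in S'w *; rewrite (proj2 (fP y Ay)); split; first by exists y.
  have : (V `&` flat_slice R n k) (phi y) by rewrite -phiS; exists y => //; split => //; exact/SS.
  by case.
have [z [Sz Dz] zy] : (phi @` (S `&` D)) (phi y).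
  by rewrite phiS; split => //; case: (pP y Dy).
have zy' : z = y by rewrite -(proj2 (pP z Dz)) zy; case: (pP y Dy).
rewrite {}zy' in Sz; exists (f y); last by rewrite (proj2 (fP y Ay)).
by split; [exact/SS|exists y].
Qed.

End transport.

Lemma locally_flatP {n k} {M : topologicalType} (S : set M) :
  locally_flat_submanifold R n k S <->
  [/\ closed S, connected S & forall x, S x -> locally_flat_at n k S x].
Proof. by []. Qed.

End charts.

(** * Gluing *)

Lemma cont_comp {T U W : topologicalType} (f : T -> U) (g : U -> W) :
  continuous f -> continuous g -> continuous (fun x => g (f x)).
Proof. by move=> cf cg x; apply: continuous_comp; [exact: cf|exact: cg]. Qed.

Lemma quotient_map_eq {T : topologicalType} (r : T -> T -> Prop) x y :
  quotient_map r x = quotient_map r y <-> clos_refl_sym_trans T r x y.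
Proof.
have h : reflect (quotient_map r x = quotient_map r y) (gen_equiv_rel r x y).
  exact: eqmodP.
by split=> [/h/asboolP//|xy]; apply/h/asboolP.
Qed.

Lemma quotient_map_repr {T : topologicalType} (r : T -> T -> Prop) (z : quotient_by r) :
  quotient_map r (repr z) = z.
Proof. exact: reprK. Qed.

Section gluing.
Context {S : Type} {Y : bool -> topologicalType} (f : forall b, S -> Y b).

(** The index type has decidable equality, so the second components can be compared. *)
Lemma existT_inj b (y y' : Y b) : existT Y b y = existT Y b y' -> y = y'.
Proof. by apply: inj_pair2_eq_dec; exact: Bool.bool_dec. Qed.

Lemma glue_in_eq b y b' y' : glue_in f b y = glue_in f b' y' <->
  clos_refl_sym_trans _ (glue_step f) (existT Y b y) (existT Y b' y').
Proof. exact: quotient_map_eq. Qed.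

Lemma cont_glue_in b : continuous (glue_in f b).
Proof.
move=> y; apply: (@continuous_comp _ _ _ (existT Y b) (quotient_map (glue_step f))).
  exact: existT_continuous.
exact: pi_continuous.
Qed.

Lemma glue_cover (z : Defs.glue f) : exists b y, z = glue_in f b y.
Proof.
by exists (tag (repr z)), (tagged (repr z));
  rewrite /glue_in -[existT _ _ _]/(Tagged Y (tagged (repr z))) taggedK quotient_map_repr.
Qed.

Lemma glue_in_step s : glue_in f true (f true s) = glue_in f false (f false s).
Proof. by apply/glue_in_eq; apply: rst_step; exists s. Qed.

Hypothesis finj : forall b, injective (f b).

(** Every step changes side, and both maps [f b] are injective, so two consecutive steps lead back
    to the start; longer chains therefore collapse. *)
Lemma glue_rst p q : clos_refl_sym_trans _ (glue_step f) p q ->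
  p = q \/ glue_step f p q \/ glue_step f q p.
Proof.
elim=> {p q} [p q h|p|p q _ [->|[h|h]]|p q r _ h1 _ h2].
- by right; left.
- by left.
- by left.
- by right; right.
- by right; left.
case: h1 => [->//|h1]; case: h2 => [<-|h2]; first by right.
move: h2 h1.
move=> [[s [qs rs]]|[s [rs qs]]] [[s' [ps' qs']]|[s' [qs' ps']]].
- by move: qs; rewrite qs' => /(congr1 (@projT1 _ _)).
- left; rewrite ps' rs; have E : f true s = f true s' by apply: existT_inj; rewrite -qs -qs'.
  by rewrite (finj true _ _ E).
- left; rewrite ps' rs; have E : f false s = f false s' by apply: existT_inj; rewrite -qs -qs'.
  by rewrite (finj false _ _ E).
- by move: qs; rewrite qs' => /(congr1 (@projT1 _ _)).
Qed.

Lemma glue_in_inj b : injective (glue_in f b).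
Proof.
move=> y y' /glue_in_eq /glue_rst [/existT_inj//|[]] [s []] h1 h2.
  by have := congr1 (@projT1 _ _) h1; have := congr1 (@projT1 _ _) h2; case: b y y' h1 h2.
by have := congr1 (@projT1 _ _) h1; have := congr1 (@projT1 _ _) h2; case: b y y' h1 h2.
Qed.

Lemma glue_in_tf y y' : glue_in f true y = glue_in f false y' ->
  exists s, y = f true s /\ y' = f false s.
Proof.
move=> /glue_in_eq /glue_rst [/(congr1 (@projT1 _ _))//|[]] [s [h1 h2]].
  by exists s; split; exact: existT_inj.
by have := congr1 (@projT1 _ _) h1.
Qed.

End gluing.

(** The pushout described inside [Z], so that a decomposition can be checked without handling the
    quotient. For compact pieces and Hausdorff [Z] it yields the quotient up to homeomorphism. *)
Definition is_gluing {S : Type} {Y : bool -> topologicalType}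
    (f : forall b, S -> Y b) {Z : topologicalType} (i : forall b, Y b -> Z) : Prop :=
  [/\ forall b, continuous (i b), forall b, injective (i b),
      forall z, exists b y, z = i b y,
      forall s, i true (f true s) = i false (f false s) &
      forall y y', i true y = i false y' -> exists s, y = f true s /\ y' = f false s].

Lemma is_gluing_homeo {S : Type} {Y : bool -> topologicalType}
    (f : forall b, S -> Y b) {Z : topologicalType} (h : Defs.glue f -> Z) k :
  (forall b, injective (f b)) -> is_homeo [set: Defs.glue f] [set: Z] h k ->
  is_gluing f (fun b y => h (glue_in f b y)).
Proof.
move=> finj [hP kP ch ck]; have hinj : injective h.
  by move=> x y xy; rewrite -(proj2 (hP x Logic.I)) xy; case: (hP y Logic.I).
split.
- by move=> b; apply: cont_comp (cont_glue_in f b) _; exact/continuous_subspace_setT.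
- by move=> b y y' /hinj; exact: glue_in_inj.
- move=> z; have [b [y zy]] := glue_cover f (k z); exists b, y.
  by rewrite -zy; case: (kP z Logic.I).
- by move=> s; rewrite glue_in_step.
- by move=> y y' /hinj; exact: glue_in_tf.
Qed.

(** The maps [i b] induce a continuous bijection from the quotient, a compact space, to the
    Hausdorff space [Z]. The point of [Y true] supplies the default of the inverse. *)
Lemma is_gluing_glue {S : Type} {Y : bool -> topologicalType}
    (f : forall b, S -> Y b) {Z : topologicalType} (i : forall b, Y b -> Z) :
  (forall b, compact [set: Y b]) -> hausdorff_space Z -> Y true -> is_gluing f i ->
  exists h k, is_homeo [set: Defs.glue f] [set: Z] h k /\
    forall b y, h (glue_in f b y) = i b y.
Proof.
move=> cY hZ y0 [ci iinj icov istep iover].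
pose j (p : {b & Y b}) := i (projT1 p) (projT2 p).
pose h (z : Defs.glue f) := j (repr z).
have jrst p q : clos_refl_sym_trans _ (glue_step f) p q -> j p = j q.
  elim=> {p q} //; last by move=> p q r _ -> _ ->.
  by move=> p q [s [-> ->]]; exact: istep.
have hE b y : h (glue_in f b y) = i b y.
  rewrite -[RHS]/(j (existT Y b y)); apply: jrst; apply/quotient_map_eq.
  exact: quotient_map_repr.
have ch : continuous h.
  apply: repr_comp_continuous.
    by apply: sigT_continuous => b; exact: ci.
  by move=> p q /eqP pq; apply/eqP/jrst/quotient_map_eq.
have hinj : injective h.
  move=> z z'; have [b [y ->]] := glue_cover f z; have [b' [y' ->]] := glue_cover f z'.
  rewrite !hE; case: b y => y; case: b' y' => y'.
  - by move=> /iinj ->.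
  - by move=> /iover[s [-> ->]]; exact: glue_in_step.
  - by move=> /esym/iover[s [-> ->]]; rewrite glue_in_step.
  - by move=> /iinj ->.
have cG : compact [set: Defs.glue f].
  have -> : [set: Defs.glue f] = quotient_map (glue_step f) @` [set: {b & Y b}].
    apply/seteqP; split=> // z _; exists (repr z) => //; exact: quotient_map_repr.
  apply: continuous_compact; first by apply: continuous_subspaceT; exact: pi_continuous.
  by apply: sigT_compact => //; exact: finite_finset.
have [k hk] := compact_is_homeo h cG hZ ch hinj (glue_in f true y0).
exists h, k; split => //; suff -> : [set: Z] = range h by [].
apply/seteqP; split=> // z _; have [b [y ->]] := icov z.
by exists (glue_in f b y).
Qed.

(** * An interior point off the surface *)

Section dimension.
Context {R : realType}.
Notation I := (unit_interval R).

Lemma compact_set_type {X : topologicalType} (A : set X) (d : set_type A) :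
  compact A -> compact [set: set_type A].
Proof.
move=> cA; have -> : [set: set_type A] = to_sub d @` A.
  apply/seteqP; split=> // x _; exists (set_val x); first exact: valP_set.
  exact: val_subK.
by apply: continuous_compact cA; exact: wcont_to_sub.
Qed.

Lemma compact_sphere n : compact [set: sphere R n].
Proof.
apply: (compact_set_type _ (pole n)); apply: bounded_closed_compact.
  exists 1; split; first exact: num_real.
  move=> M M1 v /= v1; rewrite [`|v|]mx_normrE; apply: bigmax_le => [|[i j] _ /=].
    by rewrite ltW// (lt_trans ltr01).
  rewrite (ord1 i); apply: le_trans (ltW M1).
  have := sqr_coord_le v j; rewrite /normsq v1 => h.
  by rewrite -(ler_pXn2r (n := 2))// ?nnegrE// expr1n real_normK ?num_real.
have -> : [set v : 'rV[R]_n.+1 | \sum_i v ord0 i ^+ 2 = 1] = normsq @^-1` [set 1].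
  by [].
apply: closed_comp; last exact: closed_eq.
by move=> v _; move: v; apply: cont_normsq; exact: cont_id.
Qed.

Lemma hausdorff_set_type {X : topologicalType} (A : set X) :
  hausdorff_space X -> hausdorff_space (set_type A).
Proof.
move=> hX p q pq; apply: val_inj; apply: (hX (set_val p) (set_val q)) => B C pB qC.
have cv : continuous (fun x : set_type A => set_val x) by apply: cont_val; exact: cont_id.
by have [x [Bx Cx]] := pq _ _ (cv p B pB) (cv q C qC); exists (set_val x).
Qed.

Lemma hausdorff_sphere n : hausdorff_space (sphere R n).
Proof. by apply: hausdorff_set_type; exact: norm_hausdorff. Qed.

(* The bottom edge and an arc above it both join two corners of the square. *)
Lemma no_square_line (k : R * R -> R) : {within I `*` I, continuous k} ->
  ~ {in I `*` I &, injective k}.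
Proof.
move=> ck kinj; have I0 := @unit0 R; have I1 := @unit1 R.
(* Any arc joining the two bottom corners takes the value [m]. By injectivity the edge and the arc
   take it at the same point, which is then a corner; but the corners have two different values with
   mean [m]. *)
pose m := (k (0, 0) + k (1, 0)) / 2.
have ivt (a : R -> R) : continuous a -> (forall t, I t -> I (a t)) -> a 0 = 0 -> a 1 = 0 ->
    exists2 t, I t & k (t, a t) = m.
  move=> ca aI a0 a1.
  have [|||t tI tm] := @IVT R (fun t => k (t, a t)) 0 1 m.
  - exact: ler01.
  - apply: (@wcont_comp _ _ _ _ (I `*` I) (fun t => (t, a t)) _ _ _ ck); last by split => //=; exact: aI.
    by cont_auto.
  - rewrite a0 a1 /m ge_min le_max.
    case: (leP (k (0, 0)) (k (1, 0))) => h; apply/andP; split; lra.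
  - by exists t => //; rewrite unitE; rewrite in_itv in tI.
have [||||s Is sm] := ivt (cst 0); [exact: cst_continuous|by []|by []|by []|].
have [||||t It tm] := ivt (fun t => t * (1 - t)).
- by cont_auto.
- by move=> t; rewrite !unitE => /andP[t0 t1]; apply/andP; split; nra.
- by rewrite mul0r.
- by rewrite subrr mulr0.
have /andP[t0 t1] : 0 <= t <= 1 by rewrite -unitE.
have It2 : I (t * (1 - t)) by rewrite unitE; apply/andP; split; nra.
have E : (t, t * (1 - t)) = (s, 0).
  by apply: kinj; rewrite ?inE//= tm sm.
have tt : t * (1 - t) = 0 by case: E.
have h01 : k (0, 0) != k (1, 0).
  by apply/eqP => /kinj; rewrite !inE => /(_ (conj I0 I0) (conj I1 I0)) [] /eqP; rewrite eq_sym oner_eq0.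
have mk (a : R) : a = 0 \/ a = 1 -> k (a, 0) != m.
  by move=> [->|->]; apply/eqP => e; move/eqP: h01; apply; rewrite /m in e; lra.
rewrite tt in tm; move/eqP: tt; rewrite mulf_eq0 subr_eq0 => /orP[/eqP e|/eqP e].
  by have := mk t (or_introl e); rewrite tm eqxx.
by have := mk t (or_intror (esym e)); rewrite tm eqxx.
Qed.

(** An injective square passes through [p] at most once, so its left third or its right third misses
    [p]; the offset [b], 0 or 2, selects the third, which is then rescaled. *)
Lemma square_avoid {T : topologicalType} (c : R * R -> T) (p : T) :
  {within I `*` I, continuous c} -> {in I `*` I &, injective c} ->
  exists c' : R * R -> T, [/\ {within I `*` I, continuous c'},
    {in I `*` I &, injective c'} &
    forall z, (I `*` I) z -> c' z <> p /\ exists2 w, (I `*` I) w & c' z = c w].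
Proof.
move=> cc cinj.
have key (b : R) : b = 0 \/ b = 2 -> (forall s t, I s -> I t -> c ((b + s) / 3, t) <> p) ->
    exists c' : R * R -> T, [/\ {within I `*` I, continuous c'},
    {in I `*` I &, injective c'} &
    forall z, (I `*` I) z -> c' z <> p /\ exists2 w, (I `*` I) w & c' z = c w].
  move=> hb bp; have bI s : I s -> I ((b + s) / 3).
    by rewrite !unitE => /andP[s0 s1]; case: hb => ->; unit_lra.
  exists (fun z => c ((b + z.1) / 3, z.2)); split.
  - apply: (@wcont_comp _ _ _ _ (I `*` I) (fun z : R * R => ((b + z.1) / 3, z.2)) _ _ _ cc).
      by cont_auto.
    by move=> [s t] [/= Is It]; split => //=; exact: bI.
  - move=> [s t] [s' t']; rewrite !inE => -[/= Is It] [/= Is' It'] /cinj.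
    rewrite !inE => /(_ (conj (bI _ Is) It) (conj (bI _ Is') It')) [] h ->.
    by congr (_, _); lra.
  - move=> [s t] [/= Is It]; split; first exact: bp.
    by exists ((b + s) / 3, t) => //; split => //=; exact: bI.
have [h|/existsNP[s0 /existsNP[t0 h]]] := pselect (forall s t, I s -> I t -> c ((0 + s) / 3, t) <> p).
  by apply: (key 0) => //; left.
apply: (key 2); first by right.
move=> s t Is It E; apply: h => Is0 It0 E0.
have : c ((0 + s0) / 3, t0) = c ((2 + s) / 3, t) by rewrite E E0.
move: Is Is0; rewrite !unitE => /andP[? ?] /andP[? ?] /cinj; rewrite !inE.
have h1 : (I `*` I) ((0 + s0) / 3, t0) by split => //=; unit_lra.
have h2 : (I `*` I) ((2 + s) / 3, t) by split => //=; unit_lra.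
by move=> /(_ h1 h2) [] e _; have /negP := ltr10 R; apply; lra.
Qed.

(** Once the square misses the pole, stereographic projection turns it into an injective square on a
    line. *)
Lemma no_square_circle (c : R * R -> sphere R 1) : {within I `*` I, continuous c} ->
  ~ {in I `*` I &, injective c}.
Proof.
move=> cc cinj; have [c' [cc' cinj' c'P]] := square_avoid c (pole 1) cc cinj.
apply: (@no_square_line (fun z => stereo 1 (c' z) ord0 ord0)).
  apply: cont_coord; apply: (@wcont_comp _ _ _ _ [set x | x <> pole 1] c' _ cc' _ (wcont_stereo 1)).
  by move=> z /c'P[].
move=> z w; rewrite !inE => Iz Iw E.
have [pz _] := c'P z Iz; have [pw _] := c'P w Iw.
apply: cinj'; rewrite ?inE//; rewrite -(stereoK 1 _ pz) -(stereoK 1 _ pw).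
by congr unstereo; apply/rowP => i; rewrite (ord1 i).
Qed.

(** The image of [O] under the chart is relatively open in [V], and [V] in the half-space, so both
    contain the trace of a small ball; in the maximum norm this ball is a cube. *)
Lemma chart_box {M : topologicalType} {n} (U O : set M) (V : set 'rV[R]_n) phi y :
  chart R U V phi -> open O -> U y -> O y ->
  exists2 e : R, 0 < e & forall v, half_space R n v ->
    (forall i, `|v ord0 i - phi y ord0 i| < e) -> exists2 y', (U `&` O) y' & phi y' = v.
Proof.
move=> [oU [W oW VE] /homeomorphismE[psi [pP qP cp cq]]] oO Uy Oy.
have /continuousP/(_ O oO)/open_subspaceP[W' oW' W'E] := cq.
have [Vy qpy] := pP y Uy.
have W'y : (W' `&` W) (phi y).
  have : (W' `&` V) (phi y) by rewrite W'E; split => //; rewrite /from_subspace /= qpy.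
  by rewrite VE => -[? []].
have /nbhs_ballP[e /= e0 eW] : nbhs (phi y) (W' `&` W).
  by apply: open_nbhs_nbhs; split => //; exact: openI.
exists e => // v hv ve; have [W'v Wv] : (W' `&` W) v.
  apply: eW; split => // i j; rewrite (ord1 i).
  by change (`|phi y ord0 j - v ord0 j| < e); rewrite distrC.
have Vv : V v by rewrite VE.
have [Uv pqv] := qP v Vv; exists (psi v) => //; split => //.
by have : (W' `&` V) v by []; rewrite W'E => -[].
Qed.

Lemma half_space_coord0 n (v : 'rV[R]_n.+1) : half_space R n.+1 v <-> 0 <= v ord0 ord0.
Proof. by split=> [h|h i i0]; [exact: h|rewrite (_ : i = ord0)//; exact: val_inj]. Qed.

Lemma chart_half_space {M : topologicalType} {n} (U : set M) (V : set 'rV[R]_n) phi y :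
  chart R U V phi -> U y -> half_space R n (phi y).
Proof.
move=> [_ [W _ ->] /homeomorphismE[psi [pP _ _ _]]] Uy.
by have [[]] := pP y Uy.
Qed.

Lemma knot_ne (K : set (sphere R 3)) : knot R K -> K !=set0.
Proof.
move=> [_ /= [h /homeomorphismE[k [_ kP _ _]]]].
by exists (k (pole 1)); case: (kP (pole 1) Logic.I).
Qed.

(* Otherwise [Y] is its own boundary, as the complement of the surface is dense,
   and the surface, which is locally 2-dimensional, embeds in the circle [K]. *)
Lemma interior_point {Y : topologicalType} (f : sphere R 3 -> Y) (K : set (sphere R 3))
    (F : set Y) (y0 : Y) :
  sphere_bounded R f -> knot R K -> locally_flat_submanifold R 4 2 F ->
  F `&` manifold_boundary R 4 Y = f @` K ->
  exists y, [/\ ~ manifold_boundary R 4 Y y, ~ F y & y <> y0].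
Proof.
move=> [[hY _ _ _ _] /homeomorphismE[k hf]] hK /locally_flatP[cF _ flatF] FK.
apply: contrapT => no.
have [fP kP cf ck] := hf.
have bdE : manifold_boundary R 4 Y = range f.
  apply/seteqP; split=> [y /kP[_ fk]|_ [x _ <-]]; first by exists (k y).
  by case: (fP x Logic.I).
have cbd : closed (manifold_boundary R 4 Y).
  rewrite bdE; apply: (compact_closed hY).
  exact: continuous_compact cf (compact_sphere 3).
(* Under the assumption [no], all points of [D] lie on [F]. The claim [D0] is that there are
   none. *)
pose D := ~` (manifold_boundary R 4 Y `|` [set y0]).
have oD : open D.
  apply: closed_openC; apply: closedU => //.
  exact: (compact_closed hY (compact_set1 (x := y0))).
have D0 y : ~ D y.
  move=> Dy; have Fsub y' : D y' -> F y'.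
    move=> Dy'; apply: contrapT => nF; apply: no; exists y'; split => //.
      by move=> h; apply: Dy'; left.
    by move=> h; apply: Dy'; right.
  have [U [V [phi [Uy cphi phiS]]]] := flatF y (Fsub y Dy).
  have [e e0 he] := chart_box U D V phi y cphi oD Uy Dy.
  pose i3 : 'I_4 := ord_max.
  (* The last coordinate vanishes on the flat slice: a small shift along it leaves [F] but remains
     in the open set [D]. *)
  pose v := phi y + (e / 2) *: delta_mx ord0 i3.
  have flat w : (F `&` U) w -> phi w ord0 i3 = 0.
    move=> Fw; have : (V `&` flat_slice R 4 2) (phi w) by rewrite -phiS; exists w.
    by move=> [_]; apply.
  have vE i : v ord0 i = phi y ord0 i + e / 2 * (i == i3)%:R by rewrite !mxE eqxx.
  have [||y' [Uy' Dy'] y'v] := he v.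
  - apply/half_space_coord0; rewrite vE mulr0 addr0.
    by have /half_space_coord0 := chart_half_space _ _ _ _ cphi Uy.
  - move=> i; rewrite vE addrAC subrr add0r; case: (i == i3).
      by rewrite mulr1 ger0_norm ?divr_ge0 ?ltW//; lra.
    by rewrite mulr0 normr0.
  have := flat y' (conj (Fsub _ Dy') Uy'); rewrite y'v vE eqxx mulr1.
  rewrite (flat y (conj (Fsub _ Dy) Uy)) => h; have /negP := ltr10 R; apply; lra.
have FKy y : F y -> y <> y0 -> exists2 x, K x & f x = y.
  move=> Fy yy0; suff : (f @` K) y by [].
  rewrite -FK; split => //; apply: contrapT => nb; apply: (D0 y) => -[//|].
  exact: yy0.
have [x0 Kx0] := knot_ne K hK.
have [Fy _] : (F `&` manifold_boundary R 4 Y) (f x0) by rewrite FK; exists x0.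
set y := f x0 in Fy.
have [U [V [phi [Uy cphi phiS]]]] := flatF y Fy.
have [e e0 he] := chart_box U [set: Y] V phi y cphi openT Uy Logic.I.
have [_ _ /homeomorphismE[psi [pP qP cp cq]]] := cphi.
pose i0 : 'I_4 := ord0; pose i1 : 'I_4 := lift ord0 ord0.
(* A small square in the two directions of the slice. It extends from [phi y] in the positive
   directions, so it does not leave the half-space. *)
pose v (z : R * R) := phi y + (e / 2 * z.1) *: delta_mx ord0 i0 + (e / 2 * z.2) *: delta_mx ord0 i1.
have vE z i : v z ord0 i = phi y ord0 i + e / 2 * z.1 * (i == i0)%:R + e / 2 * z.2 * (i == i1)%:R.
  by rewrite !mxE !eqxx.
have vP z : (I `*` I) z -> (V `&` flat_slice R 4 2) (v z).
  case: z => s t [/=]; rewrite !unitE => /andP[s0 s1] /andP[t0 t1].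
  have fy : (V `&` flat_slice R 4 2) (phi y) by rewrite -phiS; exists y.
  have st0 : 0 <= e / 2 * s /\ 0 <= e / 2 * t.
    by split; rewrite mulr_ge0// divr_ge0// ltW.
  have st1 : e / 2 * s <= e / 2 /\ e / 2 * t <= e / 2.
    by split; rewrite ler_piMr// divr_ge0// ltW.
  split.
    have [||y' [Uy' _] <-] := he (v (s, t)); last by case: (pP y' Uy').
    - apply/half_space_coord0; rewrite vE eqxx mulr1 mulr0 addr0 /=.
      have /half_space_coord0 := chart_half_space _ _ _ _ cphi Uy; lra.
    - move=> i; rewrite vE /=.
      rewrite [X in `|X|](_ : _ = e / 2 * s * (i == i0)%:R + e / 2 * t * (i == i1)%:R); last by ring.
      have [->|ni0] := eqVneq i i0.
        by rewrite mulr1 mulr0 addr0 ger0_norm; lra.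
      case: (i == i1); last by rewrite !mulr0 addr0 normr0.
      by rewrite mulr0 mulr1 add0r ger0_norm; lra.
  move=> i i2; rewrite vE; have [_ /(_ i i2) ->] := fy.
  have -> : (i == i0) = false by apply/eqP => E; rewrite E in i2.
  have -> : (i == i1) = false by apply/eqP => E; rewrite E in i2.
  by rewrite !mulr0 !addr0.
pose c z := psi (v z).
have cc : {within I `*` I, continuous c}.
  apply: (@wcont_comp _ _ _ _ V v _ _ _ cq); last by move=> z /vP[].
  rewrite /v; apply: continuous_subspaceT; apply: cont_vadd.
    by apply: cont_vadd; [exact: cst_continuous|apply: cont_scale; cont_auto].
  by apply: cont_scale; cont_auto.
have cF' z : (I `*` I) z -> F (c z).
  move=> /vP vz; have : (phi @` (F `&` U)) (v z) by rewrite phiS.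
  by move=> [w [Fw Uw] wv]; rewrite /c -wv (proj2 (pP w Uw)).
have cinj : {in I `*` I &, injective c}.
  move=> z w; rewrite !inE => Iz Iw E.
  have [Vz _] := vP z Iz; have [Vw _] := vP w Iw.
  have : v z = v w by rewrite -(proj2 (qP _ Vz)) -(proj2 (qP _ Vw)) -/(c z) E.
  move=> /rowP vv; have := vv i0; have := vv i1; rewrite !vE !eqxx !mulr1.
  rewrite !mulr0 !addr0 => h1 h2.
  have e2 : e / 2 != 0 by rewrite gt_eqF// divr_gt0.
  rewrite [z]surjective_pairing [w]surjective_pairing; congr (_, _); apply: (mulfI e2); lra.
(* Apart from [y0], the surface lies in the image of [K]; a square of it that misses [y0] injects
   into the knot, hence into a circle. *)
have [c' [cc' cinj' c'P]] := square_avoid c y0 cc cinj.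
have [_ [m /homeomorphismE[m' [mP mP' cm cm']]]] := hK.
have c'K z : (I `*` I) z -> exists2 x, K x & f x = c' z.
  by move=> /c'P[c'z [w Iw E]]; apply: FKy => //; rewrite E; exact: cF'.
have kK z : (I `*` I) z -> K (k (c' z)) /\ f (k (c' z)) = c' z.
  by move=> /c'K[x Kx <-]; rewrite (proj2 (fP x Logic.I)).
apply: (@no_square_circle (fun z => m (k (c' z)))).
  apply: (@wcont_comp _ _ _ _ K (fun z => k (c' z)) _ _ _ cm); last by move=> z /kK[].
  apply: (@wcont_comp _ _ _ _ (manifold_boundary R 4 Y) c' _ cc' _ ck).
  by move=> z /kK[_ <-]; case: (fP (k (c' z)) Logic.I).
move=> z w; rewrite !inE => Iz Iw E.
have [Kz fz] := kK z Iz; have [Kw fw] := kK w Iw.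
apply: cinj'; rewrite ?inE// -fz -fw; congr f.
by rewrite -(proj2 (mP _ Kz)) E; case: (mP _ Kw).
Qed.

End dimension.

(** * Open balls in manifolds *)

Section euclidean_chart.
Context {R : realType}.

Definition box {n : nat} (c : 'rV[R]_n) (e : R) : set 'rV[R]_n :=
  [set v | forall i, `|v ord0 i - c ord0 i| < e].

Lemma open_box {n} (c : 'rV[R]_n) e : open (box c e).
Proof.
have -> : box c e = \bigcap_(i in [set: 'I_n]) [set v : 'rV[R]_n | `|v ord0 i - c ord0 i| < e].
  by apply/seteqP; split=> v h; [move=> i _; exact: h|move=> i; exact: h].
rewrite openE => v hv.
have h i : nbhs v [set v : 'rV[R]_n | `|v ord0 i - c ord0 i| < e].
  apply: open_nbhs_nbhs; split; last exact: hv.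
  apply: (@open_comp _ _ (fun v : 'rV[R]_n => `|v ord0 i - c ord0 i|) [set t | t < e]);
    last exact: open_lt.
  move=> w _; move: w; apply: cont_norm; apply: cont_add; last exact: cst_continuous.
  by apply: cont_coord; exact: cont_id.
have := filter_forall (nbhs_filter v) h.
by apply: filterS => w hw i _; exact: hw.
Qed.

(** In each coordinate this is [t / (1 + |t|)], with inverse [t / (1 - |t|)], scaled by [e] and
    centred at [c]. *)
Lemma box_homeo {n} (c : 'rV[R]_n) (e : R) : 0 < e ->
  exists k k', is_homeo [set: 'rV[R]_n] (box c e) k k'.
Proof.
move=> e0.
pose u (v : 'rV[R]_n) i := (v ord0 i - c ord0 i) / e.
have d0 (t : R) : 0 < 1 + `|t| by rewrite ltr_wpDr.
exists (fun y : 'rV[R]_n => \row_i (c ord0 i + e * (y ord0 i * (1 + `|y ord0 i|)^-1))).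
exists (fun v : 'rV[R]_n => \row_i (u v i * (1 - `|u v i|)^-1)).
have ub v i : box c e v -> `|u v i| < 1.
  by move=> /(_ i) h; rewrite /u normrM normfV (gtr0_norm e0) ltr_pdivrMr// mul1r.
split.
- move=> y _; split.
    move=> i; rewrite mxE addrC addKr normrM (gtr0_norm e0) -[ltRHS]mulr1 ltr_pM2l//.
    by rewrite normrM normfV (gtr0_norm (d0 _)) ltr_pdivrMr// mul1r ltrDr.
  apply/rowP => i; rewrite mxE; have h := d0 (y ord0 i).
  have -> : u (\row_i (c ord0 i + e * (y ord0 i * (1 + `|y ord0 i|)^-1))) i =
      y ord0 i / (1 + `|y ord0 i|).
    by rewrite /u mxE; field; rewrite !gt_eqF.
  rewrite normrM normfV (gtr0_norm (d0 _)).
  set a := `|_| in h *.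
  have e1 : 1 - a / (1 + a) = (1 + a)^-1 by field; rewrite gt_eqF.
  by rewrite e1 invrK mulrVK// unitfE gt_eqF.
- move=> v hv; split => //; apply/rowP => i; rewrite !mxE.
  have h := ub v i hv; have uE : u v i = (v ord0 i - c ord0 i) / e by [].
  move: (u v i) h uE => w h uE; have h0 : 0 < 1 - `|w| by rewrite subr_gt0.
  rewrite normrM normfV (gtr0_norm h0).
  have e1 : 1 + `|w| / (1 - `|w|) = (1 - `|w|)^-1 by field; rewrite gt_eqF.
  rewrite e1 invrK mulrVK ?unitfE ?gt_eqF// uE mulrCA divff ?gt_eqF// mulr1.
  by rewrite addrC subrK.
- apply: continuous_subspaceT; apply: cont_row => i.
  have cy : continuous (fun y : 'rV[R]_n => y ord0 i) by apply: cont_coord; exact: cont_id.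
  apply: cont_add; first exact: cst_continuous.
  apply: cont_mul; first exact: cst_continuous.
  apply: cont_mul => //; apply: cont_inv; first by move=> y; rewrite gt_eqF.
  by apply: cont_add; [exact: cst_continuous|exact: cont_norm].
- apply: cont_row => i.
  have cu : continuous (fun v : 'rV[R]_n => u v i).
    apply: cont_mul; last exact: cst_continuous.
    apply: cont_add; last exact: cst_continuous.
    by apply: cont_coord; exact: cont_id.
  apply: cont_mul; first exact: continuous_subspaceT.
  apply: wcont_inv; last by move=> v /ub h; rewrite subr_eq0 gt_eqF.
  apply: continuous_subspaceT; apply: cont_add; first exact: cst_continuous.
  by apply: cont_opp; exact: cont_norm.
Qed.

(** As the boundary is empty, the first coordinate of [x] in a chart is positive. A cube whose
    radius does not exceed it lies in the open half-space, and a cube is homeomorphic to the whole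
    space. *)
Lemma euclidean_chart {n} (X : topologicalType) (x : X) : closed_manifold R n.+1 X ->
  exists (O : set X) psi phi, open O /\ is_homeo [set: 'rV[R]_n.+1] O psi phi.
Proof.
move=> [[_ _ _ _ chX] bd0]; have [U [V [phi [Ux cphi]]]] := chX x.
have [oU _ /homeomorphismE[psi hphi]] := cphi.
have x0 : 0 < phi x ord0 ord0.
  rewrite lt_neqAle; apply/andP; split; last first.
    by have /half_space_coord0 := chart_half_space _ _ _ _ cphi Ux.
  apply/eqP => p0; suff : manifold_boundary R n.+1 X x by rewrite bd0.
  exists U, V, phi; split => // i i0; rewrite p0; congr (phi x ord0).
  exact: val_inj.
have [e e0 he] := chart_box U [set: X] V phi x cphi openT Ux Logic.I.
pose d := Num.min e (phi x ord0 ord0).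
have d0 : 0 < d by rewrite lt_min e0.
have bV : box (phi x) d `<=` V.
  move=> v hv; have [||y [Uy _] <-] := he v.
  - apply/half_space_coord0; have := hv ord0; rewrite lt_min => /andP[_].
    by rewrite ltr_norml => /andP[h _]; lra.
  - by move=> i; have := hv i; rewrite lt_min => /andP[].
  - by case: hphi => /(_ y Uy)[].
have [k [k' hk]] := box_homeo (phi x) d d0.
exists (psi @` box (phi x) d), (psi \o k), (k' \o phi); split.
  have -> : box (phi x) d = V `&` box (phi x) d by apply/esym/setIidPr.
  exact: is_homeo_openI (is_homeo_sym _ _ _ _ hphi) oU (open_box _ _).
apply: is_homeo_comp hk _.
exact: is_homeo_sub bV (is_homeo_sym _ _ _ _ hphi).
Qed.

End euclidean_chart.

(** * Consequences of the van Kampen argument *)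

Section van_kampen_consequences.
Context {R : realType}.
Notation I := (unit_interval R).

(** Paths are total functions, so agreement on [0, 1] is not equality; homotopies ignore the other
    values. *)
Lemma path_homotopic_ext {T : topologicalType} (A : set T) x y (g h : R -> T) :
  paths R A x y g -> (forall t, I t -> g t = h t) -> path_homotopic R A x y g h.
Proof.
move=> /path_homotopic_refl/path_homotopicP[H sH bH] gh; apply/path_homotopicP.
by exists H => // t It; have [-> -> -> ->] := bH t It; rewrite gh.
Qed.

Lemma pi1_isoZ_homeo {T U : topologicalType} (A : set T) (B : set U) f g x :
  is_homeo A B f g -> A x -> pi1_isoZ R A x <-> pi1_isoZ R B (f x).
Proof.
move=> [fP gP cf cg] Ax.
have fB y : A y -> B (f y) by move=> /fP[].
have gA y : B y -> A (g y) by move=> /gP[].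
apply: pi1_isoZ_transfer => //.
- move=> k pk; exists (fun t => g (k t)).
    by have := paths_image _ _ _ cg gA _ _ _ pk; rewrite (proj2 (fP x Ax)).
  apply: path_homotopic_sym; apply: path_homotopic_ext => // t It.
  have /pathsE[[_ kB] _ _] := pk; by case: (gP (k t) (kB t It)).
- move=> h k ph pk hk; have := path_homotopic_image _ _ _ cg gA _ _ _ _ hk.
  rewrite (proj2 (fP x Ax)) => gfhk.
  have gf l : paths R A x x l -> path_homotopic R A x x l (fun t => g (f (l t))).
    move=> pl; apply: path_homotopic_ext => // t It.
    by have /pathsE[[_ lA] _ _] := pl; case: (fP (l t) (lA t It)).
  apply: path_homotopic_trans (gf h ph) _.
  by apply: path_homotopic_trans gfhk _; apply: path_homotopic_sym; exact: gf.
Qed.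

Context {T : topologicalType} (U V : set T).
Hypotheses (oU : open U) (oV : open V) (cP : path_connected R (U `&` V))
  (P0 : U `&` V !=set0).

(** A homotopy in the union is a square with its sides in [U], and can be refilled in [U]. This is
    the injectivity half of van Kampen. *)
Lemma van_kampen_homotopic x y (g h : R -> T) : fillable (R := R) (U `&` V) ->
  paths R U x y g -> paths R U x y h ->
  path_homotopic R (U `|` V) x y g h -> path_homotopic R U x y g h.
Proof.
move=> fP /pathsE[[cg gU] g0 g1] /pathsE[[ch hU] h0 h1] /path_homotopicP[H sH bH].
have I0 := @unit0 R; have I1 := @unit1 R.
have [|H' sH' bH'] := van_kampen_square U V oU oV cP P0 H fP sH.
  move=> t It; have [-> -> -> ->] := bH t It; have [gU0 gU1] := (gU 0 I0, gU 1 I1).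
  rewrite g0 in gU0; rewrite g1 in gU1.
  by split; [exact: gU| |exact: hU|].
apply/path_homotopicP; exists H' => // t It.
by have [-> -> -> ->] := bH' t It; exact: bH.
Qed.

(** Fillings in the union have their sides in [U] and are refilled there. Simple connectedness thus
    descends from the whole to a piece, the direction needed for the complement of a ball in [X]. *)
Lemma van_kampen_fillable : fillable (R := R) (U `&` V) ->
  fillable (R := R) (U `|` V) -> fillable (R := R) U.
Proof.
move=> fP fUV b r u l pb pr pu pl bl br ul ur.
have sub : U `<=` U `|` V by left.
have [H sH bH] := fUV b r u l (path_inS _ _ _ sub pb) (path_inS _ _ _ sub pr)
  (path_inS _ _ _ sub pu) (path_inS _ _ _ sub pl) bl br ul ur.
have [|H' sH' bH'] := van_kampen_square U V oU oV cP P0 H fP sH.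
  move=> t It; have [-> -> -> ->] := bH t It.
  by split; [case: pb|case: pr|case: pu|case: pl] => _; apply.
exists H' => // t It.
by have [-> -> -> ->] := bH' t It; exact: bH.
Qed.

Hypotheses (cV : path_connected R V) (fV : fillable (R := R) V).

Lemma van_kampen_path_connected : path_connected R (U `|` V) -> path_connected R U.
Proof.
move=> cUV x y Ux Uy; have [g /pathsE[pg g0 g1]] := cUV x y (or_introl Ux) (or_introl Uy).
have [||g' pg' _] := van_kampen_path U V oU oV cP P0 g cV fV pg; rewrite ?g0 ?g1//.
by exists g'; rewrite -g0 -g1.
Qed.

(** On loops, the inclusion is onto by [van_kampen_path] and one-to-one by
    [van_kampen_homotopic]. *)
Lemma van_kampen_isoZ x : fillable (R := R) (U `&` V) -> U x ->
  pi1_isoZ R U x <-> pi1_isoZ R (U `|` V) x.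
Proof.
move=> fP Ux; apply: (pi1_isoZ_transfer U (U `|` V) id x).
- by apply: continuous_subspaceT; exact: cont_id.
- by left.
- move=> k /pathsE[pk k0 k1].
  have [||g' pg' gk] := van_kampen_path U V oU oV cP P0 k cV fV pk; rewrite ?k0 ?k1//.
  rewrite k0 k1 in pg' gk; exists g' => //.
  exact: path_homotopic_sym.
- by move=> g h pg ph; exact: van_kampen_homotopic.
Qed.

End van_kampen_consequences.

Lemma path_connectedU {R : realType} {T : topologicalType} (U V : set T) :
  path_connected R U -> path_connected R V -> U `&` V !=set0 -> path_connected R (U `|` V).
Proof.
move=> cU cV [z [Uz Vz]]; apply: (path_connected_from _ z) => x [Ux|Vx].
  have [g /pathsE[pg g0 g1]] := cU x z Ux Uz; exists g; apply/pathsE; split => //.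
  by apply: path_inS pg => y; left.
have [g /pathsE[pg g0 g1]] := cV x z Vx Vz; exists g; apply/pathsE; split => //.
by apply: path_inS pg => y; right.
Qed.

(** * Transplanting the 4-sphere *)

Section locally_flat_image.
Context {R : realType} {T U : topologicalType} (A : set T) (B : set U) (f : T -> U) (g : U -> T).
Hypotheses (fg : is_homeo A B f g) (oA : open A) (oB : open B).

Lemma is_homeo_image_iff (S : set T) x : S `<=` A -> A x -> (S x <-> (f @` S) (f x)).
Proof.
move=> SA Ax; split=> [Sx|[y Sy fyx]]; first by exists x.
have [fP _ _ _] := fg; rewrite -(proj2 (fP x Ax)) -fyx.
by rewrite (proj2 (fP y (SA y Sy))).
Qed.

(** Flatness is local and moves chart by chart; compactness makes the image closed in the whole
    space and not just in [B]. *)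
Lemma locally_flat_image n k (S : set T) : compact S -> hausdorff_space U ->
  S `<=` A -> locally_flat_submanifold R n k S -> locally_flat_submanifold R n k (f @` S).
Proof.
move=> cS hU SA /locally_flatP[clS coS fS]; have [fP gP cf cg] := fg.
have cfS : {within S, continuous f} by exact: continuous_subspaceW cf.
apply/locally_flatP; split.
- by apply: (compact_closed hU); exact: continuous_compact.
- exact: connected_continuous_connected.
- move=> _ [x Sx <-]; apply: (locally_flat_at_transport A B f g fg oA oB n k S) => //.
  + by move=> y Ay; exact: is_homeo_image_iff.
  + exact: SA.
  + exact: fS.
Qed.

End locally_flat_image.

Lemma is_homeo_setC {T U : topologicalType} (f : T -> U) g (S : set T) :
  is_homeo [set: T] [set: U] f g -> is_homeo (~` S) (~` (f @` S)) f g.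
Proof.
move=> fg; have -> : ~` (f @` S) = f @` (~` S).
  apply/seteqP; split=> [y nSy|_ [z nSz <-] Sz].
    have [_ gP _ _] := fg; have [_ fgy] := gP y Logic.I.
    by exists (g y) => // Sgy; apply: nSy; exists (g y).
  by apply: nSz; apply/(is_homeo_image_iff _ _ _ _ fg S z).
exact: is_homeo_sub fg.
Qed.

Lemma Z_surface_homeo {R : realType} {T U : topologicalType} (f : T -> U) g (S : set T) :
  is_homeo [set: T] [set: U] f g -> compact [set: T] -> hausdorff_space U ->
  Z_surface R S -> Z_surface R (f @` S).
Proof.
move=> fg cT hU [fS [cC [x Cx px]]].
have cS : compact S.
  by case: fS => clS _ _; apply: subclosed_compact cT _.
have C' := is_homeo_setC f g S fg.
have [fP gP cf cg] := C'.
split; first exact: (locally_flat_image [set: T] [set: U] f g fg openT openT).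
split.
  apply: (path_connected_image (~` S) _ f cf cC).
  apply/seteqP; split=> [_ [z /fP[Cz _] <-]//|y /gP[Cy gy]].
  by exists (g y).
exists (f x); first by case: (fP x Cx).
exact: (pi1_isoZ_homeo _ _ f g x C' Cx).1.
Qed.

Section transplant.
Context {R : realType} {X : topologicalType}.
Notation S4 := (sphere R 4).
Notation N := (pole 4).
Context (O : set X) (psi : 'rV[R]_4 -> X) (phi : X -> 'rV[R]_4).
Hypotheses (hX : hausdorff_space X) (oO : open O)
  (hpsi : is_homeo [set: 'rV[R]_4] O psi phi).

Definition plant (x : S4) : X := psi (stereo 4 x).
Definition unplant (y : X) : S4 := unstereo 4 (phi y).

Lemma open_not_pole : open [set x : S4 | x <> N].
Proof.
have -> : [set x : S4 | x <> N] = ~` [set N] by [].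
apply: closed_openC; exact: (compact_closed (hausdorff_sphere 4) (compact_set1 (x := N))).
Qed.

Lemma plant_homeo : is_homeo [set x | x <> N] O plant unplant.
Proof.
apply: (is_homeo_comp [set x : S4 | x <> N] [set: 'rV[R]_4] O (stereo 4) (unstereo 4)
  psi phi _ hpsi); split.
- by move=> x xN; split => //; exact: stereoK.
- by move=> y _; split; [exact: unstereo_neq_pole|exact: unstereoK].
- exact: wcont_stereo.
- by apply: continuous_subspaceT; exact: cont_unstereo.
Qed.

Hypothesis (scX : simply_connected R X).

(* Near the pole, a ball is replaced by the complement [V] of the rest of the
   sphere in [X], which is simply connected as well. *)
Lemma Z_surface_plant (S : set S4) : Z_surface R S -> ~ S N ->
  (exists x, [/\ ~ S x, x <> N & pi1_isoZ R (~` S) x]) ->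
  Z_surface R (plant @` S).
Proof.
move=> [fS [cC _]] SN [x [Sx xN px]].
have [clS _ _] := fS.
have oC : open (~` S) by exact: closed_openC.
have [a [a01 aC]] := cap_nbhs 4 (~` S) oC SN.
have ep := plant_homeo; have [eP uP ce cu] := ep.
have a1 : a < 1 by case/andP: a01.
have SN' : S `<=` [set x | x <> N] by move=> z Sz zN; apply: SN; rewrite -zN.
have cS : compact S by apply: subclosed_compact (compact_sphere 4) _.
(* [K] is the sphere without a cap free of [S]: a compact set that contains [S] and misses the
   pole. *)
pose K := ~` cap 4 a.
have cK : compact K.
  apply: subclosed_compact (compact_sphere 4) _ => //.
  by apply: open_closedC; exact: open_cap.
have KN : K `<=` [set x | x <> N].
  by move=> z Kz zN; apply: Kz; rewrite zN; exact: cap_pole.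
pose V := ~` (plant @` K).
have oV : open V.
  apply: closed_openC; apply: (compact_closed hX); apply: continuous_compact cK.
  exact: continuous_subspaceW ce.
(* [A1] together with the cap is the complement of [S], and its copy [U] together with [V] is the
   complement of the copy of [S]. Both overlaps are the punctured cap. *)
pose A1 : set S4 := [set z | z <> N] `&` ~` S.
have oA1 : open A1 by apply: openI => //; exact: open_not_pole.
pose U := plant @` A1.
have oU : open U by exact: is_homeo_openI ep oO oC.
have pinj z w : z <> N -> w <> N -> plant z = plant w -> z = w.
  by move=> zN wN E; rewrite -(proj2 (eP z zN)) E; case: (eP w wN).
(* The argument 1 of [punct] stands for the sphere of dimension 1 + 3. *)
have punctI : A1 `&` cap 4 a = punct 1 a.
  apply/seteqP; split=> [z [[zN _] za]|z [za zN]]; first by split.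
  by split => //; split => //; exact: aC.
have VO : V `&` O = plant @` punct 1 a.
  apply/seteqP; split=> [y [Vy Oy]|_ [z [za zN] <-]].
    have [uy eu] := uP y Oy; exists (unplant y) => //; split => //.
    by apply: contrapT => ny; apply: Vy; exists (unplant y).
  split; last by case: (eP z zN).
  move=> [w Kw E]; have E' : w = z by apply: pinj => //; exact: KN.
  by apply: Kw; rewrite E'.
have VOU : V `|` O = [set: X].
  apply/seteqP; split=> // y _; have [Oy|nOy] := pselect (O y); [by right|left].
  by move=> [z Kz zy]; apply: nOy; rewrite -zy; case: (eP z (KN z Kz)).
have UV : U `&` V = plant @` punct 1 a.
  apply/seteqP; split=> [_ [[z [zN zS] <-] Vz]|_ [z [za zN] <-]].
    exists z => //; split => //; apply: contrapT => nz; apply: Vz.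
    by exists z.
  split; first by exists z => //; split => //; exact: aC.
  move=> [w Kw E]; have E' : w = z by apply: pinj => //; exact: KN.
  by apply: Kw; rewrite E'.
have UVM : U `|` V = ~` (plant @` S).
  apply/seteqP; split=> [y [[z [zN zS] <-]|Vy] [w Sw E]|y nSy].
  - have E' : w = z by apply: pinj => //; exact: SN'.
    by apply: zS; rewrite -E'.
  - by apply: Vy; exists w => //; move=> wc; exact: (aC w).
  - have [Oy|nOy] := pselect (O y).
      have [uy eu] := uP y Oy; left; exists (unplant y) => //; split => // Su.
      by apply: nSy; exists (unplant y).
    right => -[z Kz zy]; apply: nOy; rewrite -zy; case: (eP z (KN z Kz)) => //.
have ACN : A1 `|` cap 4 a = ~` S.
  apply/seteqP; split=> [z [[]//|/aC//]|z Sz].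
  have [->|zN] := pselect (z = N); [by right; exact: cap_pole|by left].
have hp : is_homeo (punct 1 a) (plant @` punct 1 a) plant unplant.
  by apply: is_homeo_sub ep => z [].
have [pP pQ cp cq] := hp.
have fp : fillable (R := R) (plant @` punct 1 a).
  apply: (fillable_retract _ _ plant cp _ unplant cq _ _ (fillable_punct 1 a a01)).
  - by move=> z /pP[].
  - by move=> y /pQ[].
  - by move=> y /pQ[].
have cpp : path_connected R (plant @` punct 1 a).
  exact: (path_connected_image _ _ plant cp (path_connected_punct 1 a a01)).
have pne : plant @` punct 1 a !=set0.
  by have [z za] := punct_ne 1 a a01; exists (plant z), z.
have [hP hQ ch ch'] := hpsi.
have fO : fillable (R := R) O.
  apply: (fillable_retract [set: 'rV[R]_4] O psi ch _ phi ch') => //.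
  - by move=> z /hP[].
  - by move=> y /hQ[].
  - by apply: (star_fillable _ 0).
have cO : path_connected R O.
  apply: (path_connected_image [set: 'rV[R]_4] O psi ch).
    by move=> v w _ _; exact: segment_path.
  apply/seteqP; split=> [_ [v /hP[Ov _] <-]//|y /hQ[_ E]].
  by exists (phi y).
have [cX [x1 x1t]] := scX.
have fX : fillable (R := R) [set: X].
  by apply: (simply_connected_fillable _ x1) => // g; exact: pi1_trivial_null.
(* Here [X] is the union of [V] and the ball [O], with the copy of the punctured cap as overlap. *)
have fV : fillable (R := R) V.
  by apply: (van_kampen_fillable V O) => //; rewrite ?VO// VOU.
have cV : path_connected R V.
  by apply: (van_kampen_path_connected V O) => //; rewrite ?VO// VOU.
have cA1 : path_connected R A1.
  apply: (van_kampen_path_connected A1 (cap 4 a)) => //; rewrite ?punctI ?ACN//.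
  - exact: open_cap.
  - exact: path_connected_punct.
  - exact: punct_ne.
  - exact: path_connected_cap.
  - exact: fillable_cap.
have hA1 : is_homeo A1 U plant unplant by apply: is_homeo_sub ep => z [].
have cU : path_connected R U.
  by have [_ _ c1 _] := hA1; exact: (path_connected_image A1 U plant c1).
have xA1 : A1 x by [].
have Ux : U (plant x) by exists x.
split; first exact: (locally_flat_image _ _ _ _ ep open_not_pole oO 4 2 S cS hX SN').
rewrite -UVM; split.
  by apply: path_connectedU => //; rewrite UV.
exists (plant x); first by left.
(* Read backwards, the isomorphism goes from the complement of [S] to [A1], by [plant] to [U], and
   on to the union of [U] and [V]; the base point [x] lies in [A1]. *)
apply: (van_kampen_isoZ U V _ _ _ _ _ _ _ _ _).1 => //; rewrite ?UV//.
apply: (pi1_isoZ_homeo A1 U plant unplant x hA1 xA1).1.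
apply: (van_kampen_isoZ A1 (cap 4 a) _ _ _ _ _ _ _ _ _).2 => //; rewrite ?punctI ?ACN//.
- exact: open_cap.
- exact: path_connected_punct.
- exact: punct_ne.
- exact: path_connected_cap.
- exact: fillable_cap.
- exact: fillable_punct.
Qed.

End transplant.

Lemma second_countable_set_type {X : topologicalType} (A : set X) :
  @second_countable X -> @second_countable (set_type A).
Proof.
move=> [B cB [oB bB]].
have cv : continuous (fun x : set_type A => set_val x) by apply: cont_val; exact: cont_id.
exists [set set_val @^-1` U | U in B]; first exact: card_le_trans (card_image_le _ _) cB.
split; first by move=> _ [U BU <-]; apply: open_comp (oB U BU) => x _; exact: cv.
move=> x P [_ [[W oW <-] /= Wx WP]].
have [U [BU Ux] UW] : filter_from [set U | B U /\ U (set_val x)] id W.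
  by apply: bB; exact: open_nbhs_nbhs.
exists (set_val @^-1` U); first by split => //; exists U.
by move=> y /UW /WP.
Qed.

(* A relatively clopen part of [C] disjoint from the connected set [C `&` D]
   is clopen in the whole space. *)
Lemma connected_side {X : topologicalType} (C D : set X) : connected [set: X] ->
  closed C -> closed D -> C `|` D = [set: X] -> connected (C `&` D) ->
  C `&` D !=set0 -> connected C.
Proof.
move=> cX clC clD CD cCD [z [Cz Dz]] B B0 [W oW BW] [K cK BK].
(* Off [D] every point is in [C], so a relatively open [E] disjoint from [D] is open in [X]; it is
   closed as [C] is. Then [E] is all of [X], although [D] has a point. *)
have side (E : set X) : E !=set0 -> (exists2 C', open C' & E = C `&` C') ->
    (exists2 C', closed C' & E = C `&` C') -> E `&` D = set0 -> False.
  move=> E0 [W' oW' EW] [K' cK' EK] ED.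
  have ET : E = [set: X].
    apply: cX => //.
      exists (~` D `&` W'); first by apply: openI => //; exact: closed_openC.
      rewrite setTI; apply/seteqP; split=> x.
        move=> Ex; split; last by move: Ex; rewrite EW => -[].
        by move=> Dx; have : (E `&` D) x by []; rewrite ED.
      move=> [nDx W'x]; rewrite EW; split => //.
      have : (C `|` D) x by rewrite CD.
      by case.
    by exists E; [rewrite EK; exact: closedI|rewrite setTI].
  have : (E `&` D) z by rewrite ET.
  by rewrite ED.
(* Either [B] misses [D], or it contains the whole connected intersection of [C] and [D], and then
   the rest of [C] misses [D]. *)
have [[x [Bx Dx]]|noBD] := pselect ((B `&` D) !=set0); last first.
  exfalso; apply: (side B) => //; [by exists W|by exists K|].
  by apply/seteqP; split=> // x BDx; apply: noBD; exists x.
have sub : C `&` D `<=` B.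
  have : B `&` D = C `&` D.
    apply: cCD; first by exists x.
      by exists W => //; rewrite BW setIAC.
    by exists K => //; rewrite BK setIAC.
  by move=> <- y [].
apply/seteqP; split=> [y|y Cy]; first by rewrite BW => -[].
apply: contrapT => nBy; apply: (side (C `&` ~` B)).
- by exists y.
- exists (~` K); first exact: closed_openC.
  by rewrite BK; apply/seteqP; split=> w [Cw h]; split => // h'; apply: h => //; case: h'.
- exists (~` W); first exact: open_closedC.
  by rewrite BW; apply/seteqP; split=> w [Cw h]; split => // h'; apply: h => //; case: h'.
- by apply/seteqP; split=> // w [[Cw nBw] Dw]; apply: nBw; exact: sub.
Qed.

(** * Replacing the first piece of the 4-sphere inside [X] *)

Section pieces.
Context {R : realType}.
Notation S4 := (sphere R 4).
Notation N := (pole (R := R) 4).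
Notation bd Y := (manifold_boundary R 4 Y).
Context {Y : bool -> topologicalType} (f : forall b, sphere R 3 -> Y b)
  (i : forall b, Y b -> S4) (p : Y true) {X : topologicalType}
  (O : set X) (psi : 'rV[R]_4 -> X) (phi : X -> 'rV[R]_4).
Hypotheses (fY : forall b, sphere_bounded R (f b)) (fi : is_gluing f i)
  (pN : i true p = N) (pbd : ~ bd (Y true) p)
  (mX : closed_manifold R 4 X) (oO : open O)
  (hpsi : is_homeo [set: 'rV[R]_4] O psi phi).

Let e := plant psi.

Let hX : hausdorff_space X. Proof. by case: mX => -[]. Qed.
Let cptX : compact [set: X]. Proof. by case: mX => -[]. Qed.
Let hY b : hausdorff_space (Y b). Proof. by case: (fY b) => -[]. Qed.
Let cptY b : compact [set: Y b]. Proof. by case: (fY b) => -[]. Qed.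

Let ee : is_homeo [set x | x <> N] O e (unplant phi).
Proof. exact: plant_homeo. Qed.

Let einj z w : z <> N -> w <> N -> e z = e w -> z = w.
Proof.
have [eP _ _ _] := ee.
by move=> zN wN E; rewrite -(proj2 (eP z zN)) E; case: (eP w wN).
Qed.

Let bdE b : bd (Y b) = range (f b).
Proof.
have [_ /homeomorphismE[k [fP kP _ _]]] := fY b.
apply/seteqP; split=> [y /kP[_ fk]|_ [x _ <-]]; first by exists (k y).
by case: (fP x Logic.I).
Qed.

Let cont_f b : continuous (f b).
Proof. by have [_ [_ h _]] := fY b; exact/continuous_subspace_setT. Qed.

Let inj_f b : injective (f b).
Proof.
have [_ /homeomorphismE[k [fP _ _ _]]] := fY b.
by move=> s t st; rewrite -(proj2 (fP s Logic.I)) st; case: (fP t Logic.I).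
Qed.

Let cont_i b : continuous (i b). Proof. by case: fi. Qed.
Let inj_i b : injective (i b). Proof. by case: fi. Qed.

Let ifalse_neqN y : i false y <> N.
Proof.
move=> yN; apply: pbd; have [_ _ _ _ iover] := fi.
by have [|s [-> _]] := iover p y; [rewrite pN yN|rewrite bdE; exists s].
Qed.

Let itrue_neqN y : y <> p -> i true y <> N.
Proof. by move=> yp yN; apply: yp; apply: (@inj_i true); rewrite yN pN. Qed.

Let f_neqp s : f true s <> p.
Proof. by move=> E; apply: pbd; rewrite bdE -E; exists s. Qed.

(* The part of [X] that replaces [Y true]. *)
Let C : set X := [set y | forall w, ~ bd (Y false) w -> y <> e (i false w)].

Let D : set X := (e \o i false) @` [set: Y false].

Let cont_ei : continuous (fun y => e (i false y)).
Proof.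
apply/continuous_subspace_setT; have [_ _ ce _] := ee.
apply: (wcont_comp [set: Y false] [set x | x <> N] _ _ _ _ ce).
  by apply: continuous_subspaceT; exact: cont_i.
by move=> y _; exact: ifalse_neqN.
Qed.

Let clD : closed D.
Proof.
apply: (compact_closed hX); apply: continuous_compact (cptY false).
by apply: continuous_subspaceT; exact: cont_ei.
Qed.

Let clC : closed C.
Proof.
have [_ _ icov istep iover] := fi.
have oT : open (~` range (i true)).
  apply: closed_openC; apply: (compact_closed (hausdorff_sphere 4)).
  by apply: continuous_compact (cptY true); apply: continuous_subspaceT; exact: cont_i.
(* The interior of the second piece is rewritten as the complement of the first, which is open
   because the first piece is compact. *)
have -> : C = ~` (e @` ([set x | x <> N] `&` ~` range (i true))).
  apply/seteqP; split=> [y Cy [z [zN zi] zy]|y nE w wbd yE].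
    have [[] [w zw]] := icov z; first by apply: zi; exists w.
    apply: (Cy w); last by rewrite -zw.
    rewrite bdE => -[s _ sw]; apply: zi; exists (f true s) => //.
    by rewrite istep sw -zw.
  apply: nE; exists (i false w) => //; split; first exact: ifalse_neqN.
  by move=> [v _ /iover[s [_ ws]]]; apply: wbd; rewrite bdE ws; exists s.
apply: open_closedC; exact: is_homeo_openI ee oO oT.
Qed.

Let CT y : y <> p -> C (e (i true y)).
Proof.
have [_ _ _ _ iover] := fi.
move=> yp w wbd E; apply: wbd.
have E' : i true y = i false w.
  by apply: einj => //; exact: itrue_neqN.
by have [s [_ ->]] := iover _ _ E'; rewrite bdE; exists s.
Qed.

Let CO y : C y -> O y -> exists2 w, w <> p & e (i true w) = y.
Proof.
move=> Cy Oy; have [_ uP _ _] := ee; have [uN eu] := uP y Oy.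
have [_ _ icov istep _] := fi.
have [[] [w zw]] := icov (unplant phi y).
  by exists w; [move=> wp; apply: uN; rewrite /= zw wp|rewrite -zw].
have [wbd|nwbd] := pselect (bd (Y false) w); last first.
  by exfalso; apply: (Cy w nwbd); rewrite -zw.
rewrite bdE in wbd; have [s _ sw] := wbd; exists (f true s); first exact: f_neqp.
by rewrite istep sw -zw.
Qed.

Let CDI : C `&` D = (fun s => e (i true (f true s))) @` [set: sphere R 3].
Proof.
have [_ _ _ istep _] := fi.
apply/seteqP; split=> [y [Cy [w _ wy]]|_ [s _ <-]].
  have wbd : bd (Y false) w by apply: contrapT => nw; exact: (Cy w nw (esym wy)).
  by rewrite bdE in wbd; have [s _ sw] := wbd; exists s => //; rewrite istep sw.
split; first by apply: CT; exact: f_neqp.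
by exists (f false s) => //=; rewrite istep.
Qed.

Let CDU : C `|` D = [set: X].
Proof.
apply/seteqP; split=> // y _; have [Dy|nDy] := pselect (D y); [by right|left].
by move=> w _ yE; apply: nDy; exists w.
Qed.

Let cont_eif : continuous (fun s => e (i true (f true s))).
Proof.
apply/continuous_subspace_setT; have [_ _ ce _] := ee.
apply: (wcont_comp [set: sphere R 3] [set x | x <> N] (fun s => i true (f true s)) _ _ _ ce).
  by apply: continuous_subspaceT; apply: cont_comp; [exact: cont_f|exact: cont_i].
by move=> s _; apply: itrue_neqN; exact: f_neqp.
Qed.

Let connC : connected C.
Proof.
have cX : connected [set: X] by case: mX => -[].
apply: (connected_side C D cX clC clD CDU).
- rewrite CDI; apply: connected_continuous_connected; first exact: (connected_sphere 1).
  by apply: continuous_subspaceT; exact: cont_eif.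
- by rewrite CDI; exists (e (i true (f true (pole 3)))), (pole 3).
Qed.

Let d0 : set_type C :=
  exist _ (e (i true (f true (pole 3)))) (mem_set (CT (f true (pole 3)) (f_neqp (pole 3)))).

(** The inclusion of the old first piece into the new one; its value at [p] carries no meaning. *)
Let q (y : Y true) : set_type C := to_sub d0 (e (i true y)).

Let qE y : y <> p -> set_val (q y) = e (i true y).
Proof. by move=> yp; apply: to_subK; exact: CT. Qed.

Let oYp : open [set y : Y true | y <> p].
Proof.
apply: (closed_openC (D := [set p])).
exact: (compact_closed (@hY true) (compact_set1 (x := p))).
Qed.

Let oBO : open (set_val @^-1` O : set (set_type C)).
Proof.
apply: open_comp => // x _; apply: (cont_val (fun y => y)); exact: cont_id.
Qed.

(** One of the two open sets that cover the new piece. The other is the complement of [D], treated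
    in [v_homeo]; they cover because [D] lies in [O]. Charts and boundary points are read off from
    [Y true] on the first and from [X] on the second. *)
Let q_homeo : exists q', is_homeo [set y | y <> p] (set_val @^-1` O) q q'.
Proof.
have [i' hi] := compact_is_homeo (i true) (cptY true) (hausdorff_sphere 4) (cont_i true) (@inj_i true) p.
have h1 := is_homeo_sub _ [set y | y <> p] _ _ _ (fun y _ => Logic.I) hi.
have s2 : i true @` [set y | y <> p] `<=` [set x | x <> N].
  by move=> _ [y yp <-]; exact: itrue_neqN.
have h2 := is_homeo_sub _ _ _ _ _ s2 ee.
have s3 : e @` (i true @` [set y | y <> p]) `<=` C.
  by move=> _ [_ [y yp <-] <-]; exact: CT.
have h3 := is_homeo_sub _ _ _ _ _ s3 (is_homeo_sym _ _ _ _ (is_homeo_val C d0)).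
exists ((i' \o unplant phi) \o set_val).
have -> : set_val @^-1` O = to_sub d0 @` (e @` (i true @` [set y | y <> p])).
  apply/seteqP; split=> [y /= Oy|_ [_ [_ [y yp <-] <-] <-]].
    have [w wp wy] := CO (set_val y) (valP_set y) Oy.
    exists (set_val y); last exact: val_subK.
    by exists (i true w) => //; exists w.
  rewrite /= to_subK; last exact: CT.
  by case: ee => /(_ (i true y) (itrue_neqN y yp))[].
exact: is_homeo_comp (is_homeo_comp _ _ _ _ _ _ _ h1 h2) h3.
Qed.

Let v_homeo : is_homeo (~` D) (set_val @^-1` (~` D)) (to_sub d0) (set_val (A := C)).
Proof.
have s : ~` D `<=` C.
  move=> y nDy; have : (C `|` D) y by rewrite CDU.
  by case.
have h := is_homeo_sub _ _ _ _ _ s (is_homeo_sym _ _ _ _ (is_homeo_val C d0)).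
suff -> : set_val @^-1` (~` D) = to_sub d0 @` (~` D) by [].
apply/seteqP; split=> [y /= nDy|_ [y nDy <-]].
  by exists (set_val y) => //; exact: val_subK.
by rewrite /= to_subK//; exact: s.
Qed.

Let oD : open (~` D). Proof. exact: closed_openC. Qed.

Let oBD : open (set_val @^-1` (~` D) : set (set_type C)).
Proof. by apply: open_comp => // x _; apply: (cont_val (fun y => y)); exact: cont_id. Qed.

Let DO : D `<=` O.
Proof.
by move=> _ [w _ <-]; case: ee => /(_ (i false w) (ifalse_neqN w))[].
Qed.

Definition new_f (s : sphere R 3) : set_type C := q (f true s).

Let new_fE s : set_val (new_f s) = e (i true (f true s)).
Proof. by apply: qE; exact: f_neqp. Qed.

Let cont_new_f : continuous new_f.
Proof. by apply: cont_sub; under eq_fun do rewrite new_fE; exact: cont_eif. Qed.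

Let bd_new : bd (set_type C) = range new_f.
Proof.
have [q' hq] := q_homeo; have [qP qQ _ _] := hq.
apply/seteqP; split=> [y yb|_ [s _ <-]]; last first.
  apply: (manifold_boundary_transport _ _ q q' hq) => //; first exact: f_neqp.
  by rewrite bdE; exists s.
have [Oy|nOy] := pselect (O (set_val y)).
  have : bd (Y true) (q' y).
    exact: (manifold_boundary_transport _ _ q' q (is_homeo_sym _ _ _ _ hq)).
  rewrite bdE => -[s _ sy]; exists s => //.
  by rewrite /new_f sy; case: (qQ y Oy).
(* Off [O] the new piece looks locally like [X], which has no boundary. *)
exfalso; have [_ bX0] := mX; suff : bd X (set_val y) by rewrite bX0.
apply: (manifold_boundary_transport _ _ _ _ (is_homeo_sym _ _ _ _ v_homeo)) => //.
by move=> /DO.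
Qed.

Let bounded_new : sphere_bounded R new_f.
Proof.
have hC : hausdorff_space (set_type C) by exact: hausdorff_set_type.
split.
  split => //.
  - by apply: second_countable_set_type; case: mX => -[].
  - apply: (compact_set_type _ d0); exact: subclosed_compact clC cptX _.
  - have -> : [set: set_type C] = to_sub d0 @` C.
      apply/seteqP; split=> // x _; exists (set_val x); first exact: valP_set.
      exact: val_subK.
    by apply: connected_continuous_connected; [exact: connC|exact: wcont_to_sub].
  - move=> y; have [Oy|nOy] := pselect (O (set_val y)).
      have [q' hq] := q_homeo; have [_ qQ _ _] := hq; have [yp qy] := qQ y Oy.
      rewrite -qy; apply: (has_chart_transport _ _ q q' hq) => //.
      by have [[_ _ _ _ ch] _] := fY true; exact: ch.
    have nDy : (~` D) (set_val y) by move=> /DO.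
    rewrite -(val_subK d0 y); apply: (has_chart_transport _ _ _ _ v_homeo) => //.
    by have [[_ _ _ _ ch] _] := mX; exact: ch.
apply/homeomorphismE; rewrite bd_new; apply: compact_is_homeo => //.
- exact: compact_sphere.
- move=> s t /(congr1 set_val); rewrite !new_fE => E.
  apply: (@inj_f true); apply: (@inj_i true); apply: einj => //;
    apply: itrue_neqN; exact: f_neqp.
- exact: (pole 3).
Qed.

Definition new_Y (b : bool) : topologicalType :=
  if b return topologicalType then (set_type C : topologicalType) else Y false.

Definition new_gluing (b : bool) : sphere R 3 -> new_Y b :=
  if b return sphere R 3 -> new_Y b then new_f else f false.

Definition new_i (b : bool) : new_Y b -> X :=
  if b return new_Y b -> X then set_val else fun y => e (i false y).

Lemma new_bounded b : sphere_bounded R (new_gluing b).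
Proof. by case: b; [exact: bounded_new|exact: fY]. Qed.

Lemma new_is_gluing : is_gluing new_gluing new_i.
Proof.
have [_ _ _ istep _] := fi.
split.
- case; last exact: cont_ei.
  by apply: (cont_val (fun y : set_type C => y)); exact: cont_id.
- case=> y y' E; first exact: val_inj.
  by apply: (@inj_i false); apply: einj E; exact: ifalse_neqN.
- move=> z; have [Cz|nCz] := pselect (C z).
    by exists true, (to_sub d0 z); rewrite /= to_subK.
  have : (C `|` D) z by rewrite CDU.
  by move=> [//|[w _ wz]]; exists false, w.
- by move=> s; rewrite /= new_fE istep.
- move=> /= y y' E.
  have : (C `&` D) (set_val y) by split; [exact: valP_set|rewrite E; exists y'].
  rewrite CDI => -[s _ sy]; exists s; split.
    by apply: val_inj; change (set_val y = set_val (new_f s)); rewrite new_fE.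
  apply: (@inj_i false); apply: einj; [exact: ifalse_neqN|exact: ifalse_neqN|].
  by rewrite -E -sy istep.
Qed.

Section surfaces.
Context (F : forall b, set (Y b)) (K : set (sphere R 3)).
Hypotheses (fF : forall b, locally_flat_submanifold R 4 2 (F b))
  (FK : forall b, F b `&` bd (Y b) = f b @` K) (pF : ~ F true p).

Definition new_F (b : bool) : set (new_Y b) :=
  if b return set (new_Y b) then q @` F true else F false.

Let Fp y : F true y -> y <> p.
Proof. by move=> Fy E; apply: pF; rewrite -E. Qed.

Lemma new_flat b : locally_flat_submanifold R 4 2 (new_F b).
Proof.
case: b; last exact: fF.
have [q' hq] := q_homeo.
apply: (locally_flat_image _ _ q q' hq) => //.
  by have [cF _ _] := fF true; apply: subclosed_compact cF (@cptY true) _.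
exact: hausdorff_set_type.
Qed.

Lemma new_FK b : new_F b `&` bd (new_Y b) = new_gluing b @` K.
Proof.
case: b; last exact: FK.
have qinj y y' : y <> p -> y' <> p -> q y = q y' -> y = y'.
  move=> yp y'p /(congr1 set_val); rewrite !qE// => E.
  by apply: (@inj_i true); apply: einj E; exact: itrue_neqN.
rewrite /= bd_new; apply/seteqP; split=> [_ [[y Fy <-] [s _ E]]|_ [s Ks <-]].
  have ys : y = f true s by apply: qinj; [exact: Fp|exact: f_neqp|].
  have : (F true `&` bd (Y true)) y by split => //; rewrite bdE ys; exists s.
  rewrite FK ys => -[t Kt /inj_f ts]; rewrite -ts; by exists t.
have [Fs _] : (F true `&` bd (Y true)) (f true s) by rewrite FK; exists s.
by split; [exists (f true s)|exists s].
Qed.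

Lemma new_union : \bigcup_b (new_i b @` new_F b) = e @` (\bigcup_b (i b @` F b)).
Proof.
apply/seteqP; split=> [_ [[] _ [y Fy <-]]|_ [_ [[] _ [y Fy <-]] <-]].
- have [w Fw <-] := Fy; exists (i true w); first by exists true => //; exists w.
  by rewrite /= qE//; exact: Fp.
- by exists (i false y) => //; exists false => //; exists y.
- exists true => //; exists (q y); first by exists y.
  by rewrite /= qE//; exact: Fp.
- by exists false => //; exists y.
Qed.

End surfaces.

(** The new decomposition is fixed before the surface, which then has to avoid [p]. As the new
    surface is the planted copy of the old one, genus and complement can be compared inside [X]. *)
Lemma transplant_pieces : exists (Y' : bool -> topologicalType)
    (f' : forall b, sphere R 3 -> Y' b) (i' : forall b, Y' b -> X),
  [/\ forall b, sphere_bounded R (f' b), is_gluing f' i', [set: Y' true] !=set0 &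
    forall (F : forall b, set (Y b)) K,
      (forall b, locally_flat_submanifold R 4 2 (F b)) ->
      (forall b, F b `&` bd (Y b) = f b @` K) -> ~ F true p ->
      exists F' : forall b, set (Y' b),
        [/\ forall b, locally_flat_submanifold R 4 2 (F' b),
            forall b, F' b `&` bd (Y' b) = f' b @` K &
            \bigcup_b (i' b @` F' b) = plant psi @` (\bigcup_b (i b @` F b))]].
Proof.
exists new_Y, new_gluing, new_i; split.
- exact: new_bounded.
- exact: new_is_gluing.
- by exists d0.
- move=> F K fF FK pF; exists (new_F F); split.
  + exact: new_flat.
  + exact: new_FK.
  + exact: new_union.
Qed.

End pieces.

Lemma hausdorff_injective {T U : topologicalType} (f : T -> U) :
  continuous f -> injective f -> hausdorff_space U -> hausdorff_space T.
Proof.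
move=> cf injf hU x y xy; apply/injf/hU => B C xB yC.
by have [z [Bz Cz]] := xy _ _ (cf x B xB) (cf y C yC); exists (f z).
Qed.

Lemma is_homeo_injective {T U : topologicalType} (f : T -> U) g :
  is_homeo [set: T] [set: U] f g -> injective f.
Proof.
move=> [fP _ _ _] x y xy.
by rewrite -(proj2 (fP x Logic.I)) xy; case: (fP y Logic.I).
Qed.

Lemma is_homeo_continuous {T U : topologicalType} (f : T -> U) g :
  is_homeo [set: T] [set: U] f g -> continuous f.
Proof. by move=> [_ _ cf _]; exact/continuous_subspace_setT. Qed.

(** * Transplanting a decomposition and comparing genera *)

Section main.
Context {R : realType}.

Lemma sphere_bounded_inj {Y : topologicalType} (f : sphere R 3 -> Y) :
  sphere_bounded R f -> injective f.
Proof.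
move=> [_ /homeomorphismE[k [fP _ _ _]]] s t st.
by rewrite -(proj2 (fP s Logic.I)) st; case: (fP t Logic.I).
Qed.

Lemma sphere_bounded_bd {Y : topologicalType} (f : sphere R 3 -> Y) s :
  sphere_bounded R f -> manifold_boundary R 4 Y (f s).
Proof. by move=> [_ /homeomorphismE[k [fP _ _ _]]]; case: (fP s Logic.I). Qed.

Lemma image_glue_sets {S : Type} {Y : bool -> topologicalType} (f : forall b, S -> Y b)
    {Z : Type} (h : Defs.glue f -> Z) (F : forall b, set (Y b)) :
  h @` glue_sets f F = \bigcup_b ((fun y => h (glue_in f b y)) @` F b).
Proof.
apply/seteqP; split=> [_ [_ [b _ [y Fy <-]] <-]|_ [b _ [y Fy <-]]].
  by exists b => //; exists y.
by exists (glue_in f b y) => //; exists b => //; exists y.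
Qed.

Lemma glued_genus_transplant (K : set (sphere R 3)) (X : topologicalType)
    (Y : bool -> topologicalType) (f : forall b, sphere R 3 -> Y b)
    (F : forall b, set (Y b)) (g : nat) :
  knot R K -> closed_manifold R 4 X -> simply_connected R X ->
  (forall b, sphere_bounded R (f b)) ->
  homeomorphic [set: sphere R 4] [set: Defs.glue f] ->
  (forall b, locally_flat_submanifold R 4 2 (F b)) ->
  (forall b, F b `&` manifold_boundary R 4 (Y b) = f b @` K) ->
  Z_surface R (glue_sets f F) -> has_genus R (glue_sets f F) g ->
  exists (Y' : bool -> topologicalType) (f' : forall b, sphere R 3 -> Y' b)
      (F' : forall b, set (Y' b)),
    [/\ forall b, sphere_bounded R (f' b),
        homeomorphic [set: X] [set: Defs.glue f'] &
        [/\ forall b, locally_flat_submanifold R 4 2 (F' b),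
            forall b, F' b `&` manifold_boundary R 4 (Y' b) = f' b @` K,
            Z_surface R (glue_sets f' F') & has_genus R (glue_sets f' F') g]].
Proof.
move=> hK mX scX fY [k0 /homeomorphismE[h0 hk0]] fF FK ZS gS.
have finj b : injective (f b) by exact: sphere_bounded_inj (fY b).
have [_ [_ [x0 x0S x0Z]]] := ZS.
have [p [pbd pF px0]] : exists p, [/\ ~ manifold_boundary R 4 (Y true) p, ~ F true p &
    glue_in f true p <> x0].
  (* [y0] is the point of the first piece over the base point [x0], or a dummy if [x0] is not in
     that piece. Choosing [p] away from it keeps the base point in the punctured sphere. *)
  have [y0 y0P] : exists y0, forall y, glue_in f true y = x0 -> y = y0.
    have [[y0 yx]|ny] := pselect (exists y0, glue_in f true y0 = x0).
      by exists y0 => y yx'; apply: (glue_in_inj f finj); rewrite yx.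
    by exists (f true (pole 3)) => y yx; exfalso; apply: ny; exists y.
  have [p [pbd pF pn]] := interior_point (f true) K (F true) y0 (fY true) hK (fF true) (FK true).
  by exists p; split => // /y0P.
(* The given homeomorphism with the 4-sphere is corrected by a reflection, so that [p] goes to the
   pole. *)
pose w := set_val (h0 (glue_in f true p)) - pole_vec 4.
pose h z := reflect_sphere 4 w (h0 z); pose k x := k0 (reflect_sphere 4 w x).
have hr : is_homeo [set: sphere R 4] [set: sphere R 4] (reflect_sphere 4 w) (reflect_sphere 4 w).
  split; try by move=> x _; split => //; exact: reflectK.
    by apply: continuous_subspaceT; exact: cont_reflect.
  by apply: continuous_subspaceT; exact: cont_reflect.
have hk : is_homeo [set: Defs.glue f] [set: sphere R 4] h k.
  exact: is_homeo_comp (is_homeo_sym _ _ _ _ hk0) hr.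
have pN : h (glue_in f true p) = pole 4 by exact: reflect_to_pole.
have cG : compact [set: Defs.glue f].
  have -> : [set: Defs.glue f] = k @` [set: sphere R 4].
    by apply/seteqP; split=> // z _; exists (h z) => //; case: hk => /(_ z Logic.I)[].
  apply: continuous_compact (compact_sphere 4).
  by case: hk.
have fi := is_gluing_homeo f h k finj hk.
have [_ iinj _ _ iover] := fi.
set S := h @` glue_sets f F.
have SE : S = \bigcup_b ((fun y => h (glue_in f b y)) @` F b) by exact: image_glue_sets.
have ZS' : Z_surface R S by exact: Z_surface_homeo hk cG (hausdorff_sphere 4) ZS.
have SN : ~ S (pole 4).
  rewrite SE -pN => -[[] _ [y Fy E]].
    by apply: pF; rewrite -(iinj true _ _ E).
  have [s [ps _]] := iover _ _ (esym E).
  by apply: pbd; rewrite ps; exact: sphere_bounded_bd.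
have hC := is_homeo_setC h k (glue_sets f F) hk.
have [x1 _] : exists x : X, True by have [_ [x _]] := scX; exists x.
have [B [psi [phi [oB hpsi]]]] := euclidean_chart X x1 mX.
have hX : hausdorff_space X by case: mX => -[].
have cX : compact [set: X] by case: mX => -[].
have ZP : Z_surface R (plant psi @` S).
  apply: (Z_surface_plant B psi phi hX oB hpsi scX S ZS' SN).
  exists (h x0); split.
  - by case: hC => /(_ x0 x0S)[].
  - by rewrite -pN => /(is_homeo_injective _ _ hk) E; apply: px0.
  - exact: (pi1_isoZ_homeo _ _ h k x0 hC x0S).1.
have [Y' [f' [i' [fY' fi' [t' _] FP]]]] := transplant_pieces f (fun b y => h (glue_in f b y)) p
  B psi phi fY fi pN pbd mX oB hpsi.
have [F' [fF' FK' FE]] := FP F K fF FK pF.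
have cY' b : compact [set: Y' b] by case: (fY' b) => -[].
have [h' [k' [hk' h'E]]] := is_gluing_glue f' i' cY' hX t' fi'.
have kh' := is_homeo_sym _ _ _ _ hk'.
have hG' : hausdorff_space (Defs.glue f').
  exact: hausdorff_injective (is_homeo_continuous _ _ hk') (is_homeo_injective _ _ hk') hX.
have S'E : h' @` glue_sets f' F' = plant psi @` S.
  rewrite image_glue_sets SE -FE; apply: eq_bigcupr => b _.
  by apply/seteqP; split=> _ [y Fy <-]; exists y; rewrite ?h'E.
have S'E' : glue_sets f' F' = k' @` (plant psi @` S).
  rewrite -S'E; have [hP _ _ _] := hk'.
  apply/seteqP; split=> [z Sz|_ [_ [z Sz <-] <-]].
    by exists (h' z); [exists z|case: (hP z Logic.I)].
  by rewrite (proj2 (hP z Logic.I)).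
exists Y', f', F'; split => //.
  by exists k'; apply/homeomorphismE; exists h'.
split => //; first by rewrite S'E'; exact: Z_surface_homeo kh' cX hG' ZP.
(* The genus depends on the homeomorphism type of the surface alone; [h], [plant psi] and [k']
   compose to a homeomorphism between the two surfaces. *)
have [m /homeomorphismE[m' hm]] := gS.
have SN' : S `<=` [set x | x <> pole 4] by move=> z Sz zN; apply: SN; rewrite -zN.
have c1 := is_homeo_sub _ (glue_sets f F) _ _ _ (fun _ _ => Logic.I) hk.
have c2 := is_homeo_sub _ _ _ _ _ SN' (plant_homeo B psi phi hpsi).
have c3 := is_homeo_sub _ (plant psi @` S) _ _ _ (fun _ _ => Logic.I) kh'.
rewrite -S'E' in c3.
have c := is_homeo_comp _ _ _ _ _ _ _ (is_homeo_comp _ _ _ _ _ _ _ c1 c2) c3.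
eexists; apply/homeomorphismE; eexists.
exact: is_homeo_comp (is_homeo_sym _ _ _ _ c) hm.
Qed.

End main.

Theorem theorem5p1 (R : realType) (K : set (sphere R 3)) (X : topologicalType)
    (hK : knot R K) (hX : closed_manifold R 4 X)
    (hXsc : simply_connected R X) :
  (double_slice_genus R X K <= double_slice_genus R (sphere R 4) K)%E.
Proof.
(* Both infima on the right are tested on their elements: a genus realised in the 4-sphere is
   realised in a decomposition of [X]. A decomposition without any such genus has the value [+oo],
   and there is nothing to test. *)
apply/ereal_infP => _ [Y [f [fY hf ->]]].
apply/ereal_infP => _ [g [F [fF FK ZS gS]] <-].
have [Y' [f' [F' [fY' hf' F'P]]]] :=
  glued_genus_transplant K X Y f F g hK hX hXsc fY hf fF FK ZS gS.
apply: ge_ereal_inf; exists (glued_genus R f' K); first by exists Y', f'.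
by apply: ge_ereal_inf; exists (g%:R)%:E => //; exists g => //; exists F'; case: F'P.
Qed.
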